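(* The quadratic operad $\mathrm{M}\mathcal{A}ss$ is Koszul.
   Context: $k$ is a field, normally assumed to be $\mathbb{Q}$. **The operad $\mathrm{M}\mathcal{A}ss$.** A Möbius corolla with $n$ inputs is a tree with one vertex and $n+1$ legs labelled $1,\dots,n+1$ (leg $n+1$ is the root), with a cyclic ordering of the legs and a colouring of the legs by $\{0,1\}$; two are isomorphic if they agree, or if one is obtained from the other by simultaneously reversing the cyclic ordering and switching all colours (reflection). $\mathrm{M}\mathcal{A}ss(n)$, $n\geq1$, is the $k$-vector space spanned by isomorphism classes of Möbius corollas with $n$ inputs; $S_n$ relabels inputs. Composition $\circ_i$ glues the root of the second corolla to the $i$-th input of the first and contracts the resulting edge: if the two half edges of the edge have the same colour, the two cyclic orderings are merged in the evident way keeping all other colours; if they have different colours, one of the vertices is first reflected. Then $K:=\mathrm{M}\mathcal{A}ss(1)=k[\mathbb{Z}_2]=\langle1,a\rangle/(a^2=1)$, and $\mathrm{M}\mathcal{A}ss$ is the quotient of the free operad over $K$ generated by the $(K,K^{\otimes 2})$-bimodule $E=\mathrm{M}\mathcal{A}ss(2)$ by the associativity relation, so it is quadratic. **Quadratic dual.** For a quadratic operad $\mathcal P=\mathcal P(K,E,R)=F(E)/(R)$ ($K$ semisimple, $E$ a finite dimensional $(K,K^{\otimes2})$-bimodule with compatible $S_2$-action, $R\subset F(E)(3)$ an $S_3$-stable sub-bimodule), $\mathcal P^!=\mathcal P(K^{op},E^\vee,R^\perp)$, where $E^\vee=\mathrm{Hom}_K(E,K)\otimes\mathrm{sgn}_2$.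 **Dual dg operad and Koszulness.** For an operad $\mathcal P$ with finite dimensional $\mathcal P(n)$ in degree $0$ and $\mathcal P(1)=K$ semisimple, the cobar construction $C(\mathcal P)$ has, for $n\ge2$, $$C(\mathcal P)(n)^s=\bigoplus_{T,\ |T|=s-1}\mathcal P(T)^*\otimes\det(T),$$ the sum over isomorphism classes of reduced trees with $n$ inputs (all vertices of valence at least $3$), $|T|$ the number of internal edges, $\mathcal P(T)$ the space of $\mathcal P$-decorations of $T$ with tensor products over $K$, $\mathcal{P}(T)^*=\mathrm{Hom}_K(\mathcal{P}(T),K)$ and $\det(T)$ the top exterior power of $k^{\mathrm{Edge}(T)}$. The differential is dual to the composition maps contracting one internal edge $e$ (tensored with $e\wedge-$); composition is grafting of trees. The dual dg operad is $\mathbf D\mathcal P=C(\mathcal P)\otimes\Lambda$, with $\Lambda(n)=k$ in degree $1-n$ carrying the sign representation. There is a morphism $\mathbf D\mathcal P\to\mathcal P^!$, given in degree $0$ by the quotient map $F(E^\vee)(n)\to\mathcal P^!(n)$; $\mathcal P$ is Koszul if it is a quasi-isomorphism, equivalently each complex $\mathbf D\mathcal P(n)$ is exact everywhere except at its right end (degree $0$). *)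

(* Defs.v *)
From HB Require Import structures.
From mathcomp Require Import all_boot all_order all_algebra.

Set Implicit Arguments.
Unset Strict Implicit.
Unset Printing Implicit Defensive.

Import GRing.Theory.
Local Open Scope ring_scope.

(** Operads in the language of finite sets:
    [op_sp P I] is the space of operations with inputs labelled by the finite
    set [I], so that P(n) is [op_sp P 'I_n] and the symmetric group action is
    [op_map P] along permutations of ['I_n].  The value on the empty set and
    the value of [op_map] along non-bijective maps are never used. *)

(** The inputs of x o_i y: those of x other than i, and those of y. *)
Definition graft (I J : finType) (i : I) : finType := ({x : I | x != i} + J)%type.

Record operad_data (k : fieldType) := OperadData {
  op_sp : finType -> vectType k;
  op_map : forall I J : finType, (I -> J) -> op_sp I -> op_sp J;
  op_unit : op_sp unit;
  op_comp : forall (I J : finType) (i : I),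
    op_sp I -> op_sp J -> op_sp (graft J i)
}.

Arguments op_map {k} o {I J} f x.

Lemma no_other_unit (u : {x : unit | x != tt}) : False.
Proof. by case: u => -[]. Qed.

Definition lunit_map (J : finType) (z : graft J tt) : J :=
  match z with inl u => False_rect J (no_other_unit u) | inr y => y end.

Definition runit_map (I : finType) (i : I) (z : graft unit i) : I :=
  match z with inl u => val u | inr _ => i end.

(** The maps below only forget the proofs carried by elements of iterated
    grafts; they are injective, and serve to say which bijections the operad
    axioms are about. *)
Definition gval (I J : finType) (i : I) (z : graft J i) : I + J :=
  match z with inl u => inl (val u) | inr y => inr y end.

Definition gval_right (I J L : finType) (i : I) (j : J)
    (z : graft (graft L j) i) : I + (J + L) :=
  match z with inl u => inl (val u) | inr w => inr (gval w) end.

(** [a] is either the input [inr j] of x o_i y, or another input [inl u']. *)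
Definition gval_left (I J L : finType) (i : I) (a : graft J i)
    (z : graft L a) : I + (J + L) :=
  match z with
  | inl u => match gval (val u) with inl x => inl x | inr y => inr (inl y) end
  | inr l => inr (inr l)
  end.

Definition swap_right (A B C : Type) (z : A + (B + C)) : A + (C + B) :=
  match z with
  | inl a => inl a
  | inr (inl b) => inr (inr b)
  | inr (inr c) => inr (inl c)
  end.

Section OperadTheory.
Variables (k : fieldType) (P : operad_data k).

Record is_operad : Prop := IsOperad {
  op_map_lin : forall (I J : finType) (f : I -> J), bijective f ->
    linear (op_map P f);
  op_map_idE : forall (I : finType) (f : I -> I), f =1 id ->
    forall x, op_map P f x = x;
  op_map_compE : forall (I J L : finType) (f : I -> J) (g : J -> L),
    bijective f -> bijective g ->
    forall x, op_map P g (op_map P f x) = op_map P (g \o f) x;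
  op_comp_linl : forall (I J : finType) (i : I) (y : op_sp P J),
    linear (fun x => op_comp i x y);
  op_comp_linr : forall (I J : finType) (i : I) (x : op_sp P I),
    linear (fun y : op_sp P J => op_comp i x y);
  op_equivariant : forall (I I' J J' : finType) (f : I -> I') (g : J -> J')
      (i : I) (h : graft J i -> graft J' (f i)),
    bijective f -> bijective g ->
    (forall z, gval (h z) =
       match gval z with inl x => inl (f x) | inr y => inr (g y) end) ->
    forall x y, op_map P h (op_comp i x y)
                = op_comp (f i) (op_map P f x) (op_map P g y);
  op_assoc_seq : forall (I J L : finType) (i : I) (j : J)
      (h : graft L (inr j : graft J i) -> graft (graft L j) i),
    (forall z, gval_right (h z) = gval_left z) ->
    forall x y z, op_map P h (op_comp (inr j : graft J i) (op_comp i x y) z)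
                  = op_comp i x (op_comp j y z);
  op_assoc_par : forall (I J L : finType) (i i' : I)
      (u' : {x : I | x != i}) (u : {x : I | x != i'})
      (h : graft L (inl u' : graft J i) -> graft J (inl u : graft L i')),
    val u' = i' -> val u = i ->
    (forall z, gval_left (h z) = swap_right (gval_left z)) ->
    forall x y z, op_map P h (op_comp (inl u' : graft J i) (op_comp i x y) z)
                  = op_comp (inl u : graft L i') (op_comp i' x z) y;
  op_unitl : forall (J : finType) (x : op_sp P J),
    op_map P (@lunit_map J) (op_comp tt (op_unit P) x) = x;
  op_unitr : forall (I : finType) (i : I) (x : op_sp P I),
    op_map P (@runit_map I i) (op_comp i x (op_unit P)) = x
}.

(** The algebra K = P(1) and its actions on operations; [lact] on K itself is
    the product of K. *)
Definition opK : vectType k := op_sp P unit.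

Definition lact (J : finType) (c : opK) (x : op_sp P J) : op_sp P J :=
  op_map P (@lunit_map J) (op_comp tt c x).

Definition ract (I : finType) (i : I) (x : op_sp P I) (c : opK) : op_sp P I :=
  op_map P (@runit_map I i) (op_comp i x c).

Definition left_ideal (U : {vspace opK}) : Prop :=
  forall c x : opK, x \in U -> lact c x \in U.

Definition semisimpleK : Prop :=
  forall U : {vspace opK}, left_ideal U ->
  exists V : {vspace opK},
    [/\ left_ideal V, (U + V)%VS = fullv & (U :&: V)%VS = 0%VS].

End OperadTheory.

(** A reduced tree with leaves [I] (#|I| >= 2) is encoded, up to isomorphism,
    by the family of the sets of leaves lying above each of its vertices: a
    laminar family of subsets of [I] with at least two elements, containing
    [I] (the root vertex).  The internal edges are the outgoing edges of the
    vertices other than the root vertex, and contracting an edge removes the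
    corresponding set. *)

Section Trees.
Variable I : finType.
Implicit Types (F : {set {set I}}) (S C : {set I}).

Definition is_tree F : bool :=
  [&& [set: I] \in F,
      [forall S in F, (1 < #|S|)%N] &
      [forall A in F, forall B in F,
         [|| A \subset B, B \subset A | [disjoint A & B]]]].

Definition rtree : finType := {F : {set {set I}} | is_tree F}.

(** The inputs of the vertex S: the outgoing edges of the vertices directly
    above S, and the leaves attached to S, given as singletons. *)
Definition kids F S : {set {set I}} :=
  [set C : {set I} | [&& C \proper S, (C \in F) || (#|C| == 1)%N &
     [forall D in F, (C \proper D) ==> ~~ (D \proper S)]]].

Definition inp F S : finType := {C : {set I} | C \in kids F S}.
Definition vert (T : rtree) : finType := {S : {set I} | S \in val T}.
Definition edge (T : rtree) : finType :=
  {S : {set I} | S \in val T :\ [set: I]}.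

Definition nvert (T : rtree) : nat := #|val T|.

Definition binary (T : rtree) : bool :=
  [forall v : vert T, #|kids (val T) (val v)| == 2]%N.

Lemma root_subproof (T : rtree) : [set: I] \in val T.
Proof. by case: T => F /= /and3P[]. Qed.

Definition root (T : rtree) : vert T := Sub [set: I] (root_subproof T).

Lemma top_subproof (T : rtree) (e : edge T) : val e \in val T.
Proof. by case: e => S /=; rewrite in_setD1 => /andP[]. Qed.

Definition top (T : rtree) (e : edge T) : vert T := Sub (val e) (top_subproof e).

Lemma contract_subproof (T : rtree) (e : edge T) : is_tree (val T :\ val e).
Proof.
case: T e => F treeF [S /=]; rewrite in_setD1 => /andP[SnT _] /=.
case/and3P: treeF => FT /'forall_implyP F2 /'forall_implyP Flam.
apply/and3P; split; first by rewrite in_setD1 eq_sym SnT.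
  by apply/'forall_implyP => A; rewrite in_setD1 => /andP[_ /F2].
apply/'forall_implyP => A; rewrite in_setD1 => /andP[_ /Flam/'forall_implyP FA].
by apply/'forall_implyP => B; rewrite in_setD1 => /andP[_ /FA].
Qed.

Definition contract (T : rtree) (e : edge T) : rtree :=
  Sub (val T :\ val e) (contract_subproof e).

Lemma old_subproof (T : rtree) (e : edge T) (v : vert (contract e)) :
  val v \in val T.
Proof. by case: v => S /=; rewrite in_setD1 => /andP[]. Qed.

Definition old (T : rtree) (e : edge T) (v : vert (contract e)) : vert T :=
  Sub (val v) (old_subproof v).

Lemma keep_subproof (T : rtree) (e : edge T) S C :
  val e \notin kids (val T) S -> C \in kids (val T) S ->
  C \in kids (val (contract e)) S.
Proof.
move=> eS CS; have Ce : C != val e by apply: contraNneq eS => <-.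
move: CS; rewrite !inE => /and3P[-> CF /'forall_implyP CD] /=.
rewrite Ce CF /=.
by apply/'forall_implyP => D; rewrite in_setD1 => /andP[_ /CD].
Qed.

Lemma merge_subproof (T : rtree) (e : edge T) S C :
  val e \in kids (val T) S ->
  C \in kids (val T) S :\ val e :|: kids (val T) (val e) ->
  C \in kids (val (contract e)) S.
Proof.
have eT := top_subproof e.
case: T e eT => F treeF [A /= _] AF; case/and3P: treeF => _.
move=> /'forall_implyP F2 /'forall_implyP Flam.
rewrite !inE => /and3P[AS _ /'forall_implyP AD] /orP[].
  case/andP=> CA /and3P[-> CF /'forall_implyP CD].
  rewrite CA CF /=.
  by apply/'forall_implyP => D; rewrite in_setD1 => /andP[_ /CD].
case/and3P=> CA CF /'forall_implyP CD.
rewrite (proper_trans CA AS) (proper_neq CA) CF /=.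
apply/'forall_implyP => D; rewrite in_setD1 => /andP[DA DF].
apply/implyP => CpD; apply/negP => DS.
have C0 : C != set0.
  case/orP: CF => [/F2|/eqP C1]; last by rewrite -card_gt0 C1.
  by rewrite -card_gt0 => /ltnW.
have /'forall_implyP/(_ _ AF)/or3P[DsA|AsD|] := Flam _ DF.
- by move: (CD _ DF); rewrite CpD /= properEneq DA DsA.
- by move: (AD _ DF); rewrite DS properEneq eq_sym DA AsD.
case/set0Pn: C0 => c cC; rewrite disjoint_subset => /subsetP/(_ c).
by rewrite (subsetP (proper_sub CpD)) // inE (subsetP (proper_sub CA)) // => /(_ isT).
Qed.

Definition keep_inp (T : rtree) (e : edge T) S
    (h : val e \notin kids (val T) S) (w : inp (val T) S) :
    inp (val (contract e)) S :=
  Sub (val w) (keep_subproof h (valP w)).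

Lemma merge_subproofl (T : rtree) (e : edge T) S (h : val e \in kids (val T) S)
    (u : {w : inp (val T) S | w != Sub (val e) h}) :
  val (val u) \in kids (val (contract e)) S.
Proof.
by apply: merge_subproof => //; rewrite in_setU in_setD1 (valP (val u)) (valP u).
Qed.

Lemma merge_subproofr (T : rtree) (e : edge T) S (h : val e \in kids (val T) S)
    (w : inp (val T) (val e)) :
  val w \in kids (val (contract e)) S.
Proof. by apply: merge_subproof => //; rewrite in_setU (valP w) orbT. Qed.

Definition merge_inp (T : rtree) (e : edge T) S (h : val e \in kids (val T) S)
    (z : graft (inp (val T) (val e)) (Sub (val e) h : inp (val T) S)) :
    inp (val (contract e)) S :=
  match z with
  | inl u => Sub (val (val u)) (merge_subproofl u)
  | inr w => Sub (val w) (merge_subproofr h w)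
  end.

(** Sign of S ^ (other edges of T) in det(T), where each det is identified
    with k by means of the enumeration order of the sets of leaves. *)
Definition edge_sign (k : fieldType) (T : rtree) (S : {set I}) : k :=
  (-1) ^+ #|[set A in val T :\ [set: I] | (enum_rank A < enum_rank S)%N]|.

End Trees.

Section Koszul.
Variables (k : fieldType) (P : operad_data k).

Section FixedLeaves.
Variable I : finType.

Definition dec (T : rtree I) : Type :=
  forall v : vert T, op_sp P (inp (val T) (val v)).

Definition contract_dec (T : rtree I) (e : edge T) (p : dec T) :
    dec (contract e) :=
  fun v => match @idP (val e \in kids (val T) (val v)) with
  | ReflectT h =>
      op_map P (@merge_inp _ _ _ _ h)
        (op_comp (Sub (val e) h : inp (val T) (val v)) (p (old v)) (p (top e)))
  | ReflectF h => op_map P (keep_inp (introN idP h)) (p (old v))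
  end.

Arguments contract_dec {T} e p.

(** The tensor product P(T) over K is handled through its universal property:
    linear maps from P(T) to W are the k-multilinear maps on decorations that
    are K-balanced along each internal edge. *)
Definition balanced (W : lmodType k) (T : rtree I) (f : dec T -> W) : Prop :=
  (forall (p : dec T) (v : vert T) (a : k) (x y : op_sp P (inp (val T) (val v))),
     f (dfwith p (a *: x + y)) = a *: f (dfwith p x) + f (dfwith p y)) /\
  (forall (p : dec T) (v w : vert T) (i : inp (val T) (val v)) (c : opK P),
     val i = val w ->
     f (dfwith p (ract i (p v) c)) = f (dfwith p (lact c (p w)))).

(** P(T)^* = Hom_K(P(T), K). *)
Definition in_dual (T : rtree I) (f : dec T -> opK P) : Prop :=
  balanced f /\
  forall (p : dec T) (c : opK P),
    f (dfwith p (lact c (p (root T)))) = lact c (f p).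

Inductive contracts : forall T T' : rtree I, dec T -> dec T' -> Prop :=
| contracts_refl (T : rtree I) (p : dec T) : contracts p p
| contracts_step (T T' : rtree I) (e : edge T) (p : dec T) (q : dec T') :
    contracts (contract_dec e p) q -> contracts p q.

(** x is the composite of the decorated tree p; the map h identifies I with
    the inputs of the corolla. *)
Definition composite (T : rtree I) (p : dec T) (x : op_sp P I) : Prop :=
  exists (T0 : rtree I) (q : dec T0) (h : I -> inp (val T0) (val (root T0))),
    [/\ contracts p q, forall i, val (h i) = [set i]
      & q (root T0) = op_map P h x].

(** Quadratic relations: with E = P(2), the space R of relations is the kernel
    of the composition map F(E)(3) -> P(3).  An element of R inserted at the
    ternary vertex v of the tree T, whose other vertices are decorated by q,
    is a formal combination of decorated binary trees T_j which, after
    contraction of one edge e_j, become T decorated by q away from v and by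
    x_j at v, where the combination of the x_j vanishes. *)
Definition pointed_dec : Type := {T : rtree I & (edge T * dec T)%type}.

Definition contract_pointed (t : pointed_dec) : {T : rtree I & dec T} :=
  existT dec (contract (tagged t).1) (contract_dec (tagged t).1 (tagged t).2).

Definition relation_at (T : rtree I) (v : vert T)
    (N : nat) (c : 'I_N -> k) (t : 'I_N -> pointed_dec) : Prop :=
  [/\ #|kids (val T) (val v)| = 3,
      forall j, binary (tag (t j))
    & exists (q : dec T) (x : 'I_N -> op_sp P (inp (val T) (val v))),
        (forall j, contract_pointed (t j) = existT dec T (dfwith q (x j))) /\
        \sum_j c j *: x j = 0].

(** P = F(E)/(R), in arity I, stated as the universal property of the quotient
    of F(E)(I), the sum over binary trees T of E(T), by (R)(I). *)
Definition quadratic_in : Prop :=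
  forall (W : lmodType k) (f : forall T : rtree I, dec T -> W),
    (forall T, binary T -> balanced (f T)) ->
    (forall T (v : vert T) N (c : 'I_N -> k) (t : 'I_N -> pointed_dec),
       relation_at v c t ->
       \sum_j c j *: f (tag (t j)) (tagged (t j)).2 = 0) ->
    let factors (g : op_sp P I -> W) :=
      forall T (p : dec T) x, binary T -> composite p x -> f T p = g x in
    exists2 g : {linear op_sp P I -> W},
      factors g & forall g' : {linear op_sp P I -> W}, factors g' -> g' =1 g.

(** The component of degree j of DP(I): the tensor product of the line
    Lambda(I), in degree 1 - #|I|, with the component of degree s of C(P)(I),
    which is the sum over the trees T with s vertices of the spaces
    P(T)^* (x) det(T). *)
Definition in_DP (j : int) (f : forall T : rtree I, dec T -> opK P) : Prop :=
  (forall T, in_dual (f T)) /\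
  (forall T (p : dec T), (nvert T)%:Z + (1 - #|I|%:Z) != j -> f T p = 0).

(** The transpose of the compositions P(T) -> P(T/e), tensored with e ^ -. *)
Definition DP_diff (f : forall T : rtree I, dec T -> opK P) :
    forall T : rtree I, dec T -> opK P :=
  fun T p => \sum_(e : edge T)
    edge_sign k T (val e) *: f (contract e) (contract_dec e p).

Definition DP_boundary (j : int) (f : forall T : rtree I, dec T -> opK P) :
    Prop :=
  exists2 g, in_DP (j - 1) g & forall T (p : dec T), f T p = DP_diff g p.

Definition exact_at (j : int) : Prop :=
  forall f, in_DP j f ->
    (forall T (p : dec T), DP_diff f p = 0) <-> DP_boundary j f.

(** The component of degree 0 of DP(I), carried by binary trees, is
    F(E^v)(I), the signs of E^v = Hom_K(E, K) (x) sgn being accounted for by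
    det and Lambda, and P^!(I) is its quotient by (R^perp)(I).  Since K is
    semisimple and E finite dimensional, the part of (R^perp)(I) coming from
    R^perp inserted at the ternary vertex of T consists of the functionals,
    supported on the binary expansions of T, that annihilate R inserted at
    that vertex. *)
Definition Rperp_at (T : rtree I) (f : forall T : rtree I, dec T -> opK P) :
    Prop :=
  [/\ in_DP 0 f,
      forall T' (p : dec T'), ~~ (val T \subset val T') -> f T' p = 0
    & forall (v : vert T) N (c : 'I_N -> k) (t : 'I_N -> pointed_dec),
        relation_at v c t ->
        \sum_j (c j * edge_sign k (tag (t j)) (val (tagged (t j)).1))
                 *: f (tag (t j)) (tagged (t j)).2 = 0].

(** A tree with #|I| - 2 vertices has one ternary vertex and binary ones. *)
Definition in_Rperp (f : forall T : rtree I, dec T -> opK P) : Prop :=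
  exists2 g : rtree I -> forall T : rtree I, dec T -> opK P,
    forall T, (nvert T).+2 = #|I| -> Rperp_at T (g T)
  & forall T' (p : dec T'),
      f T' p = \sum_(T | (nvert T).+2 == #|I|) g T T' p.

(** DP(I) -> P^!(I) is a quasi-isomorphism: P^!(I) is in degree 0, and the
    morphism is the quotient map of F(E^v)(I) by (R^perp)(I). *)
Definition quasi_iso_in : Prop :=
  (forall j : int, j != 0 -> exact_at j) /\
  (forall f, in_DP 0 f -> in_Rperp f <-> DP_boundary 0 f).

End FixedLeaves.

Definition quadratic : Prop :=
  forall n : nat, (2 <= n)%N -> quadratic_in 'I_n.

Definition koszul : Prop :=
  semisimpleK P /\ forall n : nat, (2 <= n)%N -> quasi_iso_in 'I_n.

End Koszul.

Section MoebiusCorollas.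

(** The legs are [option I], with [None] the root.  The cyclic ordering of the
    legs is given by the listing of the inputs met when starting from the
    root; the second component is the colouring. *)
Definition mcor (I : finType) : finType :=
  ({s : #|I|.-tuple I | uniq s} * {ffun option I -> bool})%type.

Definition mseq (I : finType) (m : mcor I) : seq I := val (val m.1).

Definition reflected (I : finType) (m m' : mcor I) : bool :=
  (mseq m' == rev (mseq m)) && [forall l, m'.2 l == ~~ m.2 l].

Definition miso (I : finType) (m m' : mcor I) : bool :=
  (m' == m) || reflected m m'.

Definition mclass (I : finType) : finType :=
  {A : {set mcor I} | [exists m, A == [set m' | miso m m']]}.

Definition mrelabel (I J : finType) (f : I -> J) (m : mcor I) (m' : mcor J) :
    bool :=
  (mseq m' == map f (mseq m)) && [forall l, m'.2 (omap f l) == m.2 l].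

(** m'' is obtained from m and m', whose half edges i and root have the same
    colour, by gluing these half edges and contracting the resulting edge. *)
Definition mglue (I J : finType) (i : I)
    (m : mcor I) (m' : mcor J) (m'' : mcor (graft J i)) : bool :=
  [&& m.2 (Some i) == m'.2 None,
      mseq m'' == flatten [seq (if insub x is Some u then [:: inl u]
                                else [seq inr y | y <- mseq m']) | x <- mseq m],
      m''.2 None == m.2 None,
      [forall u, m''.2 (Some (inl u)) == m.2 (Some (val u))] &
      [forall y, m''.2 (Some (inr y)) == m'.2 (Some y)]].

Definition class_relabel (I J : finType) (f : I -> J)
    (A : mclass I) (B : mclass J) : bool :=
  [exists m in val A, exists m' in val B, mrelabel f m m'].

(** Two half edges of different colours get the same colour once one of the
    vertices is replaced by its reflection, so it is enough to glue the
    representatives for which the two colours agree. *)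
Definition class_glue (I J : finType) (i : I)
    (A : mclass I) (B : mclass J) (C : mclass (graft J i)) : bool :=
  [exists m in val A, exists m' in val B, exists m'' in val C, mglue m m' m''].

Definition class_unit (A : mclass unit) : bool :=
  [exists m in val A, m.2 None == m.2 (Some tt)].

End MoebiusCorollas.

Section MAss.
Variable k : fieldType.

Definition MAss_sp (I : finType) : vectType k := {ffun mclass I -> k^o}.

Definition MAss_map (I J : finType) (f : I -> J) (x : MAss_sp I) : MAss_sp J :=
  [ffun B => \sum_(A | class_relabel f A B) x A].

Definition MAss_unit : MAss_sp unit := [ffun A => (class_unit A)%:R].

Definition MAss_comp (I J : finType) (i : I) (x : MAss_sp I) (y : MAss_sp J) :
    MAss_sp (graft J i) :=
  [ffun C => \sum_(A : mclass I) \sum_(B : mclass J | class_glue A B C)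
               (x A : k) * (y B : k)].

Definition MAss : operad_data k :=
  @OperadData k MAss_sp MAss_map MAss_unit MAss_comp.

End MAss.

(* Main.v *)
(* Every class of Moebius corollas has a basis vector [bas s c], for a linear
   order [s] of the inputs and a colouring [c] of the legs, where (s, c) and its
   reflection give the same vector.  A decorated tree is, up to K-balancing, a
   linear order of the leaves for which all the sets of leaves of the tree are
   intervals, together with a colouring of the outer legs; contracting an edge
   only forgets a set of leaves.  Hence DMAss(I) splits as a direct sum, over
   the linear orders of [I], of complexes of laminar families of intervals (the
   augmented cochain complexes of boundaries of simplicial spheres dual to
   associahedra).  Each of them is contracted below its top degree by a toggle:
   fix the first element i0, let S be a set of the family containing i0 such
   that S minus the next smaller such set S' (or {i0}) has at least two elements,
   and add or remove S \ S'.  This interval depends only on the sets containing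
   i0, and it exists unless the family is the comb of all initial intervals.
   The flips of binary trees towards this comb also give quadraticity. *)

Require Import Defs.
From HB Require Import structures.
From mathcomp Require Import all_boot all_order all_algebra zify.
From Stdlib Require Import FunctionalExtensionality.

Set Implicit Arguments.
Unset Strict Implicit.
Unset Printing Implicit Defensive.

Import GRing.Theory Num.Theory.
Local Open Scope ring_scope.

(** * Basis of Moebius corollas *)

Arguments op_map {k} o {I J} f x : simpl never.
Arguments op_comp {k o I J} i x y : simpl never.

Section Basis.
Variable k : fieldType.

(** Tensor products over K are only available through balanced multilinear maps, so everything rests
    on two complementary facts about P(T). Such a map is determined by its values on the normal
    forms [std_dec]: reflecting vertices makes the two half edges of each internal edge agree, and
    balancing then erases the colours of the internal edges. Conversely these values can be
    prescribed freely: composition sends normal forms with distinct oriented orders or outer colours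
    to distinct basis vectors of P(I), so a functional on P(T) can be pulled back from P(I). A class
    has two representatives, a linear order and its reverse, hence the splitting is indexed by
    oriented orders. Invertibility of 2 enters twice: in the averaging over the group of order two
    that makes K semisimple, and in passing from X = - X to X = 0 when the differential is applied
    twice. *)

Definition ordering (I : finType) (s : seq I) : bool := perm_eq s (enum I).

Lemma ordering_uniq (I : finType) (s : seq I) : ordering s -> uniq s.
Proof. by move/perm_uniq->; rewrite enum_uniq. Qed.

Lemma ordering_mem (I : finType) (s : seq I) x : ordering s -> x \in s.
Proof. by move/perm_mem->; rewrite mem_enum. Qed.

Lemma ordering_size (I : finType) (s : seq I) : ordering s -> size s = #|I|.
Proof. by move/perm_size->; rewrite cardE. Qed.

Lemma orderingP (I : finType) (s : seq I) :
  uniq s -> (forall x, x \in s) -> ordering s.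
Proof.
by move=> us ms; apply: uniq_perm => // [|x]; rewrite ?enum_uniq // mem_enum ms.
Qed.

Lemma ordering_rev (I : finType) (s : seq I) : ordering (rev s) = ordering s.
Proof. by rewrite /ordering perm_rev. Qed.

Lemma ordering_map (I J : finType) (f : I -> J) (s : seq I) :
  bijective f -> ordering s -> ordering (map f s).
Proof.
move=> [g fK gK] os; apply: orderingP.
  by rewrite map_inj_uniq ?(ordering_uniq os) //; apply: can_inj fK.
by move=> y; rewrite -(gK y) map_f // ordering_mem.
Qed.

Lemma mcor_ordering (I : finType) (m : mcor I) : ordering (mseq m).
Proof.
have us := valP m.1; apply: orderingP => // x.
have [||_ ->] := @uniq_min_size _ (mseq m) (enum I) us; last by rewrite mem_enum.
  by move=> y _; rewrite mem_enum.
by rewrite -cardE size_tuple.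
Qed.

Lemma mk_mcor_subproof (I : finType) (s : seq I) :
  ordering s -> size s == #|I|.
Proof. by move/ordering_size->. Qed.

Definition mk_mcor (I : finType) (s : seq I) (os : ordering s)
    (c : option I -> bool) : mcor I :=
  (Sub (Tuple (mk_mcor_subproof os)) (ordering_uniq os), finfun c).

Lemma mcor_eq (I : finType) (m m' : mcor I) :
  mseq m = mseq m' -> m.2 =1 m'.2 -> m = m'.
Proof.
case: m m' => [s c] [s' c'] /= es ec; congr (_, _); last exact/ffunP.
by apply/val_inj/val_inj.
Qed.

Lemma misoxx (I : finType) (m : mcor I) : miso m m.
Proof. by rewrite /miso eqxx. Qed.

Lemma reflected_sym (I : finType) (m m' : mcor I) :
  reflected m m' -> reflected m' m.
Proof.
case/andP => /eqP e /forallP h; apply/andP; split; first by rewrite e revK.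
by apply/forallP => l; rewrite (eqP (h l)) negbK.
Qed.

Lemma reflected_trans (I : finType) (m m' m'' : mcor I) :
  reflected m m' -> reflected m' m'' -> m'' = m.
Proof.
case/andP => /eqP e /forallP h /andP[/eqP e' /forallP h'].
apply: mcor_eq => [|l]; first by rewrite e' e revK.
by rewrite (eqP (h' l)) (eqP (h l)) negbK.
Qed.

Lemma miso_sym (I : finType) (m m' : mcor I) : miso m m' -> miso m' m.
Proof.
by case/orP => [/eqP->|/reflected_sym h]; rewrite /miso ?eqxx // h orbT.
Qed.

Lemma miso_trans (I : finType) (m m' m'' : mcor I) :
  miso m m' -> miso m' m'' -> miso m m''.
Proof.
case/orP => [/eqP-> //|h] /orP[/eqP->|h']; rewrite /miso; first by rewrite h orbT.
by rewrite (reflected_trans h h') eqxx.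
Qed.

Lemma cls_subproof (I : finType) (m : mcor I) :
  [exists m1, [set m' | miso m m'] == [set m' | miso m1 m']].
Proof. by apply/existsP; exists m. Qed.

Definition cls (I : finType) (m : mcor I) : mclass I :=
  Sub [set m' | miso m m'] (cls_subproof m).

Lemma clsP (I : finType) (A : mclass I) (m : mcor I) :
  (m \in val A) = (A == cls m).
Proof.
apply/idP/eqP => [|->]; last by rewrite inE misoxx.
case: A => A /= h; have /existsP[m1 /eqP e] := h => mA; apply: val_inj => /=.
move: mA; rewrite e inE => m1m; apply/setP => m'; rewrite !inE.
by apply/idP/idP; [apply: miso_trans (miso_sym m1m) | apply: miso_trans m1m].
Qed.

Lemma cls_eq (I : finType) (m m' : mcor I) : (cls m == cls m') = miso m m'.
Proof. by rewrite -clsP inE. Qed.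

Lemma cls_ex (I : finType) (A : mclass I) : exists m, A = cls m.
Proof.
case: A => A h; have /existsP[m /eqP e] := h; exists m; exact: val_inj.
Qed.

(* [0] when [s] is not a listing of [I]. *)
Definition bas (I : finType) (s : seq I) (c : option I -> bool) : MAss_sp k I :=
  [ffun A : mclass I => 
     ([exists m in val A, (mseq m == s) && [forall l, m.2 l == c l]])%:R].

Lemma bas_mcor (I : finType) (m : mcor I) (A : mclass I) :
  bas (mseq m) m.2 A = (A == cls m)%:R.
Proof.
rewrite ffunE -clsP; congr ((_ : bool)%:R); apply/idP/idP.
  case/existsP=> m' /and3P[m'A /eqP e /forallP h].
  by have <- : m' = m by apply: mcor_eq => // l; apply/eqP.
by move=> mA; apply/existsP; exists m; rewrite mA eqxx; apply/forallP => l.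
Qed.

Lemma bas_mk (I : finType) (s : seq I) (os : ordering s) c (A : mclass I) :
  bas s c A = (A == cls (mk_mcor os c))%:R.
Proof.
rewrite -bas_mcor; congr (bas _ _ A).
by apply: functional_extensionality => l; rewrite ffunE.
Qed.

Lemma bas_ext (I : finType) (s : seq I) c c' : c =1 c' -> bas s c = bas s c'.
Proof. by move/functional_extensionality->. Qed.

Lemma bas_seq (I : finType) (s s' : seq I) c : s = s' -> bas s c = bas s' c.
Proof. by move->. Qed.

Lemma bas_rev (I : finType) (s : seq I) c :
  bas (rev s) (fun l => ~~ c l) = bas s c.
Proof.
apply/ffunP => A; rewrite !ffunE; congr ((_ : bool)%:R).
(* One implication suffices: applied to the reversed data it gives the converse, reversal and
   negation being involutive. *)
have aux s' c' : [exists m in val A, (mseq m == s') && [forall l, m.2 l == c' l]]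
  -> [exists m in val A, (mseq m == rev s') && [forall l, m.2 l == ~~ c' l]].
  case/existsP => m /and3P[mA /eqP e /forallP h].
  have os : ordering (rev s') by rewrite ordering_rev -e mcor_ordering.
  apply/existsP; exists (mk_mcor os (fun l => ~~ c' l)); apply/and3P; split.
  - move: mA; rewrite !clsP => /eqP->; rewrite cls_eq /miso.
    apply/orP; right; apply/andP; split; first by rewrite e.
    by apply/forallP => l /=; rewrite ffunE (eqP (h l)).
  - by [].
  - by apply/forallP => l /=; rewrite ffunE.
apply/idP/idP => [/aux|/aux //]; rewrite revK.
by under eq_existsb => m do under eq_forallb => l do rewrite negbK.
Qed.

Lemma cls_scaled_sum (I : finType) (x : MAss_sp k I) :
  exists r : mclass I -> mcor I,
    x = \sum_A (x A : k) *: bas (mseq (r A)) (r A).2.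
Proof.
have /fin_all_exists[r rP] := @cls_ex I.
exists r; apply/ffunP => A; rewrite sum_ffunE (bigD1 A) //=.
rewrite ffunE bas_mcor -rP eqxx [_ *: _]mulr1 big1 ?addr0 // => B BA.
by rewrite ffunE bas_mcor -rP eq_sym (negPf BA) [_ *: _]mulr0.
Qed.

Lemma mass_ind (I : finType) (Q : MAss_sp k I -> Prop) :
  (forall a x y, Q x -> Q y -> Q (a *: x + y)) ->
  (forall s c, ordering s -> Q (bas s c)) -> forall x, Q x.
Proof.
move=> QD Qb x; have [r ->] := cls_scaled_sum x.
have Qr A : Q (bas (mseq (r A)) (r A).2) by apply/Qb/mcor_ordering.
(* Zero is reached as [- b + b] for a basis vector [b], so closure under [a *: x + y] is enough. *)
have Q0 : Q 0.
  have os : ordering (enum I) by apply: perm_refl.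
  have := QD (-1) _ _ (Qb _ (fun=> false) os) (Qb _ (fun=> false) os).
  by rewrite scaleN1r addNr.
apply: (big_ind Q) => // [y z Qy Qz|A _]; first by rewrite -[y]scale1r; apply: QD.
by rewrite -[X in Q X]addr0; apply: QD.
Qed.

End Basis.

(** * Relabelling and gluing of basis vectors *)

Section Operations.
Variable k : fieldType.

(** Reflection commutes with relabelling, so the image of a class can be computed from either of its
    representatives. *)
Lemma mrelabel_rev (I J : finType) (f : I -> J) m n m' :
  reflected m n -> mrelabel f m m' ->
  exists2 n', reflected m' n' & mrelabel f n n'.
Proof.
case/andP => /eqP e /forallP h /andP[/eqP e' /forallP h'].
have os : ordering (rev (mseq m')) by rewrite ordering_rev mcor_ordering.
exists (mk_mcor os (fun l => ~~ m'.2 l)).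
  by rewrite /reflected eqxx; apply/forallP => l /=; rewrite ffunE.
apply/andP; split; first by rewrite e map_rev -e'.
by apply/forallP => l /=; rewrite ffunE (eqP (h' l)) (eqP (h l)).
Qed.

(** The new colouring is constrained by an equation rather than built from an inverse of [f], so
    that it can be supplied in whatever form is at hand. *)
Lemma op_map_bas (I J : finType) (f : I -> J) (s : seq I) c c' :
  bijective f -> ordering s -> (forall l, c' (omap f l) = c l) ->
  op_map (MAss k) f (bas k s c) = bas k (map f s) c'.
Proof.
move=> bf os cc'; have os' := ordering_map bf os.
apply/ffunP => B; rewrite ffunE (bas_mk k os').
set m := mk_mcor os c; set m' := mk_mcor os' c'.
under eq_bigr => A _ do rewrite (bas_mk k os) -/m.
have mm' : mrelabel f m m'.
  by apply/andP; split=> //; apply/forallP => l; rewrite !ffunE cc'.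
have uniqm n n1 n2 : mrelabel f n n1 -> mrelabel f n n2 -> n1 = n2.
  case: bf => g fK gK /andP[/eqP e /forallP h] /andP[/eqP e' /forallP h'].
  apply: mcor_eq => [|l]; first by rewrite e e'.
  have -> : l = omap f (omap g l) by case: l => //= y; rewrite gK.
  by rewrite (eqP (h _)) (eqP (h' _)).
have E : class_relabel f (cls m) B = (B == cls m').
  rewrite -clsP; apply/existsP/idP => [[n /andP[nm]]|mB].
    case/existsP => n' /andP[n'B nn'].
    move: nm; rewrite inE => /orP[/eqP en|r].
      by rewrite (uniqm _ _ _ mm' (_ : mrelabel f m n')) // -en.
    have [m'' r' mm''] := mrelabel_rev r mm'.
    rewrite (uniqm _ _ _ nn' mm'') clsP in n'B.
    by rewrite clsP (eqP n'B) cls_eq /miso (reflected_sym r') orbT.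
  exists m; rewrite inE misoxx /=; apply/existsP; exists m'; exact/andP.
rewrite -E; case e: (class_relabel f (cls m) B).
  rewrite (bigD1 (cls m)) //= eqxx big1 ?addr0 // => A /andP[_ /negPf-> //].
by rewrite big1 // => A; case: eqP => // ->; rewrite e.
Qed.

Definition gseq (I J : finType) (i : I) (s : seq I) (t : seq J) :
    seq (graft J i) :=
  flatten [seq (if insub x is Some u then [:: inl u]
                else [seq inr y | y <- t]) | x <- s].

Definition gcol (I J : finType) (i : I) (c : option I -> bool)
    (d : option J -> bool) (l : option (graft J i)) : bool :=
  match l with
  | None => c None
  | Some (inl u) => c (Some (val u))
  | Some (inr y) => d (Some y)
  end.

Lemma gseq_rev (I J : finType) (i : I) (s : seq I) (t : seq J) :
  gseq i (rev s) (rev t) = rev (gseq i s t).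
Proof.
rewrite /gseq rev_flatten -map_comp map_rev; congr (flatten (rev _)).
by apply: eq_map => x /=; case: insubP => //= _; rewrite map_rev.
Qed.

Lemma mem_gseq (I J : finType) (i : I) (s : seq I) (t : seq J) z :
  (z \in gseq i s t) =
  match z with inl u => val u \in s | inr y => (i \in s) && (y \in t) end.
Proof.
apply/flatten_mapP/idP => [[x xs]|].
  case: insubP => [u ui eu|]; first by rewrite inE => /eqP->; rewrite eu.
  by rewrite negbK => /eqP e /mapP[y yt ->]; rewrite -e xs.
case: z => [u us|y /andP[iS yt]].
  by exists (val u) => //; rewrite valK inE.
by exists i => //; rewrite insubF ?eqxx // map_f.
Qed.

Lemma gseq_uniq (I J : finType) (i : I) (s : seq I) (t : seq J) :
  uniq s -> uniq t -> uniq (gseq i s t).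
Proof.
move=> + ut; elim: s => //= x s IH /andP[xs /IH us].
have -> : gseq i (x :: s) t =
  (if insub x is Some u then [:: inl u] else [seq inr y | y <- t]) ++ gseq i s t.
  by [].
rewrite cat_uniq us andbT; case: insubP => [u ui eu|] /=.
  by apply: contra xs => /hasP[z]; rewrite mem_gseq inE => + /eqP ez; rewrite ez eu.
rewrite negbK => /eqP e; rewrite map_inj_uniq ?ut /=; last by move=> ? ? [].
apply/hasPn => z; rewrite mem_gseq; case: z => [u _|y /andP[]]; first by apply/negP => /mapP[].
by rewrite -e (negPf xs).
Qed.

Lemma gseq_ordering (I J : finType) (i : I) (s : seq I) (t : seq J) :
  ordering s -> ordering t -> ordering (gseq i s t).
Proof.
move=> os ot; apply: orderingP => [|z].
  by rewrite gseq_uniq ?(ordering_uniq os) ?(ordering_uniq ot).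
by rewrite mem_gseq; case: z => *; rewrite !ordering_mem.
Qed.

(** Two classes have four pairs of representatives. Matching colours exclude the pairs in which
    exactly one corolla is reflected, and reflecting both reflects the glued corolla, so the
    composite is a single basis vector. *)
Lemma op_comp_bas (I J : finType) (i : I) (s : seq I) (t : seq J) c d :
  ordering s -> ordering t -> c (Some i) = d None ->
  op_comp (o := MAss k) i (bas k s c) (bas k t d) = bas k (gseq i s t) (gcol c d).
Proof.
move=> os ot cd; have og := gseq_ordering i os ot.
apply/ffunP => C; rewrite ffunE (bas_mk k og).
set m := mk_mcor os c; set m' := mk_mcor ot d; set g := mk_mcor og _.
have E : class_glue (cls m) (cls m') C = (C == cls g).
  rewrite -clsP; apply/existsP/idP => [[n /andP[nm]]|gC].
    case/existsP => n' /andP[n'm] /existsP[n'' /andP[n''C]].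
    case/and5P => h /eqP e /eqP e0 /forallP e1 /forallP e2.
    move: nm n'm; rewrite !inE => /orP[/eqP en|/andP[/eqP en /forallP hn]];
      move=> /orP[/eqP en'|/andP[/eqP en' /forallP hn']].
    - suff -> : g = n'' by [].
      apply: mcor_eq; first by rewrite e en en'.
      by case=> [[u|y]|]; rewrite !ffunE ?(eqP (e1 _)) ?(eqP (e2 _)) ?e0 ?en ?en' ffunE.
    - by move: h; rewrite en (eqP (hn' _)) !ffunE cd; case: (d None).
    - by move: h; rewrite en' (eqP (hn _)) !ffunE cd; case: (d None).
    - move: n''C; rewrite !clsP => /eqP->; rewrite cls_eq; apply/orP; right.
      apply/andP; split.
        by rewrite e en en' -[flatten _]/(gseq i _ _) gseq_rev revK.
      apply/forallP.
      by case=> [[u|y]|]; rewrite !ffunE ?(eqP (e1 _)) ?(eqP (e2 _)) ?e0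
        ?(eqP (hn _)) ?(eqP (hn' _)) !ffunE negbK.
  exists m; rewrite inE misoxx /=; apply/existsP; exists m'.
  rewrite inE misoxx /=; apply/existsP; exists g; rewrite gC /=.
  apply/and5P; split; rewrite ?ffunE ?cd //.
    by apply/forallP => u; rewrite !ffunE.
  by apply/forallP => u; rewrite !ffunE.
under eq_bigr => A _ do under eq_bigr => B _ do
  rewrite (bas_mk k os) (bas_mk k ot) -/m -/m'.
rewrite -E (bigD1 (cls m)) //= [X in _ + X]big1 ?addr0; last first.
  by move=> A /negPf nA; rewrite big1 // => B _; rewrite nA mul0r.
rewrite eqxx; under eq_bigr => B _ do rewrite mul1r.
case e: (class_glue (cls m) (cls m') C).
  rewrite (bigD1 (cls m')) //= eqxx big1 ?addr0 // => A /andP[_ /negPf-> //].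
by rewrite big1 // => A; case: eqP => // ->; rewrite e.
Qed.

Lemma op_map_linear (I J : finType) (f : I -> J) : linear (op_map (MAss k) f).
Proof.
move=> a x y; apply/ffunP => B; rewrite !ffunE scaler_sumr -big_split /=.
by apply: eq_bigr => A _; rewrite !ffunE.
Qed.

Lemma op_compDl (I J : finType) (i : I) a (x x' : op_sp (MAss k) I)
    (y : op_sp (MAss k) J) :
  op_comp i (a *: x + x') y = a *: op_comp i x y + op_comp i x' y.
Proof.
apply/ffunP => C; rewrite !ffunE scaler_sumr -big_split /=.
apply: eq_bigr => A _; rewrite scaler_sumr -big_split /=.
by apply: eq_bigr => B _; rewrite !ffunE mulrDl -mulrA.
Qed.

Lemma op_compDr (I J : finType) (i : I) a (x : op_sp (MAss k) I)
    (y y' : op_sp (MAss k) J) :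
  op_comp i x (a *: y + y') = a *: op_comp i x y + op_comp i x y'.
Proof.
apply/ffunP => C; rewrite !ffunE scaler_sumr -big_split /=.
apply: eq_bigr => A _; rewrite scaler_sumr -big_split /=.
by apply: eq_bigr => B _; rewrite !ffunE mulrDr mulrCA.
Qed.

(* Induction over a second factor, with a representative whose root has the
   colour needed for gluing. *)
Lemma mass_ind_root (J : finType) (b : bool) (Q : MAss_sp k J -> Prop) :
  (forall a x y, Q x -> Q y -> Q (a *: x + y)) ->
  (forall t d, ordering t -> d None = b -> Q (bas k t d)) -> forall x, Q x.
Proof.
move=> QD Qb; apply: mass_ind => // t d ot.
have [e|e] := eqVneq (d None) b; first exact: Qb.
rewrite -bas_rev; apply: Qb; first by rewrite ordering_rev.
by case: (d None) b e => -[].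
Qed.

End Operations.

(** * Operad axioms *)

Section OperadAxioms.
Variable k : fieldType.

Lemma card_graft (I J : finType) (i : I) : #|graft J i| = (#|I|.-1 + #|J|)%N.
Proof. by rewrite card_sum card_sig cardC1. Qed.

Lemma gval_inj (I J : finType) (i : I) : injective (@gval I J i).
Proof. by case=> [u|y] [u'|y'] //= [] => [/val_inj->|->]. Qed.

Lemma gval_right_inj (I J L : finType) (i : I) (j : J) :
  injective (@gval_right I J L i j).
Proof. by case=> [u|y] [u'|y'] //= [] => [/val_inj->|/gval_inj->]. Qed.

Lemma gval_left_inj (I J L : finType) (i : I) (a : graft J i) :
  injective (@gval_left I J L i a).
Proof.
case=> [u|y] [u'|y'] //=; last by case=> ->.
- move=> e; congr inl; apply/val_inj/gval_inj.
  by case: (gval (val u)) (gval (val u')) e => ? [] ? // [->].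
- by case: (gval (val u)).
- by case: (gval (val u')).
Qed.

Lemma swap_right_inj (A B C : Type) : injective (@swap_right A B C).
Proof. by case=> [?|[?|?]] [?|[?|?]] //= [->]. Qed.

Lemma map_gval_gseq (I J : finType) (i : I) (s : seq I) (t : seq J) :
  [seq gval z | z <- gseq i s t] =
  flatten [seq (if x == i then [seq inr y | y <- t] else [:: inl x]) | x <- s].
Proof.
rewrite map_flatten -map_comp; congr flatten; apply: eq_map => x /=.
case: insubP => [u /negPf-> <- //|]; rewrite negbK => ->.
by rewrite -map_comp.
Qed.

Lemma gseq_cons (I J : finType) (i : I) x (s : seq I) (t : seq J) :
  gseq i (x :: s) t =
  (if insub x is Some u then [:: inl u] else [seq inr y | y <- t]) ++ gseq i s t.
Proof. by []. Qed.

Lemma gseq_cat (I J : finType) (i : I) (s1 s2 : seq I) (t : seq J) :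
  gseq i (s1 ++ s2) t = gseq i s1 t ++ gseq i s2 t.
Proof. by rewrite /gseq map_cat flatten_cat. Qed.

(** The common form of both sides of sequential associativity, once the proofs inside iterated
    grafts are forgotten by [gval_left] and [gval_right]. *)
Definition subst3 (I J L : finType) (i : I) (j : J) (s : seq I) (t : seq J)
    (r : seq L) : seq (I + (J + L)) :=
  flatten [seq (if x == i then
                  flatten [seq (if y == j then [seq inr (inr l) | l <- r]
                                else [:: inr (inl y)]) | y <- t]
                else [:: inl x]) | x <- s].

Lemma map_gval_right_gseq (I J L : finType) (i : I) (j : J) s t (r : seq L) :
  [seq gval_right z | z <- gseq i s (gseq j t r)] = subst3 i j s t r.
Proof.
rewrite map_flatten -map_comp; congr flatten; apply: eq_map => x /=.
case: insubP => [u /negPf-> <- //|]; rewrite negbK => ->.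
rewrite -map_comp (@eq_map _ _ _ (inr \o @gval _ _ _)) // map_comp.
rewrite map_gval_gseq map_flatten -map_comp; congr flatten; apply: eq_map => y /=.
by case: ifP => // _; rewrite -map_comp.
Qed.

Lemma map_gval_left_gseq_inr (I J L : finType) (i : I) (j : J) s t (r : seq L) :
  [seq gval_left z | z <- gseq (inr j : graft J i) (gseq i s t) r]
  = subst3 i j s t r.
Proof.
rewrite /subst3; elim: s => //= x s IH; rewrite gseq_cons gseq_cat map_cat IH.
congr (_ ++ _); case: insubP => [u /negPf-> <- //|].
  by rewrite /gseq /= insubT.
rewrite negbK => ->; rewrite map_flatten -!map_comp; congr flatten.
apply: eq_map => y /=; case: insubP => [v + ev|].
  by move=> h; rewrite /= ev; have [e|//] := eqVneq y j; rewrite e eqxx in h.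
by rewrite negbK => /eqP[->]; rewrite eqxx -map_comp.
Qed.

(** Read through [gval_left], substitutions at two distinct inputs play symmetric roles up to
    [swap_right]; this is parallel associativity for listings. *)
Lemma map_gval_left_gseq_inl (I J L : finType) (i i' : I)
    (u : {x : I | x != i}) s t (r : seq L) : val u = i' ->
  [seq gval_left z | z <- gseq (inl u : graft J i) (gseq i s t) r] =
  flatten [seq (if x == i then [seq inr (inl y) | y <- t]
                else if x == i' then [seq inr (inr l) | l <- r]
                else [:: inl x]) | x <- s].
Proof.
move=> <- {i'}; elim: s => //= x s IH; rewrite gseq_cons gseq_cat map_cat IH.
congr (_ ++ _); case: insubP => [v /negPf-> <- /=|].
  rewrite /gseq /= cats0; case: insubP => [w + ew /=|].
    rewrite ew => h; have [/val_inj e|//] := eqVneq (val v) (val u).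
    by rewrite e eqxx in h.
  by rewrite negbK => /eqP[->]; rewrite eqxx -map_comp.
rewrite negbK => ->; rewrite map_flatten -!map_comp.
by rewrite -[RHS]flatten_map1; congr flatten; apply: eq_map => y /=; rewrite insubT.
Qed.

(** The bijection [h] is known only through [gval]. Injectivity of [gval] makes [h] injective, hence
    bijective by cardinality, and also lets listings be compared after forgetting proofs. The
    associativity axioms are treated in the same way. *)
Lemma MAss_equivariant (I I' J J' : finType) (f : I -> I') (g : J -> J')
      (i : I) (h : graft J i -> graft J' (f i)) :
    bijective f -> bijective g ->
    (forall z, gval (h z) =
       match gval z with inl x => inl (f x) | inr y => inr (g y) end) ->
    forall x y, op_map (MAss k) h (op_comp i x y)
                = op_comp (f i) (op_map (MAss k) f x) (op_map (MAss k) g y).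
Proof.
move=> bf bg hE.
have bh : bijective h.
  apply: inj_card_bij; last first.
    by rewrite !card_graft (bij_eq_card bf) (bij_eq_card bg).
  move=> z z' /(congr1 (@gval _ _ _)); rewrite !hE => e; apply: gval_inj; move: e.
  by case: (gval z) (gval z') => [?|?] [?|?] // [] => [/(bij_inj bf)|/(bij_inj bg)] ->.
elim/mass_ind => [a x x' Hx Hx' y|s c os].
  by rewrite op_compDl !op_map_linear Hx Hx' op_compDl.
elim/(@mass_ind_root k J (c (Some i))) => [a y y' Hy Hy'|t d ot dc].
  by rewrite op_compDr !op_map_linear Hy Hy' op_compDr.
have [f' fK f'K] := bf; have [g' gK g'K] := bg.
rewrite op_comp_bas // (@op_map_bas k _ _ f s c (c \o omap f')) //; last first.
  by case=> //= ?; rewrite fK.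
rewrite (@op_map_bas k _ _ g t d (d \o omap g')) //; last first.
  by case=> //= ?; rewrite gK.
rewrite op_comp_bas ?ordering_map //=; last by rewrite fK dc.
rewrite (@op_map_bas _ _ _ h _ _ (gcol (c \o omap f') (d \o omap g')) bh (gseq_ordering _ os ot)).
- apply: bas_seq; apply: (inj_map (@gval_inj _ _ _)).
  have -> l : map (@gval _ _ _) (map h l) = map (fun v => match v with
      inl x => inl (f x) | inr y => inr (g y) end) (map (@gval _ _ _) l).
    by rewrite -!map_comp; apply: eq_map.
  rewrite !map_gval_gseq.
  rewrite map_flatten -!map_comp; congr flatten; apply: eq_map => x /=.
  by rewrite (bij_eq bf); case: ifP => // _; rewrite -!map_comp.
case=> //= z; move: (h z) (hE z); case: z => [u|y] [u'|y'] //= [->] /=.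
  by rewrite fK.
by rewrite gK.
Qed.

Definition col3 (I J L : finType) (c : option I -> bool) (d : option J -> bool)
   (e : option L -> bool) (z : I + (J + L)) : bool :=
  match z with
  | inl x => c (Some x)
  | inr (inl y) => d (Some y)
  | inr (inr l) => e (Some l)
  end.

Lemma gcol_right (I J L : finType) (i : I) (j : J) c d (e : option L -> bool) z :
  @gcol _ _ i c (@gcol _ _ j d e) (Some z) = col3 c d e (gval_right z).
Proof. by case: z => [|[]]. Qed.

Lemma gcol_left (I J L : finType) (i : I) (a : graft J i) c d
    (e : option L -> bool) z :
  @gcol _ _ a (@gcol _ _ i c d) e (Some z) = col3 c d e (gval_left z).
Proof. by case: z => [[[]]|]. Qed.

Lemma MAss_assoc_seq (I J L : finType) (i : I) (j : J)
      (h : graft L (inr j : graft J i) -> graft (graft L j) i) :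
    (forall z, gval_right (h z) = gval_left z) ->
    forall x y z,
      op_map (MAss k) h (op_comp (inr j : graft J i) (op_comp i x y) z)
      = op_comp i x (op_comp j y z).
Proof.
move=> hE.
have bh : bijective h.
  apply: inj_card_bij => [z z' /(congr1 (@gval_right _ _ _ _ _))|].
    by rewrite !hE => /gval_left_inj.
  have J0 : (0 < #|J|)%N by apply/card_gt0P; exists j.
  by rewrite !card_graft; case: #|J| J0 => // n _; rewrite addnS /= addnA.
elim/mass_ind => [a x x' Hx Hx' y z|s c os].
  by rewrite !op_compDl op_map_linear Hx Hx'.
elim/(@mass_ind_root k J (c (Some i))) => [a y y' Hy Hy' z|t d ot dc].
  by rewrite op_compDr !op_compDl op_map_linear Hy Hy' op_compDr.
elim/(@mass_ind_root k L (d (Some j))) => [a y y' Hy Hy'|r e or ed].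
  by rewrite op_compDr op_map_linear Hy Hy' !op_compDr.
have og := gseq_ordering i os ot.
rewrite (op_comp_bas _ os ot (esym dc)) (op_comp_bas _ ot or (esym ed)).
rewrite (op_comp_bas _ og or (esym ed)).
rewrite (op_comp_bas _ os (gseq_ordering j ot or) (esym dc)).
rewrite (@op_map_bas _ _ _ h _ _ (gcol c (gcol d e)) bh (gseq_ordering _ og or)).
  apply: bas_seq; apply: (inj_map (@gval_right_inj _ _ _ _ _)).
  have -> l : map (@gval_right _ _ _ _ _) (map h l) = map (@gval_left _ _ _ _ _) l.
    by rewrite -!map_comp; apply: eq_map.
  by rewrite map_gval_left_gseq_inr map_gval_right_gseq.
case=> // z; rewrite gcol_left -hE; exact: gcol_right.
Qed.

Lemma MAss_assoc_par (I J L : finType) (i i' : I)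
      (u' : {x : I | x != i}) (u : {x : I | x != i'})
      (h : graft L (inl u' : graft J i) -> graft J (inl u : graft L i')) :
    val u' = i' -> val u = i ->
    (forall z, gval_left (h z) = swap_right (gval_left z)) ->
    forall x y z,
      op_map (MAss k) h (op_comp (inl u' : graft J i) (op_comp i x y) z)
      = op_comp (inl u : graft L i') (op_comp i' x z) y.
Proof.
move=> u'i ui hE.
have bh : bijective h.
  apply: inj_card_bij => [z z' /(congr1 (@gval_left _ _ _ _ _))|].
    by rewrite !hE => /swap_right_inj/gval_left_inj.
  have : (1 < #|I|)%N.
    by rewrite (cardD1 i) (cardD1 i') !inE -u'i (valP u').
  rewrite !card_graft; case: #|I| => [//|[//|n]] _.
  by rewrite !addSn /= addnAC.
elim/mass_ind => [a x x' Hx Hx' y z|s c os].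
  by rewrite !op_compDl op_map_linear Hx Hx'.
elim/(@mass_ind_root k J (c (Some i))) => [a y y' Hy Hy' z|t d ot dc].
  by rewrite op_compDr op_compDl op_map_linear Hy Hy' op_compDr.
elim/(@mass_ind_root k L (c (Some i'))) => [a y y' Hy Hy'|r e or ed].
  by rewrite op_compDr op_map_linear Hy Hy' op_compDr op_compDl.
have ii' : i != i' by rewrite -ui (valP u).
have og := gseq_ordering i os ot; have og' := gseq_ordering i' os or.
rewrite (op_comp_bas _ os ot (esym dc)) (op_comp_bas _ os or (esym ed)).
rewrite -u'i in ed; rewrite -ui in dc.
rewrite (op_comp_bas _ og or (esym ed)) (op_comp_bas _ og' ot (esym dc)).
rewrite (@op_map_bas _ _ _ h _ _ (gcol (gcol c e) d) bh (gseq_ordering _ og or)).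
  apply: bas_seq; apply: (inj_map (@gval_left_inj _ _ _ _ _)).
  have -> l : map (@gval_left _ _ _ _ _) (map h l)
      = map (@swap_right _ _ _) (map (@gval_left _ _ _ _ _) l).
    by rewrite -!map_comp; apply: eq_map.
  rewrite (map_gval_left_gseq_inl _ _ _ u'i) (map_gval_left_gseq_inl _ _ _ ui).
  rewrite map_flatten -map_comp; congr flatten; apply: eq_map => x /=.
  have [->|_] := eqVneq x i; first by rewrite (negPf ii') -map_comp.
  by case: ifP => // _; rewrite -map_comp.
case=> // z; rewrite gcol_left; rewrite [LHS]gcol_left hE.
by case: (gval_left z) => [|[]].
Qed.

Lemma lunit_map_bij (J : finType) : bijective (@lunit_map J).
Proof. by exists inr => // -[u|//]; case: (no_other_unit u). Qed.

Lemma runit_map_inj (I : finType) (i : I) : injective (@runit_map I i).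
Proof.
case=> [u|[]] [u'|[]] //=; first by move/val_inj->.
  by move=> e; case/eqP: (valP u).
by move=> e; case/eqP: (valP u').
Qed.

Lemma runit_map_bij (I : finType) (i : I) : bijective (@runit_map I i).
Proof.
apply: inj_card_bij; first exact: runit_map_inj.
rewrite card_graft card_unit addn1 prednK //; apply/card_gt0P; by exists i.
Qed.

Lemma ordering_unit (s : seq unit) : ordering s = (s == [:: tt]).
Proof.
apply/idP/eqP => [os|->]; last by apply: orderingP => // -[].
have := ordering_size os; rewrite card_unit.
by case: s os => // -[] [].
Qed.

(** Effect on a colouring of the action of [a ^ b] at the leg [l]. *)
Definition recol (I : finType) (l : option I) (b : bool) (c : option I -> bool)
  (l' : option I) : bool := c l' (+) (b && (l' == l)).

(** A unary corolla is the unit or [a] according to whether its legs have equal colours, which is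
    the parity on the right. If the half edges to be glued disagree, [bas k s c] is first replaced
    by its reflection. *)
Lemma lact_bas (J : finType) d (s : seq J) c : ordering s ->
  lact (P := MAss k) (bas k [:: tt] d) (bas k s c)
  = bas k s (recol None (d None (+) d (Some tt)) c).
Proof.
move=> os; rewrite /lact.
have ot : ordering [:: tt] by rewrite ordering_unit.
have eg r : map (@lunit_map J) (gseq tt [:: tt] r) = r.
  by rewrite /gseq /= insubF // cats0 -map_comp map_id.
have [e|e] := eqVneq (d (Some tt)) (c None).
  rewrite op_comp_bas // (@op_map_bas _ _ _ _ _ _ (recol None (d None (+) d (Some tt)) c)) ?eg //.
  - exact: lunit_map_bij.
  - exact: gseq_ordering.
  case=> [[u|y]|] /=; first by case: (no_other_unit u).
    by rewrite /recol andbF addbF.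
  by rewrite /recol eqxx andbT e addbA [c None (+) d None]addbC -addbA addbb addbF.
rewrite -[bas k s c]bas_rev op_comp_bas ?ordering_rev //; last first.
  by case: (d _) (c _) e => -[].
rewrite (@op_map_bas _ _ _ _ _ _ (fun l => ~~ recol None (d None (+) d (Some tt)) c l)) ?eg.
- by rewrite bas_rev.
- exact: lunit_map_bij.
- by rewrite gseq_ordering // ordering_rev.
case=> [[u|y]|] /=; first by case: (no_other_unit u).
  by rewrite /recol andbF addbF.
rewrite /recol eqxx andbT; by case: (d None) (d (Some tt)) (c None) e => [] [] [].
Qed.

Lemma ract_bas (I : finType) (i : I) d (s : seq I) c : ordering s ->
  ract (P := MAss k) i (bas k s c) (bas k [:: tt] d)
  = bas k s (recol (Some i) (d None (+) d (Some tt)) c).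
Proof.
move=> os; rewrite /ract.
have ot : ordering [:: tt] by rewrite ordering_unit.
have eg : map (@runit_map I i) (gseq i s [:: tt]) = s.
  rewrite map_flatten -map_comp -[RHS]map_id -[RHS]flatten_map1; congr flatten.
  apply: eq_map => x /=; case: insubP => [u _ <- //|] /=.
  by rewrite negbK => /eqP->.
have aux (d' : option unit -> bool) : c (Some i) = d' None ->
    op_map (MAss k) (@runit_map I i) (op_comp (o := MAss k) i (bas k s c) (bas k [:: tt] d'))
    = bas k s (recol (Some i) (d' None (+) d' (Some tt)) c).
  move=> e.
  rewrite op_comp_bas // (@op_map_bas _ _ _ _ _ _ (recol (Some i) (d' None (+) d' (Some tt)) c)) ?eg //.
  - exact: runit_map_bij.
  - exact: gseq_ordering.
  case=> [[u|[]]|] /=; rewrite /recol.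
  - by rewrite (_ : (Some (val u) == Some i) = (val u == i)) // (negPf (valP u)) andbF addbF.
  - by rewrite eqxx andbT e addbA addbb.
  - by rewrite andbF addbF.
have [e|e] := eqVneq (c (Some i)) (d None); first exact: aux.
rewrite -[bas k _ d]bas_rev /= aux; first by rewrite addbN addNb negbK.
by case: (d _) (c _) e => -[].
Qed.

Lemma MAss_unit_bas : MAss_unit k = bas k [:: tt] (fun=> false).
Proof.
have ot : ordering [:: tt] by rewrite ordering_unit.
apply/ffunP => A; rewrite (bas_mk k ot) ffunE -clsP; congr ((_ : bool)%:R).
apply/existsP/idP => [[m /andP[mA /eqP e]]|mA]; last first.
  by exists (mk_mcor ot (fun=> false)); rewrite mA !ffunE eqxx.
have es : mseq m = [:: tt] by apply/eqP; rewrite -ordering_unit mcor_ordering.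
move: mA; rewrite !clsP => /eqP->; rewrite cls_eq /miso.
case eN: (m.2 None); last first.
  apply/orP; left; apply/eqP/mcor_eq => // -[[]|]; by rewrite ffunE // -e eN.
apply/orP; right; rewrite /reflected es eqxx; apply/forallP => -[[]|];
 by rewrite ffunE // -?e eN.
Qed.

Lemma MAss_is_operad : is_operad (MAss k).
Proof.
have ot : ordering [:: tt] by rewrite ordering_unit.
split.
- by move=> *; apply: op_map_linear.
- move=> I f f1; have -> : f = id by apply: functional_extensionality.
  elim/mass_ind => [a x y Hx Hy|s c os]; first by rewrite op_map_linear Hx Hy.
  rewrite (@op_map_bas _ _ _ _ _ _ c) ?map_id //; first by exists id.
  by case.
- move=> I J L f g bf bg; elim/mass_ind => [a x y Hx Hy|s c os].
    by rewrite !op_map_linear Hx Hy.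
  have [f' fK f'K] := bf; have [g' gK g'K] := bg.
  have fc l : (c \o omap f') (omap f l) = c l by case: l => //= x; rewrite fK.
  have gc l : (c \o omap f' \o omap g') (omap g l) = (c \o omap f') l.
    by case: l => //= x; rewrite gK.
  rewrite (op_map_bas _ bf os fc) (op_map_bas _ bg _ gc) ?ordering_map //.
  have gfc l : (c \o omap f' \o omap g') (omap (g \o f) l) = c l.
    by case: l => //= x; rewrite gK fK.
  by rewrite (op_map_bas _ (bij_comp bg bf) os gfc) map_comp.
- by move=> I J i y a x x'; apply: op_compDl.
- by move=> I J i x a y y'; apply: op_compDr.
- exact: MAss_equivariant.
- exact: MAss_assoc_seq.
- exact: MAss_assoc_par.
- move=> J; elim/mass_ind => [a x y Hx Hy|s c os].
    by rewrite op_compDr op_map_linear Hx Hy.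
  rewrite -[LHS]/(lact _ _) [op_unit _]MAss_unit_bas lact_bas //.
  by apply: bas_ext => l; rewrite /recol /= addbF.
- move=> I i; elim/mass_ind => [a x y Hx Hy|s c os].
    by rewrite op_compDl op_map_linear Hx Hy.
  rewrite -[LHS]/(ract _ _ _) [op_unit _]MAss_unit_bas ract_bas //.
  by apply: bas_ext => l; rewrite /recol /= addbF.
Qed.

End OperadAxioms.

(** * Actions of K *)

Section Bimodule.
Variable k : fieldType.
Local Notation P := (MAss k).

Lemma lactDl (J : finType) a (c d : opK P) (x : op_sp P J) :
  lact (a *: c + d) x = a *: lact c x + lact d x.
Proof. by rewrite /lact op_compDl op_map_linear. Qed.

Lemma lact_linearr (J : finType) (c : opK P) : linear (@lact _ P J c).
Proof. by move=> a x y; rewrite /lact op_compDr op_map_linear. Qed.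

Lemma ractDl (I : finType) (i : I) a (x y : op_sp P I) (c : opK P) :
  ract i (a *: x + y) c = a *: ract i x c + ract i y c.
Proof. by rewrite /ract op_compDl op_map_linear. Qed.

Lemma ract_linearr (I : finType) (i : I) (x : op_sp P I) : linear (ract i x).
Proof. by move=> a c d; rewrite /ract op_compDr op_map_linear. Qed.

(** The basis of K: the unit for [false], and the generator [a], whose legs have different colours,
    for [true]. *)
Definition kflip (b : bool) : opK P :=
  bas k [:: tt] (fun l => b && (l == None)).

Lemma kflip1 : kflip false = MAss_unit k.
Proof. by rewrite MAss_unit_bas; apply: bas_ext => l. Qed.

Lemma kflip_ind (Q : opK P -> Prop) :
  (forall a x y, Q x -> Q y -> Q (a *: x + y)) ->
  (forall b, Q (kflip b)) -> forall c, Q c.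
Proof.
move=> QD Qb; apply: mass_ind => // s c; rewrite ordering_unit => /eqP->.
suff -> : bas k [:: tt] c = kflip (c None (+) c (Some tt)) by [].
rewrite /kflip; case e: (c (Some tt)).
  rewrite -bas_rev; apply: bas_ext => -[[]|]; rewrite ?e ?andbF ?andbT //.
  by rewrite addbT.
by apply: bas_ext => -[[]|]; rewrite ?e ?andbF ?andbT ?addbF.
Qed.

Lemma lact_flip (J : finType) b (s : seq J) c : ordering s ->
  lact (kflip b) (bas k s c : op_sp P J) = bas k s (recol None b c).
Proof. by move=> os; rewrite lact_bas // eqxx andbT andbF addbF. Qed.

Lemma ract_flip (I : finType) (i : I) b (s : seq I) c : ordering s ->
  ract i (bas k s c : op_sp P I) (kflip b) = bas k s (recol (Some i) b c).
Proof. by move=> os; rewrite ract_bas // eqxx andbT andbF addbF. Qed.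

Lemma op_map_lact (I J : finType) (f : I -> J) c x : bijective f ->
  op_map P f (lact c x) = lact c (op_map P f x).
Proof.
move=> bf; elim/kflip_ind: c => [a c d Hc Hd|b].
  by rewrite !lactDl op_map_linear Hc Hd.
elim/mass_ind: x => [a x y Hx Hy|s c os].
  by rewrite lact_linearr !op_map_linear Hx Hy lact_linearr.
have [g fK gK] := bf.
have gf c' l : (c' \o omap g) (omap f l) = c' l by case: l => //= z; rewrite fK.
rewrite lact_flip // (op_map_bas (c' := _ \o omap g) _ bf os (gf _ _)) (op_map_bas (c' := _ \o omap g) _ bf os (gf _ _)).
rewrite lact_flip ?ordering_map //; apply: bas_ext.
by case=> [z|]; rewrite /recol /= ?andbF ?andbT.
Qed.

Lemma op_map_ract (I J : finType) (f : I -> J) i c x : bijective f ->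
  op_map P f (ract i x c) = ract (f i) (op_map P f x) c.
Proof.
move=> bf; elim/kflip_ind: c => [a c d Hc Hd|b].
  by rewrite !ract_linearr op_map_linear Hc Hd.
elim/mass_ind: x => [a x y Hx Hy|s c os].
  by rewrite ractDl !op_map_linear Hx Hy ractDl.
have [g fK gK] := bf.
have gf c' l : (c' \o omap g) (omap f l) = c' l by case: l => //= z; rewrite fK.
rewrite ract_flip // (op_map_bas (c' := _ \o omap g) _ bf os (gf _ _)) (op_map_bas (c' := _ \o omap g) _ bf os (gf _ _)).
rewrite ract_flip ?ordering_map //; apply: bas_ext.
case=> [z|]; rewrite /recol /= ?andbF //; congr (_ (+) (_ && _)).
by rewrite -{2}[z]gK; apply/eqP/eqP => [[->]|[/(can_inj fK)->]].
Qed.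

(** This is what makes composition descend to the tensor product over K. *)
Lemma comp_ract_lact (I J : finType) (i : I) x c (y : op_sp P J) :
  op_comp i (ract i x c) y = op_comp i x (lact c y).
Proof.
elim/kflip_ind: c => [a c d Hc Hd|b].
  by rewrite lactDl ract_linearr op_compDl op_compDr Hc Hd.
elim/mass_ind: x => [a x x' Hx Hx'|s c os].
  by rewrite ractDl !op_compDl Hx Hx'.
(* The root colour of [y] is chosen to match the half edge [i] after the action on [x]; acting on
   [y] instead restores the original colour. *)
elim/(@mass_ind_root k J (c (Some i) (+) b)): y => [a y y' Hy Hy'|t d ot dc].
  by rewrite lact_linearr !op_compDr Hy Hy'.
have e1 : recol (Some i) b c (Some i) = d None by rewrite /recol eqxx andbT dc.
have e2 : c (Some i) = recol None b d None.
  by rewrite /recol eqxx andbT dc -addbA addbb addbF.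
rewrite ract_flip // lact_flip // (op_comp_bas _ os ot e1) (op_comp_bas _ os ot e2).
apply: bas_ext; case=> [[u|y]|]; rewrite /= /recol ?andbF ?addbF //.
by rewrite (_ : (Some (val u) == Some i) = (val u == i)) // (negPf (valP u)) andbF addbF.
Qed.

Lemma comp_ractr (I J : finType) (i : I) (j : J) (x : op_sp P I) y c :
  op_comp i x (ract j y c) = ract (inr j : graft J i) (op_comp i x y) c.
Proof.
elim/kflip_ind: c => [a c d Hc Hd|b].
  by rewrite !ract_linearr op_compDr Hc Hd.
elim/mass_ind: x => [a x x' Hx Hx'|s c os].
  by rewrite !op_compDl Hx Hx' ractDl.
elim/(@mass_ind_root k J (c (Some i))): y => [a y y' Hy Hy'|t d ot dc].
  by rewrite ractDl !op_compDr Hy Hy' ractDl.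
have e1 : c (Some i) = recol (Some j) b d None by rewrite /recol andbF addbF dc.
rewrite ract_flip // (op_comp_bas _ os ot e1) (op_comp_bas _ os ot (esym dc)).
rewrite ract_flip ?gseq_ordering //.
by apply: bas_ext; case=> [[u|y]|]; rewrite /= /recol ?andbF ?addbF.
Qed.

Lemma comp_ractl (I J : finType) (i : I) (u : {x : I | x != i})
    (x : op_sp P I) (y : op_sp P J) c :
  op_comp i (ract (val u) x c) y = ract (inl u : graft J i) (op_comp i x y) c.
Proof.
elim/kflip_ind: c => [a c d Hc Hd|b].
  by rewrite !ract_linearr op_compDl Hc Hd.
elim/mass_ind: x => [a x x' Hx Hx'|s c os].
  by rewrite ractDl !op_compDl Hx Hx' ractDl.
elim/(@mass_ind_root k J (c (Some i))): y => [a y y' Hy Hy'|t d ot dc].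
  by rewrite !op_compDr Hy Hy' ractDl.
have e1 : recol (Some (val u)) b c (Some i) = d None.
  rewrite /recol (_ : (Some i == Some (val u)) = (val u == i)).
    by rewrite (negPf (valP u)) andbF addbF.
  by rewrite eq_sym.
rewrite ract_flip // (op_comp_bas _ os ot e1) (op_comp_bas _ os ot (esym dc)).
rewrite ract_flip ?gseq_ordering //.
by apply: bas_ext; case=> [[v|z]|]; rewrite /= /recol ?andbF ?addbF.
Qed.

Lemma comp_lactl (I J : finType) (i : I) (x : op_sp P I) (y : op_sp P J) c :
  op_comp i (lact c x) y = lact c (op_comp i x y).
Proof.
elim/kflip_ind: c => [a c d Hc Hd|b].
  by rewrite !lactDl op_compDl Hc Hd.
elim/mass_ind: x => [a x x' Hx Hx'|s c os].
  by rewrite lact_linearr !op_compDl Hx Hx' lact_linearr.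
elim/(@mass_ind_root k J (c (Some i))): y => [a y y' Hy Hy'|t d ot dc].
  by rewrite !op_compDr Hy Hy' lact_linearr.
have e1 : recol None b c (Some i) = d None by rewrite /recol andbF addbF.
rewrite lact_flip // (op_comp_bas _ os ot e1) (op_comp_bas _ os ot (esym dc)).
rewrite lact_flip ?gseq_ordering //.
by apply: bas_ext; case=> [[v|z]|]; rewrite /= /recol ?andbF ?addbF.
Qed.

Lemma lact_unit (J : finType) (x : op_sp P J) : lact (kflip false) x = x.
Proof. rewrite kflip1; exact: (op_unitl (MAss_is_operad k) x). Qed.

Lemma lact_flipK (J : finType) b (x : op_sp P J) :
  lact (kflip b) (lact (kflip b) x) = x.
Proof.
elim/mass_ind: x => [a x y Hx Hy|s c os]; first by rewrite !lact_linearr Hx Hy.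
rewrite !lact_flip //; apply: bas_ext => l.
by rewrite /recol -addbA addbb addbF.
Qed.

End Bimodule.

(** * Trees as laminar families *)

Section TreeFacts.
Local Open Scope nat_scope.
Variable I : finType.
Implicit Types (F : {set {set I}}) (A B C D S : {set I}).

Definition laminar A B : bool := [|| A \subset B, B \subset A | [disjoint A & B]].

Lemma laminar_sym A B : laminar A B = laminar B A.
Proof. by rewrite /laminar orbCA disjoint_sym. Qed.

Lemma laminar_meet A B x : laminar A B -> x \in A -> x \in B ->
  (A \subset B) || (B \subset A).
Proof.
by case/or3P => [->|->|dAB] // xA xB; rewrite ?orbT //; rewrite (disjointFr dAB xA) in xB.
Qed.

Lemma is_treeP F :
  reflect [/\ [set: I] \in F, (forall S, S \in F -> 1 < #|S|)
            & forall A B, A \in F -> B \in F -> laminar A B]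
          (is_tree F).
Proof.
apply: (iffP and3P) => [[h1 /'forall_implyP h2 /'forall_implyP h3]|[h1 h2 h3]].
  by split=> // A B /h3/'forall_implyP; apply.
split=> //; first by apply/'forall_implyP.
by apply/'forall_implyP => A AF; apply/'forall_implyP => B BF; apply: h3.
Qed.

Lemma tree_setT F : is_tree F -> [set: I] \in F. Proof. by case/is_treeP. Qed.
Lemma tree_card F S : is_tree F -> S \in F -> 1 < #|S|.
Proof. by case/is_treeP => _ + _; apply. Qed.
Lemma tree_lam F A B : is_tree F -> A \in F -> B \in F -> laminar A B.
Proof. by case/is_treeP => _ _; apply. Qed.

Lemma is_tree_set1U F A : is_tree F -> 1 < #|A| ->
  (forall B, B \in F -> laminar A B) -> is_tree (A |: F).
Proof.
move=> tF A1 Alam; apply/is_treeP; split.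
- by rewrite in_setU1 tree_setT ?orbT.
- by move=> S /setU1P[->|/(tree_card tF)].
move=> B C /setU1P[->|BF] /setU1P[->|CF].
- by rewrite /laminar subxx.
- exact: Alam.
- by rewrite laminar_sym Alam.
exact: tree_lam tF BF CF.
Qed.

Lemma is_tree_set1D F A : is_tree F -> A != [set: I] -> is_tree (F :\ A).
Proof.
move=> tF AT; apply/is_treeP; split.
- by rewrite in_setD1 eq_sym AT tree_setT.
- by move=> S /setD1P[_ /(tree_card tF)].
by move=> B C /setD1P[_ BF] /setD1P[_ CF]; exact: tree_lam tF BF CF.
Qed.

Lemma tree_cardI F : is_tree F -> 1 < #|I|.
Proof. by move=> tF; rewrite -cardsT; apply: (tree_card tF); apply: tree_setT. Qed.

(** The sets labelling edges: members of [F] for the outgoing edges of vertices, singletons for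
    leaves. *)
Definition node F C : bool := (C \in F) || (#|C| == 1).

Lemma node_gt0 F C : is_tree F -> node F C -> 0 < #|C|.
Proof. by move=> tF /orP[/(tree_card tF)/ltnW|/eqP->]. Qed.

Lemma node_nonempty F C : is_tree F -> node F C -> exists x, x \in C.
Proof. by move=> tF /(node_gt0 tF)/card_gt0P. Qed.

Lemma laminar1 x B : laminar [set x] B.
Proof.
rewrite /laminar sub1set; case xB: (x \in B) => //=.
by rewrite disjoints1 xB orbT.
Qed.

Lemma node_lam F A B : is_tree F -> node F A -> node F B -> laminar A B.
Proof.
move=> tF /orP[AF|/cards1P[x ->]]; last by rewrite laminar1.
move=> /orP[BF|/cards1P[x ->]]; first exact: tree_lam tF AF BF.
by rewrite laminar_sym laminar1.
Qed.

Lemma kidsP F S C :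
  reflect [/\ C \proper S, node F C
            & forall D, D \in F -> C \proper D -> ~~ (D \proper S)]
          (C \in kids F S).
Proof.
rewrite inE; apply: (iffP and3P) => [[h1 h2 /'forall_implyP h3]|[h1 h2 h3]].
  by split=> // D /h3/implyP; apply.
by split=> //; apply/'forall_implyP => D DF; apply/implyP; apply: h3.
Qed.

Lemma kid_proper F S C : C \in kids F S -> C \proper S.
Proof. by case/kidsP. Qed.
Lemma kid_sub F S C : C \in kids F S -> C \subset S.
Proof. by move/kid_proper/proper_sub. Qed.
Lemma kid_node F S C : C \in kids F S -> node F C.
Proof. by case/kidsP. Qed.

(** Once [D] meets [C], laminarity makes it comparable with both [C] and [S], and no member lies
    strictly between a kid and its parent. *)
Lemma kid_max F S C D x : is_tree F -> C \in kids F S -> S \in F -> D \in F ->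
  x \in C -> x \in D -> (D \subset C) || (S \subset D).
Proof.
move=> tF /kidsP[CS nC Cmax] SF DF xC xD.
have /orP[CD|->//] := laminar_meet (node_lam tF nC (introT orP (or_introl DF))) xC xD.
have xS := subsetP (proper_sub CS) _ xC.
have /orP[SD|DS] := laminar_meet (tree_lam tF SF DF) xS xD; first by rewrite SD orbT.
have [->|nCD] := eqVneq C D; first by rewrite subxx.
have CpD : C \proper D by rewrite properEneq nCD.
have := Cmax _ DF CpD; rewrite properEneq DS andbT negbK => /eqP->.
by rewrite subxx orbT.
Qed.

Lemma parent_ex F C : is_tree F -> node F C -> C != [set: I] ->
  exists2 S, S \in F & C \in kids F S.
Proof.
move=> tF nC CT; have CpT : C \proper [set: I] by rewrite properT.
have P0 : ([set: I] \in F) && (C \proper [set: I]) by rewrite tree_setT.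
case: (@arg_minnP _ [set: I] (fun S => (S \in F) && (C \proper S)) (fun S => #|S|) P0).
move=> S /andP[SF CS] Smin; exists S => //; apply/kidsP; split=> // D DF CD.
apply/negP => /proper_card; apply/negP; rewrite -leqNgt; apply: Smin.
by rewrite DF.
Qed.

Lemma parent_uniq F C S S' : is_tree F -> S \in F -> S' \in F ->
  C \in kids F S -> C \in kids F S' -> S = S'.
Proof.
move=> tF SF S'F CS CS'; have [x xC] := node_nonempty tF (kid_node CS).
have xS := subsetP (kid_sub CS) _ xC; have xS' := subsetP (kid_sub CS') _ xC.
have h T T' : T \in F -> T' \in F -> C \in kids F T -> C \in kids F T' -> x \in T' ->
    T \subset T'.
  move=> TF T'F CT CT' xT'; have /orP[|//] := kid_max tF CT TF T'F xC xT'.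
  by move/(proper_sub_trans (kid_proper CT')); rewrite properxx.
by apply/eqP; rewrite eqEsubset !h.
Qed.

Lemma kids_cover F S x : is_tree F -> S \in F -> x \in S ->
  exists2 C, C \in kids F S & x \in C.
Proof.
move=> tF SF xS.
have P0 : [&& node F [set x], [set x] \proper S & x \in [set x]].
  rewrite /node cards1 eqxx orbT properEcard sub1set xS cards1 inE eqxx andbT /=.
  exact: tree_card tF SF.
case: (@arg_maxnP _ [set x] (fun C => [&& node F C, C \proper S & x \in C])
        (fun C => #|C|) P0) => C /and3P[nC CS xC] Cmax.
exists C => //; apply/kidsP; split=> // D DF CD; apply/negP => DS.
have : #|D| <= #|C|.
  by apply: Cmax; rewrite /node DF DS (subsetP (proper_sub CD)).
by rewrite leqNgt proper_card.
Qed.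

Lemma kids_disj F S C C' x : is_tree F -> C \in kids F S -> C' \in kids F S ->
  x \in C -> x \in C' -> C = C'.
Proof.
move=> tF.
have h B B' : B \in kids F S -> B' \in kids F S -> B \subset B' -> B = B'.
  move=> BS B'S BB'; apply/eqP; apply: contraT => nBB'.
  have BpB' : B \proper B' by rewrite properEneq nBB'.
  case/orP: (kid_node B'S) => [B'F|/eqP B'1].
    case/kidsP: BS => _ _ /(_ _ B'F BpB'); by rewrite (kid_proper B'S).
  by have := proper_card BpB'; rewrite B'1 ltnNge (node_gt0 tF) // (kid_node BS).
move=> CS C'S xC xC'.
have := laminar_meet (node_lam tF (kid_node CS) (kid_node C'S)) xC xC'.
by case/orP => [/h->|/h->].
Qed.

Lemma kids_ge2 F S : is_tree F -> S \in F -> 1 < #|kids F S|.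
Proof.
move=> tF SF; have [x xS] : exists x, x \in S.
  by apply/card_gt0P; apply: ltnW; apply: tree_card tF SF.
have [C CS xC] := kids_cover tF SF xS.
have /properP[_ [y yS yC]] := kid_proper CS.
have [C' C'S yC'] := kids_cover tF SF yS.
have C'C : C' != C by apply: contraNneq yC => <-.
by rewrite (cardsD1 C) CS (cardsD1 C') in_setD1 C'S C'C.
Qed.

(** Deleting [e] can only remove an obstruction to maximality: the new kids of [S] are the sets
    whose sole intermediate member was [e], that is, the kids of [e]. *)
Lemma kids_contract F S e : is_tree F -> S \in F :\ e -> e \in F -> 
  e != [set: I] ->
  kids (F :\ e) S =
    if e \in kids F S then kids F S :\ e :|: kids F e else kids F S.
Proof.
move=> tF; rewrite in_setD1 => /andP[Se SF] eF eT.
have eS C : C \in kids (F :\ e) S -> C != e.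
  move=> /kid_node; apply: contraTneq => ->; rewrite /node in_setD1 eqxx /=.
  by rewrite gtn_eqF // (tree_card tF).
have nCe C : C != e -> node (F :\ e) C = node F C.
  by move=> Ce; rewrite /node in_setD1 Ce.
have grow C : C \in kids F S -> C != e -> C \in kids (F :\ e) S.
  move=> /kidsP[CS nC Cmax] Ce; apply/kidsP; split; rewrite ?nCe //.
  by move=> D /setD1P[_]; apply: Cmax.
apply/setP => C; case: ifP => eK; last first.
  apply/idP/idP => [CK|CK]; last by apply: grow => //; apply: contraFneq eK => <-.
  have := CK => /kidsP[CS + Cmax]; rewrite nCe ?eS // => nC.
  apply/kidsP; split=> // D DF CD; apply/negP => DS.
  have De : D = e.
    by apply/eqP; apply: contraTT DS => De; apply: Cmax => //; rewrite in_setD1 De.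
  move/negP: eK; apply; apply/kidsP; split; rewrite -?De /node ?DF //.
  move=> D' D'F DD'; apply: Cmax; last exact: proper_trans CD DD'.
  by rewrite in_setD1 D'F -De andbT; apply: contraTneq DD' => ->; rewrite properxx.
have eP := kid_proper eK; rewrite in_setU in_setD1.
apply/idP/idP => [CK|].
  have Ce := eS _ CK; have := CK => /kidsP[CS + Cmax]; rewrite nCe // => nC.
  rewrite Ce /=; case CKS: (C \in kids F S) => //=.
  have inF' D : D \in F -> C \proper D -> D \proper S -> D = e.
    move=> DF CD DS; apply/eqP; apply: contraTT DS => De; apply: Cmax => //.
    by rewrite in_setD1 De.
  have CpE : C \proper e.
    move/negbT: CKS; apply: contraR => CpE; apply/kidsP; split=> // D DF CD.
    by apply: contra CpE => DS; rewrite -(inF' _ DF CD DS).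
  apply/kidsP; split=> // D DF CD; apply/negP => De.
  have := inF' _ DF CD (proper_trans De eP) => eDe.
  by rewrite eDe properxx in De.
case/orP => [/andP[Ce CK]|CK]; first exact: grow.
have Ce : C != e by apply: contraTneq (kid_proper CK) => ->; rewrite properxx.
case/kidsP: (CK) => CpE nC Cmax; apply/kidsP; split.
- exact: proper_trans CpE eP.
- by rewrite nCe.
move=> D /setD1P[De DF] CD; apply/negP => DS.
have [x xC] := node_nonempty tF nC.
have xD := subsetP (proper_sub CD) _ xC.
have xe := subsetP (proper_sub CpE) _ xC.
have /orP[De'|SD] := kid_max tF eK SF DF xe xD; last first.
  by have := proper_sub_trans DS SD; rewrite properxx.
by have := Cmax _ DF CD; rewrite properEneq De De'.
Qed.

Lemma card_inp F S : #|inp F S| = #|kids F S|.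
Proof. by rewrite card_sig; apply: eq_card => C; rewrite !inE. Qed.

(** Double count of the edges other than the root leg: each leaf and each member of [F] except the
    full set has exactly one parent. The successor accounts for the full set. *)
Lemma count_kids F : is_tree F ->
  (\sum_(S in F) #|kids F S|).+1 = #|F| + #|I|.
Proof.
move=> tF; have I1 := tree_cardI tF.
have -> : \sum_(S in F) #|kids F S| =
    \sum_C \sum_(S in F) (C \in kids F S : nat).
  rewrite exchange_big /=; apply: eq_bigr => S _.
  by rewrite -sum1_card big_mkcond.
have -> : \sum_C \sum_(S in F) (C \in kids F S : nat)
    = \sum_C (node F C && (C != [set: I]) : nat).
  apply: eq_bigr => C _; case nC: (node F C && _).
    have /andP[n CT] := nC; have [S SF CS] := parent_ex tF n CT.
    rewrite (bigD1 S) //= CS big1 // => S' /andP[S'F S'S].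
    case CS': (C \in kids F S') => //.
    by rewrite (parent_uniq tF S'F SF CS' CS) eqxx in S'S.
  rewrite big1 // => S SF; case CS: (C \in _) => //; move: nC.
  rewrite (kid_node CS) /=; case: eqP => // CT.
  by have := proper_sub_trans (kid_proper CS) (subsetT S); rewrite CT properxx.
have -> : \sum_C (node F C && (C != [set: I]) : nat) =
    #|(F :\ [set: I]) :|: [set [set x] | x : I]|.
  rewrite -sum1_card [RHS]big_mkcond; apply: eq_bigr => C _.
  rewrite !inE; suff -> : (C \in [set [set x] | x : I]) = (#|C| == 1).
    rewrite /node; case C1: (#|C| == 1); rewrite ?orbT ?orbF ?[_ && (C \in F)]andbC /=.
      rewrite (_ : C != [set: I]) //; apply: contraTneq C1 => ->.
      by rewrite cardsT gtn_eqF.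
    by case: (_ && _).
  by apply/imsetP/cards1P => [[x _ ->]|[x ->]]; exists x.
rewrite cardsU card_imset; last exact: set1_inj.
rewrite (_ : _ :&: _ = set0) ?cards0 ?subn0; last first.
  apply/setP => C; rewrite !inE; apply/negP => /andP[/andP[_ /(tree_card tF)]].
  by move=> + /imsetP[x _ eC]; rewrite eC cards1.
by rewrite [#|F|](cardsD1 [set: I]) tree_setT // add1n addSn.
Qed.

Lemma card_tree F : is_tree F -> #|F| < #|I|.
Proof.
move=> tF; have := count_kids tF.
have : \sum_(S in F) 2 <= \sum_(S in F) #|kids F S|.
  by apply: leq_sum => S; apply: kids_ge2.
rewrite sum_nat_const; lia.
Qed.

(** The equality case of [card_tree]: a sum of inequalities [2 <= #|kids F S|] is an equality
    exactly when every term is. *)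
Lemma binary_card (T : rtree I) : binary T = (nvert T == #|I|.-1).
Proof.
case: T => F tF; rewrite /binary /nvert /=.
have h := count_kids tF; have lF := card_tree tF.
have le2 : \sum_(S in F) 2 <= \sum_(S in F) #|kids F S|.
  by apply: leq_sum => S; apply: kids_ge2.
have -> : [forall v : vert (Sub F tF : rtree I), #|kids F (val v)| == 2]
    = [forall S in F, 2 == #|kids F S|].
  apply/forallP/forall_inP => [h' S SF|h' v]; rewrite eq_sym.
    exact: (h' (Sub S SF)).
  by apply: h'; apply: (valP v).
have E : \sum_(S in F) 2 <= \sum_(S in F) #|kids F S|
     ?= iff [forall (S | S \in F), 2 == #|kids F S|].
  by apply: leqif_sum => S SF; apply: leqif_eq; apply: kids_ge2.
rewrite -(eq_leqif E); clear E; move: h le2; rewrite !sum_nat_const; set s := \sum_(S in F) _; move=> h le2.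
have {}h : s.+1 = #|F| + #|I| by []; have {}le2 : #|F| * 2 <= s by [].
move: lF h le2; move: (#|F|) (#|I|) s => f n s lF h le2.
by apply/eqP/eqP; lia.
Qed.

End TreeFacts.

(** * Kids of a vertex in a linear order *)

Arguments contract_dec {k P I T} e p.

Section Orders.
Local Open Scope nat_scope.
Variable I : finType.
Implicit Types (F : {set {set I}}) (A B C D S : {set I}) (s : seq I).

Definition conv s S : bool :=
  [forall a, forall b, forall c,
    [&& index a s < index b s, index b s < index c s, a \in S & c \in S]
    ==> (b \in S)].

Lemma convP s S : reflect (forall a b c, index a s < index b s ->
   index b s < index c s -> a \in S -> c \in S -> b \in S) (conv s S).
Proof.
apply: (iffP forallP) => [h a b c ab bc aS cS|h a].
  by move/forallP/(_ b)/forallP/(_ c): (h a); rewrite ab bc aS cS.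
by apply/forallP => b; apply/forallP => c; apply/implyP => /and4P[]; apply: h.
Qed.

Definition first s S : nat := find (mem S) s.

Lemma index_ord_inj s : ordering s -> injective (index^~ s).
Proof. by move=> os x y; apply: (index_inj x); apply: ordering_mem. Qed.

Lemma first_le s S x : ordering s -> x \in S -> first s S <= index x s.
Proof.
move=> os xS; rewrite leqNgt; apply/negP => /(before_find x).
by rewrite nth_index ?ordering_mem //= xS.
Qed.

Lemma first_in s S x : ordering s -> x \in S ->
  exists2 y, y \in S & index y s = first s S.
Proof.
move=> os xS; have hS : has (mem S) s by apply/hasP; exists x; rewrite ?ordering_mem.
exists (nth x s (first s S)); first exact: (nth_find x hS).
by rewrite index_uniq ?(ordering_uniq os) // -has_find.
Qed.

Lemma first_sub s A B x : ordering s -> x \in A -> A \subset B ->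
  first s B <= first s A.
Proof.
move=> os xA AB; have [y yA <-] := first_in os xA.
exact/first_le/(subsetP AB).
Qed.

(** Otherwise the first element of [C] would lie between two elements of the interval [B], hence in
    [B], against disjointness. *)
Lemma first_conv s A B C x y : ordering s -> conv s B -> A \subset B ->
  x \in A -> y \in C -> [disjoint B & C] -> first s B < first s C ->
  first s A < first s C.
Proof.
move=> os cB AB xA yC BC BltC; rewrite ltnNge leq_eqVlt; apply/negP.
have [a aA <-] := first_in os xA; have aB := subsetP AB _ aA.
have [c cC ec] := first_in os yC; have [b bB eb] := first_in os aB.
have nBC z : z \in B -> z \in C -> False by move=> zB; rewrite (disjointFr BC zB).
rewrite -ec in BltC *; rewrite -eb in BltC.
case/orP=> [/eqP/(index_ord_inj os) e|ca]; first by apply: (nBC a); rewrite // -e.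
by apply: (nBC c) => //; apply: (convP _ _ cB b c a).
Qed.

(** Inputs are sorted by their first leaves. For disjoint intervals this is their natural order, but
    the definition makes sense for every leaf order. *)
Definition kidseq F S s : seq (inp F S) :=
  sort (relpre (fun w => first s (val w)) leq) (enum (inp F S)).

Lemma kidseq_ordering F S s : ordering (kidseq F S s).
Proof. by rewrite /ordering perm_sort. Qed.

Lemma inp_first_inj F S s : is_tree F -> ordering s ->
  injective (fun w : inp F S => first s (val w)).
Proof.
move=> tF os w w' /= e; apply: val_inj.
have [x xw] := node_nonempty tF (kid_node (valP w)).
have [x' xw'] := node_nonempty tF (kid_node (valP w')).
have [y yw ey] := first_in os xw; have [y' yw' ey'] := first_in os xw'.
apply: (kids_disj tF (valP w) (valP w') yw).
by rewrite (index_ord_inj os (_ : index y s = index y' s)) // ey e ey'.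
Qed.

Lemma kidseq_sorted F S s : is_tree F -> ordering s ->
  sorted (relpre (fun w => first s (val w)) ltn) (kidseq F S s).
Proof.
move=> tF os; rewrite -sorted_map ltn_sorted_uniq_leq.
rewrite map_inj_uniq ?(ordering_uniq (kidseq_ordering _ _ _)) /=; last exact: inp_first_inj.
by rewrite sorted_map; apply: sort_sorted => x y /=; apply: leq_total.
Qed.

Lemma kidseq_eq F S s (t : seq (inp F S)) : is_tree F -> ordering s ->
  ordering t -> sorted (relpre (fun w => first s (val w)) ltn) t ->
  kidseq F S s = t.
Proof.
move=> tF os ot st; apply: (irr_sorted_eq _ _ (kidseq_sorted _ tF os) st).
- by move=> x y z /=; apply: ltn_trans.
- by move=> x /=; rewrite ltnn.
by move=> x; rewrite !ordering_mem // kidseq_ordering.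
Qed.

End Orders.

(** * Order of the inputs under contraction of an edge *)

Section MergeOrder.
Local Open Scope nat_scope.
Variable I : finType.

Lemma first_kid_lt F (S e C C' : {set I}) s : is_tree F -> ordering s -> conv s e ->
  e \in kids F S -> C \in kids F e -> C' \in kids F S -> C' != e ->
  first s e < first s C' -> first s C < first s C'.
Proof.
move=> tF os ce eS Ce C'S C'e.
have [x xC] := node_nonempty tF (kid_node Ce).
have [y yC'] := node_nonempty tF (kid_node C'S).
apply: first_conv (kid_sub Ce) xC yC' _ => //.
apply/pred0P => z; apply/negP => /andP[ze zC'].
by case/eqP: C'e; apply: (kids_disj tF C'S eS zC' ze).
Qed.

Lemma first_kid_ge F (e C C' : {set I}) s : is_tree F -> ordering s ->
  C' \in kids F e -> first s C < first s e -> first s C < first s C'.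
Proof.
move=> tF os C'e /leq_trans; apply.
have [x xC] := node_nonempty tF (kid_node C'e).
exact: first_sub xC (kid_sub C'e).
Qed.

(** The input of the lower vertex through which [z] is reached. *)
Definition gbase (A B : finType) (i : A) (z : graft B i) : A :=
  match z with inl u => val u | inr _ => i end.

(** The kids of [e] start no earlier than [e]; that they also start before any later sibling of [e]
    uses that [e] is an interval. *)
Lemma merge_first_lt (T : rtree I) (e : edge T) S
    (h : val e \in kids (val T) S) s z z' : ordering s -> conv s (val e) ->
  first s (val (gbase z)) < first s (val (gbase z')) ->
  first s (val (merge_inp (h := h) z)) < first s (val (merge_inp (h := h) z')).
Proof.
move=> os ce; have tF : is_tree (val T) := valP T.
case: z z' => [u|w] [u'|w'].
- by [].
- exact: (first_kid_ge tF os (valP w')).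
- apply: (first_kid_lt tF os ce h (valP w) (valP (val u'))).
  by apply: contra (valP u') => /eqP e1; apply/eqP/val_inj.
- by move=> lt_ee; rewrite ltnn in lt_ee.
Qed.

End MergeOrder.

Section ContractDec.
Local Open Scope nat_scope.
Variables (k : fieldType) (P : operad_data k) (I : finType).

(** [contract_dec] branches on a proof that its branches mention; proof irrelevance allows that
    proof to be replaced by a given one. *)
Lemma match_reflectT (Q : Prop) (b : bool) (A : Type) (f : Q -> A)
    (g : ~ Q -> A) (r : reflect Q b) (h : Q) : (forall h1 h2, f h1 = f h2) ->
  match r with ReflectT h' => f h' | ReflectF h' => g h' end = f h.
Proof. by move=> irr; case: r. Qed.

Lemma match_reflectF (Q : Prop) (b : bool) (A : Type) (f : Q -> A)
    (g : ~ Q -> A) (r : reflect Q b) y : ~ Q -> (forall h', g h' = y) ->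
  match r with ReflectT h' => f h' | ReflectF h' => g h' end = y.
Proof. by move=> nQ gy; case: r. Qed.

Lemma contract_dec_merge (T : rtree I) (e : edge T) (p : dec P T)
    (v : vert (contract e)) (h : val e \in kids (val T) (val v)) :
  contract_dec e p v = op_map P (@merge_inp _ _ _ _ h)
    (op_comp (Sub (val e) h : inp (val T) (val v)) (p (old v)) (p (top e))).
Proof.
rewrite /contract_dec (match_reflectT _ _ h) // => h1 h2.
by rewrite (bool_irrelevance h1 h2).
Qed.

Lemma contract_dec_keep (T : rtree I) (e : edge T) (p : dec P T)
    (v : vert (contract e)) (h : val e \notin kids (val T) (val v)) :
  contract_dec e p v = op_map P (keep_inp h) (p (old v)).
Proof.
apply: match_reflectF => [|h']; first exact/negP.
by rewrite (bool_irrelevance (introN idP h') h).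
Qed.

End ContractDec.

(** * Contraction of decorations given by a leaf order *)

Section Contraction.
Local Open Scope nat_scope.
Variable I : finType.
Implicit Types (T : rtree I) (S : {set I}).

Lemma rtreeP T : is_tree (val T). Proof. exact: valP T. Qed.

Lemma edgeP T (e : edge T) : val e != [set: I] /\ val e \in val T.
Proof. by have := valP e; rewrite in_setD1 => /andP. Qed.

Lemma keep_inp_bij T (e : edge T) S (h : val e \notin kids (val T) S) :
  S \in val T :\ val e -> bijective (keep_inp h).
Proof.
move=> SF; have [eT eF] := edgeP e; apply: inj_card_bij => [w w' [] /val_inj //|].
by rewrite !card_inp kids_contract ?rtreeP // (negPf h).
Qed.

Lemma merge_inp_bij T (e : edge T) S (h : val e \in kids (val T) S) :
  S \in val T :\ val e -> bijective (merge_inp (h := h)).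
Proof.
move=> SF; have [eT eF] := edgeP e; have tF := rtreeP T.
have sub C : C \in kids (val T) (val e) -> C \in kids (val T) S -> C = val e.
  move=> Ce CS; have [x xC] := node_nonempty tF (kid_node Ce).
  exact: kids_disj tF CS h xC (subsetP (kid_sub Ce) _ xC).
have nKe C : C \in kids (val T) (val e) -> C != val e.
  by move/kid_proper; apply: contraTneq => ->; rewrite properxx.
apply: inj_card_bij => [|].
  case=> [u|w] [u'|w'] /= /(congr1 val) /= e1.
  - by congr inl; do 2!apply: val_inj.
  - have Ce : val (val u) \in kids (val T) (val e) by rewrite [val (val u)]e1 (valP w').
    by case/eqP: (nKe _ Ce); apply: sub Ce (valP (val u)).
  - have Ce : val (val u') \in kids (val T) (val e) by rewrite -[val (val u')]e1 (valP w).
    by case/eqP: (nKe _ Ce); apply: sub Ce (valP (val u')).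
  - by congr inr; apply: val_inj.
rewrite card_graft !card_inp [kids (val (contract e)) S](kids_contract tF) // h.
apply: leq_trans (leq_card_setU _ _) _.
by rewrite leq_add2r [#|kids (val T) S|](cardsD1 (val e)) h.
Qed.

Lemma pairwise_gseq (A B : finType) (i : A) (s : seq A) (t : seq B)
    (R : rel (graft B i)) (rs : rel A) (rt : rel B) :
  pairwise rs s -> pairwise rt t ->
  (forall z z', rs (gbase z) (gbase z') -> R z z') ->
  (forall y y', rt y y' -> R (inr y) (inr y')) ->
  pairwise R (gseq i s t).
Proof.
move=> + pt hs ht; elim: s => //= x s IH /andP[xs /IH {}IH].
rewrite gseq_cons pairwise_cat IH andbT; apply/andP; split.
  apply/allrelP => z z' zx; rewrite mem_gseq => z's; apply: hs.
  have -> : gbase z = x.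
    move: zx; case: insubP => [u _ <-|]; first by rewrite inE => /eqP->.
    by rewrite negbK => /eqP-> /mapP[y _ ->].
  by apply: (allP xs); case: z' z's => // y /andP[].
case: insubP => // _; rewrite pairwise_map.
exact: (sub_pairwise (fun y y' => @ht y y')).
Qed.

Variable k : fieldType.

(** [eta] colours edges rather than half edges: both ends of an internal edge receive the colour of
    its set, so gluing along it needs no reflection. *)
Definition std_dec T (s : seq I) (eta : {set I} -> bool) : dec (MAss k) T :=
  fun v => bas k (kidseq (val T) (val v) s)
    (fun l => if l is Some w then eta (val w) else eta (val v)).

Arguments std_dec : clear implicits.

(** The half edges of [e] both carry [eta (val e)], so the corollas glue as they stand, and as [e]
    is an interval the glued listing is still sorted by first leaves. *)
Lemma contract_std_dec T (e : edge T) s eta : ordering s -> conv s (val e) ->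
  contract_dec e (std_dec T s eta) = std_dec (contract e) s eta.
Proof.
move=> os ce; apply: functional_extensionality_dep => v.
have tF := rtreeP T; have tF' := rtreeP (contract e).
have [eT eF] := edgeP e.
have SF : val v \in val T :\ val e by apply: (valP v).
have [h|h] := boolP (val e \in kids (val T) (val v)).
  rewrite (contract_dec_merge _ h).
  have bm := merge_inp_bij h SF.
  have oS := kidseq_ordering (val T) (val (old v)) s.
  have oE := kidseq_ordering (val T) (val (top e)) s.
  rewrite (op_comp_bas k oS oE) //.
  rewrite (@op_map_bas k _ _ _ _ _ (fun l => if l is Some w then eta (val w) else eta (val v))
     bm (gseq_ordering _ oS oE)); last by case=> [[u|w]|].
  apply: bas_seq; symmetry; apply: kidseq_eq => //.
    by apply: ordering_map bm _; apply: gseq_ordering.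
  rewrite sorted_pairwise; last by move=> x y z /=; apply: ltn_trans.
  rewrite pairwise_map.
  have sS := kidseq_sorted (val (old v)) tF os.
  have sE := kidseq_sorted (val (top e)) tF os.
  rewrite sorted_pairwise in sS; last by move=> x y z /=; apply: ltn_trans.
  rewrite sorted_pairwise in sE; last by move=> x y z /=; apply: ltn_trans.
  apply: (pairwise_gseq sS sE) => [z z'|//]; exact: merge_first_lt.
rewrite (contract_dec_keep _ h); have bk := keep_inp_bij h SF.
have oS := kidseq_ordering (val T) (val (old v)) s.
rewrite (@op_map_bas k _ _ _ _ _ (fun l => if l is Some w then eta (val w) else eta (val v)) bk oS);
  last by case.
apply: bas_seq; symmetry; apply: kidseq_eq => //; first exact: ordering_map.
by rewrite sorted_map; apply: kidseq_sorted.
Qed.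

End Contraction.

Arguments std_dec {I} k T s eta v.

(** * From orders at the vertices to an order of the leaves *)

Section Flatten.
Local Open Scope nat_scope.
Variable I : finType.
Variable T : rtree I.
Let F := val T.
Let tF : is_tree F := valP T.

Definition listing (sq : {set I} -> seq {set I}) : Prop :=
  forall S, S \in F -> uniq (sq S) /\ sq S =i kids F S.

(** Depth-first reading of the leaves above [C]. The number [n] is fuel, sufficient as soon as it
    bounds [#|C|]. *)
Fixpoint flat (sq : {set I} -> seq {set I}) n C : seq I :=
  if n is m.+1 then
    if C \in F then flatten [seq flat sq m D | D <- sq C] else enum C
  else [::].

Variable sq : {set I} -> seq {set I}.
Hypothesis sqP : listing sq.

Lemma flat_uniq_mem n C : node F C -> #|C| <= n ->
  uniq (flat sq n C) /\ flat sq n C =i C.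
Proof.
elim: n C => [|n IH] C nC Cn; first by have := leq_trans (node_gt0 tF nC) Cn.
rewrite /=; case: ifP => CF; last by split; [apply: enum_uniq|apply: mem_enum].
have [us ms] := sqP CF.
have IHK D : D \in kids F C -> uniq (flat sq n D) /\ flat sq n D =i D.
  move=> DK; apply: IH; first exact: kid_node DK.
  by rewrite -ltnS (leq_trans (proper_card (kid_proper DK)) Cn).
split.
  have sub : {subset sq C <= kids F C} by move=> D; rewrite ms.
  move: (sq C) us sub {ms} => l; elim: l => //= D l IHl /andP[Dl ul] sub.
  have DK : D \in kids F C by apply: sub; rewrite mem_head.
  have sub' : {subset l <= kids F C} by move=> E El; apply: sub; rewrite inE El orbT.
  rewrite cat_uniq (IHK _ DK).1 IHl // andbT; apply/hasPn => x /flatten_mapP[E El].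
  have EK := sub' _ El; rewrite (IHK _ EK).2 (IHK _ DK).2 => xE.
  by apply: contra Dl => xD; rewrite (kids_disj tF DK EK xD xE).
move=> x; apply/flatten_mapP/idP => [[D]|xC].
  by rewrite ms => DK; rewrite (IHK _ DK).2; apply/subsetP/kid_sub/DK.
have [D DK xD] := kids_cover tF CF xC.
by exists D; rewrite ?ms // (IHK _ DK).2.
Qed.

(** The leaves above a vertex are read without interruption, which is why their set is an interval.
    The fuel left on reaching [v] is existential, as it depends on the depth. *)
Lemma flat_infix n C v : node F C -> #|C| <= n -> v \in F -> v \subset C ->
  exists m a b, #|v| <= m /\ flat sq n C = a ++ flat sq m v ++ b.
Proof.
move=> + + vF; elim: n C => [|n IH] C nC Cn vC.
  by have := leq_trans (node_gt0 tF nC) Cn.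
have [->|vnC] := eqVneq v C; first by exists n.+1, [::], [::]; rewrite cats0.
have CF : C \in F.
  case/orP: nC => // /eqP C1; have vpC : v \proper C by rewrite properEneq vnC.
  by have := proper_card vpC; rewrite C1 ltnNge ltnW // (tree_card tF).
have [us ms] := sqP CF.
have [x xv] : exists x, x \in v by apply: (node_nonempty tF); rewrite /node vF.
have [D DK xD] := kids_cover tF CF (subsetP vC _ xv).
have vD : v \subset D.
  case/orP: (kid_max tF DK CF vF xD xv) => // Cv.
  by move/eqP: vnC; case; apply/eqP; rewrite eqEsubset vC.
have [|m [a [b [vm e]]]] := IH D (kid_node DK) _ vD.
  by rewrite -ltnS (leq_trans (proper_card (kid_proper DK)) Cn).
have : D \in sq C by rewrite ms.
rewrite /= CF => /splitPr[l1 l2]; rewrite map_cat flatten_cat /= e.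
exists m, (flatten [seq flat sq n E | E <- l1] ++ a),
  (b ++ flatten [seq flat sq n E | E <- l2]); split=> //.
by rewrite !catA.
Qed.

Let s := flat sq #|I| [set: I].

Lemma node_setT : node F [set: I]. Proof. by rewrite /node tree_setT. Qed.

Lemma flat_ordering : ordering s.
Proof.
have [||us ms] := @flat_uniq_mem #|I| [set: I]; rewrite ?cardsT ?node_setT //.
by apply: orderingP => // x; rewrite ms inE.
Qed.

Lemma mem_infix (J : eqType) (a t b : seq J) x : uniq (a ++ t ++ b) ->
  x \in a ++ t ++ b ->
  (x \in t) = (size a <= index x (a ++ t ++ b) < size a + size t).
Proof.
rewrite !cat_uniq !mem_cat has_cat negb_or !index_cat.
case/and3P=> ua /andP[/hasPn at_ /hasPn ab] /and3P[ut /hasPn tb ub].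
case xa: (x \in a) => /=.
  have -> : (x \in t) = false by apply/negP => /at_; rewrite xa.
  by rewrite leqNgt index_mem xa.
case xt: (x \in t) => /= xb; first by rewrite leq_addr ltn_add2l index_mem xt.
by lia.
Qed.

Lemma flat_conv S : S \in F -> conv s S.
Proof.
move=> SF; have [|m [a [b [Sm e]]]] := @flat_infix #|I| [set: I] S node_setT _ SF (subsetT S).
  by rewrite cardsT.
have os := flat_ordering; have us := ordering_uniq os.
have [_ ms] := @flat_uniq_mem m S (introT orP (or_introl SF)) Sm.
have mS x : (x \in S) = (size a <= index x s < size a + size (flat sq m S)).
  by rewrite -ms [in RHS]/s e; apply: mem_infix; rewrite -e // ordering_mem.
by apply/convP => x y z; rewrite !mS; lia.
Qed.

Lemma pairwise_split (J : Type) (r : rel J) (l : seq J) :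
  (forall l1 x l2, l = l1 ++ x :: l2 -> all (r x) l2) -> pairwise r l.
Proof.
elim: l => //= x l IH h; rewrite (h [::]) //=; apply: IH => l1 y l2 e.
by apply: (h (x :: l1)); rewrite e.
Qed.

(** The whole block of an earlier kid is read before the block of a later one. *)
Lemma flat_first S : S \in F -> pairwise (fun C D => first s C < first s D) (sq S).
Proof.
move=> SF; have [|m [a [b [Sm e]]]] := @flat_infix #|I| [set: I] S node_setT _ SF (subsetT S).
  by rewrite cardsT.
have os := flat_ordering; have us := ordering_uniq os.
have [_ ms] := sqP SF.
apply: pairwise_split => l1 D l2 eS.
have kS E : E \in sq S -> E \in kids F S by rewrite ms.
apply/allP => E El2.
have DK : D \in kids F S by apply: kS; rewrite eS mem_cat mem_head orbT.
have EK : E \in kids F S by apply: kS; rewrite eS mem_cat inE El2 !orbT.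
case: m Sm e => [|m] Sm e; first by have := leq_trans (ltnW (tree_card tF SF)) Sm.
have fl C : C \in kids F S -> flat sq m C =i C.
  move=> CK; apply: (@flat_uniq_mem m C (kid_node CK) _).2.
  by rewrite -ltnS (leq_trans (proper_card (kid_proper CK)) Sm).
have [A [B [es EB]]] : exists A B, s = A ++ flat sq m D ++ B
    /\ {subset E <= B}.
  exists (a ++ flatten [seq flat sq m C | C <- l1]),
    (flatten [seq flat sq m C | C <- l2] ++ b); split.
    by rewrite [s]e /= SF eS map_cat flatten_cat /= !catA.
  move=> x xE; rewrite mem_cat; apply/orP; left.
  by apply/flatten_mapP; exists E; rewrite ?fl.
have [x xD] := node_nonempty tF (kid_node DK).
have [y yE] := node_nonempty tF (kid_node EK).
have [z zE <-] := first_in os yE.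
apply: leq_ltn_trans (first_le os xD) _.
have xf : x \in flat sq m D by rewrite fl.
have xs : x \in s by apply: ordering_mem os.
have := mem_infix (x := x) (a := A) (t := flat sq m D) (b := B).
rewrite -es xf => /(_ us xs)/esym/andP[_ lx]; apply: leq_trans lx _.
have zB := EB _ zE; move: us; rewrite es cat_uniq => /and3P[_ /hasPn nA].
rewrite cat_uniq => /and3P[_ /hasPn nD _].
rewrite !index_cat (negPf (nD _ zB)) (negPf (nA _ _)) ?leq_addr ?mem_cat ?zB ?orbT //.
by rewrite leq_add2l leq_addr.
Qed.

End Flatten.

Section FlatRev.
Local Open Scope nat_scope.
Variables (I : finType) (T : rtree I).

Lemma flat_rev (sq : {set I} -> seq {set I}) n C : listing T sq ->
  node (val T) C -> flat T (rev \o sq) n C = rev (flat T sq n C).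
Proof.
move=> sqP; elim: n C => //= n IH C nC; case: ifP => CF.
  rewrite rev_flatten -map_comp -map_rev; congr flatten.
  have [_ ms] := sqP _ CF; rewrite /=.
  apply/eq_in_map => D; rewrite mem_rev ms => DK.
  by rewrite IH // (kid_node DK).
by move: nC; rewrite /node CF => /cards1P[x ->]; rewrite enum_set1.
Qed.

(** Independent orders at the vertices come from a single leaf order, by depth-first reading;
    reversing all of them reverses the reading. The reversed statements serve when the resulting
    order must be made oriented. *)
Lemma merge_orders (sg : forall v : vert T, seq (inp (val T) (val v))) :
  (forall v, ordering (sg v)) -> exists s,
  [/\ ordering s, (forall S, S \in val T -> conv s S),
      (forall v, kidseq (val T) (val v) s = sg v),
      (forall S, S \in val T -> conv (rev s) S)
    & (forall v, kidseq (val T) (val v) (rev s) = rev (sg v))].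
Proof.
move=> osg; have tF : is_tree (val T) := valP T.
pose sq S := if insub S is Some v then map val (sg v : seq (inp (val T) (val v))) else [::].
have sqE (v : vert T) : sq (val v) = map val (sg v) by rewrite /sq valK.
have sqP : listing T sq.
  move=> S SF; rewrite (sqE (Sub S SF : vert T)); split.
    by rewrite map_inj_uniq ?(ordering_uniq (osg _)) //; apply: val_inj.
  move=> C; apply/mapP/idP => [[w _ ->]|CK]; first exact: (valP w).
  by exists (Sub C CK : inp (val T) S); rewrite ?ordering_mem ?osg.
have sqrP : listing T (rev \o sq).
  move=> S SF; have [u m] := sqP S SF; split; first by rewrite rev_uniq.
  by move=> C; rewrite mem_rev m.
have kidE sq' (sg' : forall v : vert T, seq (inp (val T) (val v))) : listing T sq' -> (forall v : vert T, ordering (sg' v)) ->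
    (forall v : vert T, sq' (val v) = map val (sg' v)) ->
    forall v : vert T, kidseq (val T) (val v) (flat T sq' #|I| [set: I]) = sg' v.
  move=> sqP' osg' sqE' v; apply: (kidseq_eq tF (flat_ordering sqP') (osg' v)).
  rewrite sorted_pairwise; last by move=> x y z /=; apply: ltn_trans.
  have := flat_first sqP' (valP v); rewrite sqE' pairwise_map; exact.
exists (flat T sq #|I| [set: I]); rewrite -flat_rev ?node_setT //; split.
- exact: flat_ordering.
- exact: flat_conv.
- exact: kidE.
- exact: flat_conv.
apply: kidE => // v; first by rewrite ordering_rev.
by rewrite /= sqE map_rev.
Qed.

End FlatRev.

(** * Normal form of decorations *)

(** A choice between a linear order and its reverse, made by comparing the two end points in the
    enumeration of [I]. *)
Definition oriented (I : finType) (s : seq I) : bool :=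
  if s is x :: t then (index x (enum I) < index (last x t) (enum I))%N else false.

Lemma oriented_rev (I : finType) (s : seq I) :
  ordering s -> (1 < #|I|)%N -> ~~ oriented s -> oriented (rev s).
Proof.
move=> os; rewrite -(ordering_size os).
case: s os => // x t; case/lastP: t => // t y os _.
have : x != y.
  have := ordering_uniq os; rewrite /= mem_rcons inE negb_or => /andP[/andP[]] //.
rewrite rev_cons rev_rcons /= !last_rcons => xy.
rewrite -leqNgt leq_eqVlt => /orP[/eqP e|//].
have oe : ordering (enum I) by apply: perm_refl.
by rewrite (index_ord_inj oe e) eqxx in xy.
Qed.

Section Normal.
Variables (k : fieldType) (I : finType).
Local Notation P := (MAss k).

Lemma dfwith_id (A : eqType) (B : A -> Type) (p : forall a, B a) a :
  dfwith p (p a) = p.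
Proof. by apply: functional_extensionality_dep => b; case: dfwithP. Qed.

Lemma dfwith_twice (A : eqType) (B : A -> Type) (p : forall a, B a) a (x y : B a) :
  dfwith (dfwith p x) y = dfwith p y.
Proof.
apply: functional_extensionality_dep => b; case: dfwithP => [|c ac].
  by rewrite dfwith_in.
by rewrite !dfwith_out.
Qed.

Lemma multilinear_eq (T : rtree I) (W : lmodType k) (f f' : dec P T -> W) :
  balanced f -> balanced f' ->
  (forall (sg : forall v : vert T, seq (inp (val T) (val v)))
          (ka : forall v : vert T, option (inp (val T) (val v)) -> bool),
     (forall v, ordering (sg v)) ->
     f (fun v => bas k (sg v) (ka v)) = f' (fun v => bas k (sg v) (ka v))) ->
  f =1 f'.
Proof.
move=> [fl _] [f'l _] ff' p.
(* Vertices are reduced to basis vectors one at a time; [l] contains those whose decoration is still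
   arbitrary. *)
have H (l : seq (vert T)) (q : dec P T) :
    (forall v, v \notin l -> exists sc : _ * _,
        ordering sc.1 /\ q v = bas k sc.1 sc.2) -> f q = f' q.
  elim: l q => [|v l IH] q qb.
    have /fin_all_exists[sc scP] v : exists sc : _ * _,
        ordering sc.1 /\ q v = bas k sc.1 sc.2 by apply: qb.
    have -> : q = (fun v => bas k (sc v).1 (sc v).2).
      by apply: functional_extensionality_dep => v; rewrite (scP v).2.
    by apply: ff' => v; rewrite (scP v).1.
  rewrite -(dfwith_id q v); move: (q v); apply: mass_ind => [a x y Hx Hy|s c os].
    by rewrite fl f'l Hx Hy.
  apply: IH => u; case: dfwithP => [_|u' vu ul]; first by exists (s, c).
  by apply: qb; rewrite inE negb_or eq_sym vu.
by apply: (H (enum (vert T))) => v; rewrite mem_enum.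
Qed.

Section Gauge.
Variables (T : rtree I).
Let tF : is_tree (val T) := valP T.
Implicit Type ka : forall v : vert T, option (inp (val T) (val v)) -> bool.

Lemma parent_vert (v v' : vert T) (w : inp (val T) (val v))
    (w' : inp (val T) (val v')) : val w = val w' -> v = v'.
Proof.
move=> e; apply: val_inj; apply: parent_uniq (valP v) (valP v') (valP w) _ => //.
by rewrite e; exact: (valP w').
Qed.

(** The internal edges whose half edges disagree. Indexing them by plain sets allows them to be
    counted without transport between types of inputs. *)
Definition mismatch ka (C : {set I}) : bool :=
  [exists v : vert T, exists w : inp (val T) (val v), exists u : vert T,
    [&& val w == C, val u == C & ka v (Some w) != ka u None]].

Lemma mismatchE ka (v u : vert T) (w : inp (val T) (val v)) :
  val w = val u -> mismatch ka (val u) = (ka v (Some w) != ka u None).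
Proof.
move=> wu; apply/idP/idP; last first.
  move=> h; apply/existsP; exists v; apply/existsP; exists w; apply/existsP.
  by exists u; rewrite h wu !eqxx.
case/existsP => v' /existsP[w' /existsP[u' /and3P[/eqP ew /eqP eu]]].
have vv' : v = v' by apply: (@parent_vert _ _ w w'); rewrite wu ew.
case: v' / vv' w' ew => w' ew.
have -> : w' = w by apply: val_inj; rewrite ew wu.
by have -> : u' = u by apply: val_inj.
Qed.

(* Reflecting each vertex [v] with [gauge v] makes the two half edges of every
   internal edge have the same colour. *)
Definition gauge ka (v : vert T) : bool :=
  odd #|[set C | mismatch ka C & val v \subset C]|.

(** [gauge] is the parity of the mismatches on the path from a vertex to the root, and passing from
    [v] to its kid [u] adds the single edge [u] to that path. *)
Lemma gaugeE ka (v u : vert T) (w : inp (val T) (val v)) :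
  val w = val u -> gauge ka u = gauge ka v (+) (ka v (Some w) != ka u None).
Proof.
move=> wu; rewrite -(mismatchE _ wu) /gauge.
have uK : val u \in kids (val T) (val v) by rewrite -wu; exact: (valP w).
have -> : [set C | mismatch ka C & val u \subset C] =
    (if mismatch ka (val u) then [set val u] else set0)
    :|: [set C | mismatch ka C & val v \subset C].
  apply/setP => C; rewrite in_setU !inE.
  have -> : (C \in (if mismatch ka (val u) then [set val u] else set0))
      = mismatch ka C && (C == val u).
    by case: ifP => m; rewrite inE; case: eqP => [->|//]; rewrite ?m ?andbF.
  case m: (mismatch ka C) => //=.
  have CF : C \in val T.
    by case/existsP: m => v' /existsP[w' /existsP[u' /and3P[_ /eqP <- _]]]; exact: (valP u').
  apply/idP/idP => [uC|/orP[/eqP-> //|]]; last exact: subset_trans (kid_sub uK).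
  have [x xu] := node_nonempty tF (kid_node uK).
  have /orP[Cu|->] := kid_max tF uK (valP v) CF xu (subsetP uC _ xu); last by rewrite orbT.
  by rewrite eqEsubset Cu uC.
rewrite cardsU (_ : _ :&: _ = set0) ?cards0 ?subn0 ?oddD; last first.
  apply/setP => C; rewrite !inE; case: ifP => _; rewrite inE //; apply/negP.
  by case/and3P=> /eqP-> _ /(proper_sub_trans (kid_proper uK)); rewrite properxx.
by rewrite addbC; case: (mismatch _ _); rewrite ?cards1 ?cards0 //= addbF.
Qed.

(** Reflecting a vertex changes the representative but not the vector, so the colours can first be
    matched along all internal edges and the orders merged afterwards. *)
Lemma normal_form (sg : forall v : vert T, seq (inp (val T) (val v))) ka :
  (forall v, ordering (sg v)) ->
  exists s eta, [/\ ordering s, oriented s, (forall S, S \in val T -> conv s S)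
    & (fun v => bas k (sg v) (ka v)) = std_dec k T s eta].
Proof.
move=> osg.
pose sg' v := if gauge ka v then rev (sg v) else sg v.
pose ka' (v : vert T) (l : option (inp (val T) (val v))) := ka v l (+) gauge ka v.
have -> : (fun v => bas k (sg v) (ka v)) = (fun v => bas k (sg' v) (ka' v)).
  apply: functional_extensionality_dep => v; rewrite /sg' /ka'; case: ifP => _.
    by rewrite -bas_rev; apply: bas_ext => l; rewrite addbT.
  by apply: bas_ext => l; rewrite addbF.
have osg' v : ordering (sg' v) by rewrite /sg'; case: ifP; rewrite ?ordering_rev.
have match' (v u : vert T) (w : inp (val T) (val v)) :
    val w = val u -> ka' v (Some w) = ka' u None.
  move=> wu; rewrite /ka' (gaugeE ka wu).
  by case: (ka v _) (ka u _) (gauge ka v) => [] [] [].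
(* Half edges now agree, so each edge has one colour; it is read at the input of the parent, except
   on the root leg. *)
pose eta (C : {set I}) := if C == [set: I] then ka' (Defs.root T) None else
  [exists v : vert T, exists w : inp (val T) (val v), (val w == C) && ka' v (Some w)].
have eta1 (v : vert T) (w : inp (val T) (val v)) : eta (val w) = ka' v (Some w).
  rewrite /eta; case: eqP => [e|_].
    by have := proper_sub_trans (kid_proper (valP w)) (subsetT _); rewrite [val w]e properxx.
  apply/existsP/idP => [[v' /existsP[w' /andP[/eqP e h]]]|h]; last first.
    by exists v; apply/existsP; exists w; rewrite eqxx.
  have vv' : v = v' by apply: (@parent_vert _ _ w w').
  case: v' / vv' w' e h => w' e; by rewrite (val_inj e).
have eta2 (v : vert T) : eta (val v) = ka' v None.
  have [e|nT] := eqVneq (val v) [set: I].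
    have -> : v = Defs.root T by apply: val_inj.
    by rewrite /eta eqxx.
  have nv : node (val T) (val v) by rewrite /node; have -> := valP v.
  have [S SF vS] := parent_ex tF nv nT.
  have e : val (Sub (val v) vS : inp (val T) (val (Sub S SF : vert T))) = val v by [].
  by rewrite -(match' _ _ _ e) -eta1.
have [s [os cs ks csr ksr]] := merge_orders osg'.
have [h|h] := boolP (oriented s).
  exists s, eta; split=> //; apply: functional_extensionality_dep => v.
  by rewrite /std_dec ks; apply: bas_ext => -[w|]; rewrite ?eta1 ?eta2.
(* Reflecting every vertex at once keeps the half edges matched and reverses [s]. *)
exists (rev s), (fun C => ~~ eta C); split=> //; first by rewrite ordering_rev.
  by apply: oriented_rev => //; apply: tree_cardI tF.
apply: functional_extensionality_dep => v.
rewrite /std_dec ksr -bas_rev; apply: bas_ext => -[w|]; by rewrite ?eta1 ?eta2.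
Qed.

End Gauge.

Lemma balanced_eq (T : rtree I) (W : lmodType k) (f f' : dec P T -> W) :
  balanced f -> balanced f' ->
  (forall s eta, ordering s -> oriented s -> (forall S, S \in val T -> conv s S) ->
     f (std_dec k T s eta) = f' (std_dec k T s eta)) ->
  f =1 f'.
Proof.
move=> bf bf' h; apply: multilinear_eq => // sg ka osg.
by have [s [eta [os ors cs ->]]] := normal_form ka osg; apply: h.
Qed.

(* Recolouring an internal edge is the action of [a] on both of its half edges,
   and [a ^ 2 = 1]. *)
Lemma balanced_recolor (T : rtree I) (W : lmodType k) (f : dec P T -> W) s eta eta' :
  balanced f -> (forall C, C = [set: I] \/ #|C| = 1%N -> eta C = eta' C) ->
  f (std_dec k T s eta) = f (std_dec k T s eta').
Proof.
move=> [_ fb]; have tF : is_tree (val T) := valP T.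
have flip (e : {set I}) et : e \in val T -> e != [set: I] ->
    f (std_dec k T s et) = f (std_dec k T s (fun C => et C (+) (C == e))).
  move=> eF eT; have ne : node (val T) e by rewrite /node eF.
  have [S SF eS] := parent_ex tF ne eT.
  pose v : vert T := Sub S SF; pose w : vert T := Sub e eF.
  pose i : inp (val T) (val v) := Sub e eS.
  set p1 := std_dec k T s et; set p2 := std_dec k T s _.
  have Se : S != e.
    by apply/negP => /eqP SE; have := kid_proper eS; rewrite SE properxx.
  have vw : v != w by rewrite -val_eqE.
  have p1w : p1 w = lact (kflip k true) (p2 w).
    rewrite lact_flip ?kidseq_ordering //; apply: bas_ext => -[z|]; last first.
      by rewrite /recol /= eqxx; case: (et e).
    have ze : (val z == e) = false.
      by apply/negP => /eqP ze; have := kid_proper (valP z); rewrite [val z]ze properxx.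
    by rewrite /recol ze andbF !addbF.
  have p2v : p2 v = ract i (p1 v) (kflip k true).
    rewrite ract_flip ?kidseq_ordering //; apply: bas_ext => -[z|].
      by rewrite /recol.
    by rewrite /recol /= (negPf Se).
  have p12 u : u != v -> u != w -> p1 u = p2 u.
    move=> uv uw; apply: bas_ext => -[z|].
      have ze : (val z == e) = false.
        by apply: contraNF uv => /eqP ze; apply/eqP/(@parent_vert _ _ _ z i); rewrite [val z]ze.
      by rewrite ze addbF.
    have ue : (val u == e) = false.
      by apply: contraNF uw => /eqP ue; apply/eqP/val_inj.
    by rewrite ue addbF.
  (* Balancing is applied to the decoration equal to [p1] at [v] and to [p2] elsewhere: acting at
     the input [i] of [v] turns it into [p2], acting at the root of [w] turns it into [p1]. *)
  have := fb (dfwith p2 (p1 v)) v w i (kflip k true) erefl.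
  rewrite dfwith_twice dfwith_in -p2v dfwith_id dfwith_out // -p1w => ->.
  congr f; apply: functional_extensionality_dep => u.
  case: dfwithP => // u' wu'; have [<-|vu'] := eqVneq v u'; first by rewrite dfwith_in.
  by rewrite dfwith_out // p12 // eq_sym.
move=> h.
(* Edges are flipped in succession, so only the parity of the multiplicity of [C] in [l] matters. *)
have H (l : seq {set I}) et : (forall C, C \in l -> C \in val T /\ C != [set: I]) ->
    f (std_dec k T s et) = f (std_dec k T s (fun C => et C (+) (odd (count_mem C l)))).
  elim: l et => [|e l IH] et hl.
    by congr f; apply: functional_extensionality_dep => v; apply: bas_ext => -[z|] /=; rewrite addbF.
  have [eF eT] := hl _ (mem_head _ _).
  rewrite (flip e) // IH; last by move=> C Cl; apply: hl; rewrite inE Cl orbT.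
  congr f; apply: functional_extensionality_dep => v.
  by apply: bas_ext => -[z|] /=; rewrite oddD oddb addbA [e == _]eq_sym.
rewrite (H [seq C <- enum (val T) | eta C != eta' C]) => [|C]; last first.
  rewrite mem_filter mem_enum => /andP[ee' ->]; split=> //.
  by apply: contraNneq ee' => ->; rewrite h //; left.
have E C : node (val T) C ->
    eta C (+) odd (count_mem C [seq C <- enum (val T) | eta C != eta' C]) = eta' C.
  rewrite (count_uniq_mem _ (filter_uniq _ (enum_uniq _))) mem_filter mem_enum.
  case/orP => [->|/eqP C1]; last by rewrite h ?eqxx ?addbF //; right.
  by rewrite andbT; case: (eta C) (eta' C) => [] [].
congr f; apply: functional_extensionality_dep => v.
apply: bas_ext => -[z|]; apply: E; first exact: kid_node (valP z).
by rewrite /node; have -> := valP v.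
Qed.

End Normal.

(** * Contraction and balanced maps *)

Section MapComp.
Variables (k : fieldType) (I J L : finType) (i : I) (f : graft J i -> L).
Local Notation P := (MAss k).

Lemma map_comp_linearl (y : op_sp P J) :
  linear (fun x : op_sp P I => op_map P f (op_comp i x y)).
Proof. by move=> a x x'; rewrite op_compDl op_map_linear. Qed.

Lemma map_comp_linearr (x : op_sp P I) :
  linear (fun y : op_sp P J => op_map P f (op_comp i x y)).
Proof. by move=> a y y'; rewrite op_compDr op_map_linear. Qed.

End MapComp.

Section ContractBalanced.
Variables (k : fieldType) (I : finType) (T : rtree I) (e : edge T).
Local Notation P := (MAss k).
Let tF : is_tree (val T) := valP T.

Lemma contract_dec_local (p q : dec P T) (v : vert (contract e)) :
  p (old v) = q (old v) ->
  (val e \in kids (val T) (val v) -> p (top e) = q (top e)) ->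
  contract_dec e p v = contract_dec e q v.
Proof.
move=> pq pqe; have [h|h] := boolP (val e \in kids (val T) (val v)).
  by rewrite !(contract_dec_merge _ h) pq pqe.
by rewrite !(contract_dec_keep _ h) pq.
Qed.

Lemma edge_parent : exists v : vert (contract e), val e \in kids (val T) (val v).
Proof.
have [eT eF] := edgeP e.
have ne : node (val T) (val e) by rewrite /node eF.
have [S SF eS] := parent_ex tF ne eT.
have SF' : S \in val (contract e).
  rewrite in_setD1 SF andbT; apply/negP => /eqP Se.
  by have := kid_proper eS; rewrite Se properxx.
by exists (Sub S SF').
Qed.

Lemma not_top_old (v : vert T) : v != top e -> exists v' : vert (contract e), v = old v'.
Proof.
move=> ve; have vF : val v \in val (contract e).
  rewrite in_setD1; apply/andP; split; last exact: (valP v).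
  by apply: contra ve => /eqP ev; apply/eqP/val_inj.
by exists (Sub (val v) vF); apply: val_inj.
Qed.

Lemma top_not_old (v : vert (contract e)) : top e != old v.
Proof.
by have := valP v; rewrite in_setD1 => /andP[ve _]; rewrite -val_eqE eq_sym.
Qed.

Lemma old_inj : injective (@old I T e).
Proof. by move=> v w /(congr1 val) h; apply: val_inj. Qed.

Lemma contract_dfwith_top (p : dec P T) (v : vert (contract e))
    (h : val e \in kids (val T) (val v)) (x : op_sp P (inp (val T) (val (top e)))) :
  contract_dec e (dfwith p x) =
  dfwith (contract_dec e p) (op_map P (@merge_inp _ _ _ _ h)
    (op_comp (Sub (val e) h : inp (val T) (val v)) (p (old v)) x)).
Proof.
apply: functional_extensionality_dep => w; case: dfwithP => [|w' vw].
  rewrite (contract_dec_merge _ h) dfwith_in dfwith_out //; exact: top_not_old.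
apply: contract_dec_local => [|h']; first by rewrite dfwith_out ?top_not_old.
case/eqP: vw; apply: old_inj; apply: val_inj.
exact: parent_uniq (valP (old v)) (valP (old w')) h h'.
Qed.

(** Contraction as a function of the decoration of one surviving vertex, uniform in whether that
    vertex absorbs [e] or only has its inputs renamed. *)
Definition contract_at (p : dec P T) (v : vert (contract e))
    (x : op_sp P (inp (val T) (val (old v)))) : op_sp P (inp (val (contract e)) (val v)) :=
  contract_dec e (dfwith p x) v.

Lemma contract_dfwith_old (p : dec P T) (v : vert (contract e))
    (x : op_sp P (inp (val T) (val (old v)))) :
  contract_dec e (dfwith p x) = dfwith (contract_dec e p) (contract_at p x).
Proof.
apply: functional_extensionality_dep => w; case: dfwithP => [//|w' vw].
apply: contract_dec_local => [|_]; rewrite dfwith_out //.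
by rewrite eq_sym top_not_old.
Qed.

Lemma contract_at_merge (p : dec P T) (v : vert (contract e))
    (h : val e \in kids (val T) (val v)) x :
  contract_at (v := v) p x = op_map P (@merge_inp _ _ _ _ h)
    (op_comp (Sub (val e) h : inp (val T) (val v)) x (p (top e))).
Proof.
rewrite /contract_at (contract_dec_merge _ h) dfwith_in dfwith_out //.
by rewrite eq_sym top_not_old.
Qed.

Lemma contract_at_keep (p : dec P T) (v : vert (contract e))
    (h : val e \notin kids (val T) (val v)) x :
  contract_at (v := v) p x = op_map P (keep_inp h) x.
Proof. by rewrite /contract_at (contract_dec_keep _ h) dfwith_in. Qed.

Lemma contract_at_linear (p : dec P T) (v : vert (contract e)) :
  linear (@contract_at p v).
Proof.
move=> a x y; have [h|h] := boolP (val e \in kids (val T) (val v)).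
  rewrite !(contract_at_merge _ h); exact: map_comp_linearl.
rewrite !(contract_at_keep _ h); exact: op_map_linear.
Qed.

Lemma contract_at_lact (p : dec P T) (v : vert (contract e)) c x :
  contract_at (v := v) p (lact c x) = lact c (contract_at p x).
Proof.
have SF : val v \in val T :\ val e by apply: (valP v).
have [h|h] := boolP (val e \in kids (val T) (val v)).
  by rewrite !(contract_at_merge _ h) comp_lactl op_map_lact //; apply: merge_inp_bij.
by rewrite !(contract_at_keep _ h) op_map_lact //; apply: keep_inp_bij.
Qed.

Lemma contract_at_ract (p : dec P T) (v : vert (contract e))
    (i : inp (val T) (val (old v))) c x : val i != val e ->
  exists2 i' : inp (val (contract e)) (val v), val i' = val i &
    contract_at (v := v) p (ract i x c) = ract i' (contract_at p x) c.
Proof.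
move=> ie; have SF : val v \in val T :\ val e by apply: (valP v).
have [h|h] := boolP (val e \in kids (val T) (val v)).
  have iu : i != (Sub (val e) h : inp (val T) (val v)) by rewrite -val_eqE.
  pose u : {w : inp (val T) (val v) | w != Sub (val e) h} := Sub i iu.
  exists (merge_inp (h := h) (inl u)) => //.
  rewrite !(contract_at_merge _ h) -op_map_ract; last exact: merge_inp_bij.
  by rewrite -comp_ractl.
exists (keep_inp h i) => //.
by rewrite !(contract_at_keep _ h) op_map_ract //; apply: keep_inp_bij.
Qed.

Lemma contract_at_id (p : dec P T) (v : vert (contract e)) :
  contract_at p (p (old v)) = contract_dec e p v.
Proof. by rewrite /contract_at dfwith_id. Qed.

(** Contraction descends to tensor products over K. Along [e] itself this is [comp_ract_lact]; any
    other edge survives in the contracted tree, and the actions at its ends commute with the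
    composition performed there. *)
Lemma balanced_contract (W : lmodType k) (f : dec P (contract e) -> W) :
  balanced f -> balanced (fun p => f (contract_dec e p)).
Proof.
move=> bf; have [fl fb] := bf.
have [v0 h0] := edge_parent.
split=> [p v a x y|p v w i c iw].
  have [ev|/not_top_old[v' ev]] := eqVneq v (top e).
    rewrite ev in x y *; rewrite !(contract_dfwith_top _ h0).
    rewrite -fl; congr (f (dfwith _ _)); exact: map_comp_linearr.
  rewrite ev in x y *; rewrite !contract_dfwith_old.
  rewrite -fl; congr (f (dfwith _ _)); exact: contract_at_linear.
have [ew|wn] := eqVneq w (top e).
  rewrite ew in iw *; rewrite (contract_dfwith_top _ h0).
  have ev : v = old v0.
    apply: (@parent_vert _ _ _ _ i (Sub (val e) h0 : inp (val T) (val (old v0)))).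
    by rewrite iw.
  rewrite ev in i iw *.
  rewrite contract_dfwith_old (contract_at_merge _ h0) -comp_ract_lact.
  by have -> : i = Sub (val e) h0 by apply: val_inj; rewrite iw.
have iwn : val i != val e by rewrite iw -[val e]/(val (top e)) val_eqE.
have [w' ew] := not_top_old wn.
rewrite ew in iw *; rewrite (@contract_dfwith_old _ w' _) contract_at_lact contract_at_id.
(* An edge attached just above [e] becomes an input of the merged vertex; all other edges keep their
   lower vertex. *)
have [ev|/not_top_old[v' ev]] := eqVneq v (top e).
  rewrite ev in i iw iwn *; rewrite (contract_dfwith_top _ h0) comp_ractr.
  rewrite op_map_ract; last by apply: merge_inp_bij; apply: (valP v0).
  by rewrite -(contract_dec_merge _ h0) (fb _ _ w').
rewrite ev in i iw iwn *; rewrite contract_dfwith_old.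
have [i' ii' ->] := contract_at_ract p c (p (old v')) iwn.
by rewrite contract_at_id (fb _ _ w') // ii'.
Qed.

(** The action on values is abstract, so as to cover values in both P(I) and K. *)
Lemma root_equivariant_contract (W : Type) (act : opK P -> W -> W)
    (f : dec P (contract e) -> W) :
  (forall (p : dec P (contract e)) (c : opK P),
     f (dfwith p (lact c (p (Defs.root (contract e))))) = act c (f p)) ->
  forall (p : dec P T) (c : opK P),
    f (contract_dec e (dfwith p (lact c (p (Defs.root T))))) = act c (f (contract_dec e p)).
Proof.
move=> fr p c; have -> : Defs.root T = old (Defs.root (contract e)) by apply: val_inj.
by rewrite contract_dfwith_old contract_at_lact contract_at_id fr.
Qed.

End ContractBalanced.

(** * Composition of decorated trees *)

Section Extension.
Variables (k : fieldType) (I : finType) (W : lmodType k).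
Variable theta : seq I -> (option I -> bool) -> W.

(* Each Moebius corolla has exactly one oriented representative. *)
Definition ext (y : op_sp (MAss k) I) : W :=
  \sum_(m : mcor I | oriented (mseq m)) (y : MAss_sp k I) (cls m) *: theta (mseq m) m.2.

Lemma ext_linear : linear ext.
Proof.
move=> a x y; rewrite /ext scaler_sumr -big_split /=; apply: eq_bigr => m _.
by rewrite !ffunE scalerDl scalerA.
Qed.

Lemma oriented_revF (s : seq I) : oriented s -> ~~ oriented (rev s).
Proof.
case: s => // x t; case/lastP: t => [|t y]; first by rewrite /= ltnn.
by rewrite rev_cons rev_rcons /= !last_rcons -leqNgt => /ltnW.
Qed.

Lemma ext_bas s c : ordering s -> oriented s -> ext (bas k s c) = theta s c.
Proof.
move=> os ors; set m := mk_mcor os c.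
have em : theta s c = theta (mseq m) m.2.
  by congr (theta _ _); apply: functional_extensionality => l; rewrite ffunE.
rewrite /ext (bigD1 m) //= (bas_mk k os) -/m eqxx scale1r -em big1 ?addr0 //.
move=> m' /andP[orm' m'm]; rewrite (bas_mk k os) -/m cls_eq /miso.
rewrite eq_sym (negPf m'm) /=; case r: (reflected m' m); last by rewrite scale0r.
case/andP: r => /eqP e _; have := oriented_revF orm'.
by rewrite -e ors.
Qed.

End Extension.

Section Composition.
Variables (k : fieldType) (I : finType).
Local Notation P := (MAss k).

Definition corolla (T : rtree I) : Prop := val T = [set [set: I]].

Lemma leaf_subproof (T : rtree I) : corolla T -> forall i : I,
  [set i] \in kids (val T) [set: I].
Proof.
move=> cT i; have I1 := tree_cardI (valP T : is_tree (val T)).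
apply/kidsP; split.
- by rewrite properEcard subsetT cards1 cardsT.
- by rewrite /node cards1 eqxx orbT.
by move=> D; rewrite cT inE => /eqP-> _; rewrite properxx.
Qed.

Definition leaf_inp (T : rtree I) (cT : corolla T) (i : I) :
    inp (val T) (val (Defs.root T)) :=
  Sub [set i] (leaf_subproof cT i).

(** [i0] is a default value: the inputs of a corolla are singletons. *)
Definition inp_leaf (i0 : I) (T : rtree I) (w : inp (val T) (val (Defs.root T))) : I :=
  odflt i0 [pick i in val w].

Lemma leaf_inpK i0 T (cT : corolla T) : cancel (leaf_inp cT) (@inp_leaf i0 T).
Proof.
move=> i; rewrite /inp_leaf; case: pickP => [j|/(_ i)]; rewrite inE ?eqxx //.
by move=> /eqP.
Qed.

Lemma inp_leafK i0 T (cT : corolla T) : cancel (@inp_leaf i0 T) (leaf_inp cT).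
Proof.
move=> w; apply: val_inj; rewrite /inp_leaf /=.
have : node (val T) (val w) := kid_node (valP w).
case/orP=> [wF|/cards1P[x e]].
  have /set1P e : val w \in [set [set: I]] by rewrite -cT.
  by have := kid_proper (valP w); rewrite [val w]e properxx.
rewrite [val w]e; case: pickP => [j|/(_ x)]; rewrite inE ?eqxx //.
by move=> /eqP->.
Qed.

Lemma index_sorted (s : seq I) : ordering s -> sorted (relpre (index^~ s) ltn) s.
Proof.
move=> os; rewrite -sorted_map (_ : map _ _ = iota 0 (size s)) ?iota_ltn_sorted //.
case: s os => // x s; set t := x :: s => os.
apply: (@eq_from_nth _ 0%N) => [|j]; rewrite size_map ?size_iota // => jt.
by rewrite nth_iota // (nth_map x) // index_uniq ?(ordering_uniq os).
Qed.

Lemma first1 (s : seq I) x : ordering s -> first s [set x] = index x s.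
Proof. by move=> os; have [|y] := @first_in _ s [set x] x os; rewrite inE // => /eqP->. Qed.

Lemma kidseq_corolla T (cT : corolla T) s : ordering s ->
  kidseq (val T) (val (Defs.root T)) s = map (leaf_inp cT) s.
Proof.
move=> os; case: s os => [|i0 s']; first by move=> os; have := tree_cardI (valP T : is_tree (val T)); rewrite -(ordering_size os).
set s := i0 :: s' => os; have bl : bijective (leaf_inp cT).
  by exists (@inp_leaf i0 T); [apply: leaf_inpK|apply: inp_leafK].
apply: kidseq_eq => //; [exact: valP T|exact: ordering_map|].
rewrite sorted_map; have := index_sorted os; congr sorted.
apply: functional_extensionality => x; apply: functional_extensionality => y.
rewrite -[LHS]/(index x s < index y s)%N -[RHS]/(first s [set x] < first s [set y])%N.
by rewrite !first1.
Qed.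

Lemma corolla_vert (T : rtree I) (v : vert T) : corolla T -> v = Defs.root T.
Proof.
by move=> cT; apply: val_inj; apply/set1P; rewrite -cT; exact: (valP v).
Qed.

Definition outer (eta : {set I} -> bool) (l : option I) : bool :=
  if l is Some i then eta [set i] else eta [set: I].

(** A characterisation of the composition map from P(T) to P(I). Uniqueness makes the result
    independent of the order in which edges are contracted. *)
Definition composes (T : rtree I) (F : dec P T -> op_sp P I) : Prop :=
  [/\ balanced F,
      (forall (p : dec P T) (c : opK P),
         F (dfwith p (lact c (p (Defs.root T)))) = lact c (F p))
    & forall s eta, ordering s -> (forall S, S \in val T -> conv s S) ->
         F (std_dec k T s eta) = bas k s (outer eta)].

Lemma corolla_composes i0 (T : rtree I) (cT : corolla T) :
  composes (fun p : dec P T => op_map P (@inp_leaf i0 T) (p (Defs.root T))).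
Proof.
have bl : bijective (@inp_leaf i0 T).
  by exists (leaf_inp cT); [apply: inp_leafK|apply: leaf_inpK].
split.
- split=> [p v a x y|p v w i c iw].
    have ev := corolla_vert v cT; rewrite ev in x y *.
    rewrite !dfwith_in; exact: op_map_linear.
  rewrite (corolla_vert w cT) in iw.
  have := proper_sub_trans (kid_proper (valP i)) (subsetT _).
  by rewrite [val i]iw properxx.
- by move=> p c; rewrite dfwith_in op_map_lact.
move=> s eta os cs; rewrite /std_dec (kidseq_corolla cT os).
rewrite (op_map_bas (c' := outer eta) _ bl) ?ordering_map //.
- by apply: bas_seq; rewrite -map_comp -[RHS]map_id; apply: eq_map; apply: leaf_inpK.
- by exists (@inp_leaf i0 T); [apply: leaf_inpK|apply: inp_leafK].
case=> [w|//] /=; congr (eta _).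
by have := inp_leafK i0 cT w => /(congr1 val).
Qed.

Lemma contract_composes (T : rtree I) (e : edge T) F :
  composes F -> composes (fun p : dec P T => F (contract_dec e p)).
Proof.
case=> bF rF cF; split; first exact: balanced_contract.
  by move=> p c; apply: root_equivariant_contract rF p c.
move=> s eta os cs; rewrite contract_std_dec ?cF //; last exact: cs (edgeP e).2.
by move=> S; rewrite in_setD1 => /andP[_]; apply: cs.
Qed.

Lemma edge_contract_card (T : rtree I) (e : edge T) :
  #|val T| = #|val (contract e)|.+1.
Proof. by rewrite (cardsD1 (val e)) (edgeP e).2. Qed.

Lemma no_edge_corolla (T : rtree I) : (edge T =i pred0) -> corolla T.
Proof.
move=> noe; apply/setP => S; rewrite inE; apply/idP/eqP => [SF|->].
  apply/eqP; apply: contraT => ST; have SE : S \in val T :\ [set: I].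
    by rewrite in_setD1 ST.
  by have := noe (Sub S SE); rewrite !inE.
exact: tree_setT (valP T).
Qed.

Lemma compose_ex (T : rtree I) : {F : dec P T -> op_sp P I | composes F}.
Proof.
have [n] := ubnP #|val T|; elim: n T => // n IH T Tn.
case: (pickP (edge T)) => [e _|noe].
  have [|F cF] := IH (contract e); first by rewrite -ltnS -edge_contract_card.
  by exists (fun p => F (contract_dec e p)); apply: contract_composes.
case: (pickP I) => [i0 _|noI].
  exists (fun p : dec P T => op_map P (@inp_leaf i0 T) (p (Defs.root T))).
  by apply: corolla_composes; apply: no_edge_corolla.
(* A dummy value: the existence of a tree rules out an empty [I]. *)
exists (fun=> 0); have := tree_cardI (valP T : is_tree (val T)).
by rewrite (eq_card noI) card0.
Qed.

Definition compose (T : rtree I) : dec P T -> op_sp P I := sval (compose_ex T).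

Lemma composeP (T : rtree I) : composes (@compose T).
Proof. exact: (svalP (compose_ex T)). Qed.

Lemma composes_uniq (T : rtree I) F : composes F -> F =1 @compose T.
Proof.
have [bC _ cC] := composeP T; case=> bF _ cF; apply: balanced_eq => //.
by move=> s eta os _ cs; rewrite cF // cC.
Qed.

(** Both sides satisfy [composes], whose solution is unique; this takes the place of associativity
    for trees. *)
Lemma compose_contract (T : rtree I) (e : edge T) (p : dec P T) :
  compose (contract_dec e p) = compose p.
Proof.
exact: (composes_uniq (contract_composes (e := e) (composeP (contract e)))).
Qed.

Lemma contracts_compose (T T' : rtree I) (p : dec P T) (q : dec P T') :
  contracts p q -> compose p = compose q.
Proof.
elim=> // {T T' p q} T T' e p q _ IH; by rewrite -IH compose_contract.
Qed.

Lemma contracts_corolla (T : rtree I) (p : dec P T) :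
  exists (T0 : rtree I) (q : dec P T0), contracts p q /\ corolla T0.
Proof.
have [n] := ubnP #|val T|; elim: n T p => // n IH T p Tn.
case: (pickP (edge T)) => [e _|noe].
  have [|T0 [q [pq cT0]]] := IH (contract e) (contract_dec e p).
    by rewrite -ltnS -edge_contract_card.
  by exists T0, q; split=> //; apply: contracts_step pq.
exists T, p; split; [exact: contracts_refl|exact: no_edge_corolla].
Qed.

Lemma compose_corolla (T : rtree I) (cT : corolla T) (q : dec P T) x :
  q (Defs.root T) = op_map P (leaf_inp cT) x <-> compose q = x.
Proof.
case: (pickP I) => [i0 _|noI]; last first.
  by have := tree_cardI (valP T : is_tree (val T)); rewrite (eq_card noI) card0.
have [Pi Pc] := (op_map_idE (MAss_is_operad k), op_map_compE (MAss_is_operad k)).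
have b1 : bijective (leaf_inp cT).
  by exists (@inp_leaf i0 T); [apply: leaf_inpK|apply: inp_leafK].
have b2 : bijective (@inp_leaf i0 T).
  by exists (leaf_inp cT); [apply: inp_leafK|apply: leaf_inpK].
rewrite -(composes_uniq (corolla_composes i0 cT)); split=> [->|<-].
  by rewrite Pc // Pi //; apply: leaf_inpK.
by rewrite Pc // Pi //; apply: inp_leafK.
Qed.

Lemma compositeP (T : rtree I) (p : dec P T) x : composite p x <-> compose p = x.
Proof.
split=> [[T0 [q [h [pq hE e]]]]|<-].
  have cT : corolla T0.
    (* [h] makes every singleton a kid of the root, which leaves no room for another vertex in
       between. *)
    apply/setP => S; rewrite inE; apply/idP/eqP => [SF|->]; last exact: tree_setT (valP T0).
    apply/eqP; apply: contraT => ST.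
    have [i iS] : exists i, i \in S.
      by apply: (node_nonempty (valP T0 : is_tree (val T0))); rewrite /node SF.
    have := valP (h i); rewrite [X in X \in _]hE => /kidsP[_ _ /(_ _ SF)].
    rewrite properT ST properEcard sub1set iS cards1 (tree_card (valP T0)) //.
    by move/(_ isT).
  rewrite (contracts_compose pq); apply/(compose_corolla cT); rewrite e.
  congr (op_map P _ x); apply: functional_extensionality => i.
  by apply: val_inj; rewrite hE.
have [T0 [q [pq cT]]] := contracts_corolla p.
exists T0, q, (leaf_inp cT); split=> //; apply/compose_corolla.
exact/esym/contracts_compose.
Qed.

End Composition.

(** * Toggling a set of a tree *)

Section Toggle.
Variables (I : finType) (i0 : I).
Implicit Types (F : {set {set I}}) (A B C D S : {set I}).

(** In a tree the members containing [i0] form a chain, so this union is the largest of those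
    strictly inside [S], or the singleton of [i0] when there is none. *)
Definition below F S : {set I} :=
  i0 |: \bigcup_(C in F | (i0 \in C) && (C \proper S)) C.

Definition gap F S : {set I} := S :\: below F S.

(** Several [S] may qualify. The test of [pick] only involves members containing [i0], so the choice
    is unaffected by adding or removing other sets, the toggled one included. *)
Definition alpha F : option {set I} :=
  omap (gap F) [pick S | [&& S \in F, i0 \in S & (1 < #|gap F S|)%N]].

Definition n0 F : nat := #|[set C in F | i0 \in C]|.

Lemma gap_dep F F' S : (forall C, i0 \in C -> (C \in F) = (C \in F')) ->
  gap F S = gap F' S.
Proof.
move=> h; congr (_ :\: (_ :|: _)); apply: eq_bigl => C.
by case iC: (i0 \in C); rewrite ?andbF // h.
Qed.

Lemma alpha_dep F F' : (forall C, i0 \in C -> (C \in F) = (C \in F')) ->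
  alpha F = alpha F'.
Proof.
move=> h; rewrite /alpha; have gE := gap_dep _ h.
have -> : [pick S | [&& S \in F, i0 \in S & (1 < #|gap F S|)%N]] =
    [pick S | [&& S \in F', i0 \in S & (1 < #|gap F' S|)%N]].
  apply: eq_pick => S /=; rewrite gE; case iS: (i0 \in S); last by rewrite !andbF.
  by rewrite h.
by case: [pick S | _] => //= S; rewrite gE.
Qed.

Lemma belowP F S x :
  reflect (x = i0 \/ exists C, [/\ C \in F, i0 \in C, C \proper S & x \in C])
          (x \in below F S).
Proof.
rewrite in_setU1; apply: (iffP orP) => [[/eqP->|/bigcupP[C /and3P[]]]|[->|[C []]]].
- by left.
- by right; exists C.
- by left.
by right; apply/bigcupP; exists C => //; apply/and3P.
Qed.

Lemma alphaP F A : alpha F = Some A ->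
  exists S, [/\ S \in F, i0 \in S, (1 < #|A|)%N & A = gap F S].
Proof.
rewrite /alpha; case: pickP => //= S /and3P[SF iS gS] [<-].
by exists S.
Qed.

Lemma alpha_i0 F A : alpha F = Some A -> i0 \notin A.
Proof.
case/alphaP => S [_ _ _ ->]; rewrite in_setD negb_and negbK.
by apply/orP; left; apply/belowP; left.
Qed.

Lemma alpha_nT F A : alpha F = Some A -> A != [set: I].
Proof. by move/alpha_i0; apply: contraNneq => ->; rewrite inE. Qed.

(** A member containing [i0] either contains [S], or lies inside [below F S], or equals [S]. A
    member inside [S] that avoids [i0] and meets [below F S] meets a smaller member through [i0] and
    is contained in it, hence misses the gap; if it does not meet [below F S], it lies in the
    gap. *)
Lemma alpha_lam F A B : is_tree F -> alpha F = Some A -> B \in F -> laminar A B.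
Proof.
move=> tF /alphaP[S [SF iS _ ->]] BF; rewrite /laminar.
have dis (E : {set I}) : (forall x, x \in E -> x \in S -> x \in below F S) ->
    [disjoint gap F S & E].
  move=> h; apply/pred0P => x; apply/negP => /andP[xg /h].
  have /setDP[xS xb] : x \in gap F S by [].
  by move/(_ xS); rewrite (negPf xb).
have [iB|iB] := boolP (i0 \in B).
  have /orP[SB|BS] := laminar_meet (tree_lam tF SF BF) iS iB.
    by rewrite (subset_trans (subsetDl _ _) SB).
  have [->|BnS] := eqVneq B S; first by rewrite subsetDl.
  rewrite dis ?orbT // => x xB _; apply/belowP; right; exists B; split=> //.
  by rewrite properEneq BnS.
case/or3P: (tree_lam tF SF BF) => [SB|BS|dSB].
- by rewrite (subset_trans (subsetDl _ _) SB).
- have [|/pred0Pn[x /andP[xB xb]]] := boolP [disjoint B & below F S].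
    move=> dB; apply/or3P; apply: Or32; apply/subsetP => x xB.
    by rewrite in_setD (disjointFr dB xB) (subsetP BS).
  case/belowP: xb => [e|[C [CF iC CS xC]]]; first by rewrite -e [x \in B]xB in iB.
  have /orP[BC|CB] := laminar_meet (tree_lam tF BF CF) xB xC; last first.
    by rewrite (subsetP CB _ iC) in iB.
  rewrite dis ?orbT // => y yB _; apply/belowP; right; exists C; split=> //.
  exact: (subsetP BC).
by rewrite dis ?orbT // => x xB xS; rewrite (disjointFr dSB xS) in xB.
Qed.

Lemma below_or F S : is_tree F -> S \in F -> i0 \in S ->
  below F S = [set i0] \/ [/\ below F S \in F, i0 \in below F S & below F S \proper S].
Proof.
move=> tF SF iS.
have [X0|[C0 C0X]] := set_0Vmem [set C in F | (i0 \in C) && (C \proper S)].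
  left; apply/setP => x; apply/belowP/set1P => [[//|[C [CF iC CS _]]]|]; last by left.
  by have := in_set0 C; rewrite -X0 inE CF iC CS.
pose X := [set C in F | (i0 \in C) && (C \proper S)].
case: (@arg_maxnP _ C0 (mem X) (fun C => #|C|) C0X) => Cm CmX Cmax.
have /and3P[CmF iCm CmS] : [&& Cm \in F, i0 \in Cm & Cm \proper S].
  by have : Cm \in X by []; rewrite !inE.
right; suff -> : below F S = Cm by [].
apply/setP => x; apply/belowP/idP => [[-> //|[C [CF iC CS xC]]]|xC]; last first.
  by right; exists Cm.
have CX : C \in X by rewrite !inE CF iC.
have /orP[CCm|CmC] := laminar_meet (tree_lam tF CF CmF) iC iCm.
  exact: (subsetP CCm).
suff -> : Cm = C by [].
by apply/eqP; rewrite eqEcard CmC; apply: Cmax.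
Qed.

(** When all gaps have at most one element, descending the chain of members through [i0] loses at
    most one leaf per step until only [i0] remains, which forces at least [#|I| - 1] members. *)
Lemma alpha_none F : is_tree F -> alpha F = None -> (#|I| <= (n0 F).+1)%N.
Proof.
move=> tF; rewrite /alpha; case: pickP => // no _.
have g1 S : S \in F -> i0 \in S -> (#|gap F S| <= 1)%N.
  by move=> SF iS; have := no S; rewrite SF iS /= ltnNge => /negbFE.
have H n S : (#|S| <= n)%N -> S \in F -> i0 \in S ->
    (#|S| <= #|[set C in F | (i0 \in C) && (C \subset S)]|.+1)%N.
  elim: n S => [|n IH] S Sn SF iS; first by have := leq_trans (tree_card tF SF) Sn.
  set X := [set C in F | _].
  have SX : S \in X by rewrite !inE SF iS subxx.
  have cS : (#|S| <= 1 + #|below F S|)%N.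
    rewrite -(cardsID (below F S) S) addnC; apply: leq_add; first exact: g1.
    exact/subset_leq_card/subsetIr.
  have [e|[bF ib bS]] := below_or tF SF iS.
    rewrite e cards1 in cS; apply: leq_trans cS _.
    by rewrite ltnS card_gt0; apply/set0Pn; exists S.
  apply: leq_trans cS _; rewrite add1n ltnS.
  have bn : (#|below F S| <= n)%N by rewrite -ltnS (leq_trans (proper_card bS)).
  apply: leq_trans (IH _ bn bF ib) _.
  rewrite (cardsD1 S X) SX ltnS; apply/subset_leq_card/subsetP => C.
  rewrite !inE => /and3P[-> -> Cb]; rewrite (subset_trans Cb (proper_sub bS)) /= andbT.
  by apply: contraTneq Cb => ->; apply: proper_subn.
have := H _ _ (leqnn _) (tree_setT tF) (in_setT i0).
rewrite cardsT /n0 => /leq_trans; apply; rewrite ltnS.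
by apply/subset_leq_card/subsetP => C; rewrite !inE => /and3P[-> ->].
Qed.

End Toggle.

Section Compat.
Variables (I : finType) (i0 : I) (s : seq I).
Hypotheses (os : ordering s) (s0 : index i0 s = 0%N).
Implicit Types (F : {set {set I}}) (A B C D S : {set I}).

Definition compat F : bool := is_tree F && [forall S in F, conv s S].

Lemma compatP F : reflect (is_tree F /\ forall S, S \in F -> conv s S) (compat F).
Proof.
by apply: (iffP andP) => -[tF h]; split=> //; apply/forall_inP.
Qed.

Lemma compat_tree F : compat F -> is_tree F. Proof. by case/compatP. Qed.

Lemma compat_set1D F A : compat F -> A != [set: I] -> compat (F :\ A).
Proof.
case/compatP => tF cF AT; apply/compatP; split; first exact: is_tree_set1D.
by move=> S /setD1P[_]; apply: cF.
Qed.

Lemma compat_set1U F A : compat F -> (1 < #|A|)%N -> conv s A ->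
  (forall B, B \in F -> laminar A B) -> compat (A |: F).
Proof.
case/compatP => tF cF A1 cA lA; apply/compatP; split; first exact: is_tree_set1U.
by move=> S /setU1P[->|/cF].
Qed.

Lemma conv_initial B a b : conv s B -> i0 \in B -> b \in B ->
  (index a s <= index b s)%N -> a \in B.
Proof.
move=> cB iB bB; rewrite leq_eqVlt => /orP[/eqP/(index_ord_inj os)->//|ab].
have [->//|ai] := eqVneq a i0.
apply: (convP _ _ cB i0 a b) => //; rewrite s0 lt0n -s0.
by apply: contra ai => /eqP/(index_ord_inj os)->.
Qed.

Lemma below_initial F S a b : (forall C, C \in F -> conv s C) ->
  b \in below i0 F S -> (index a s <= index b s)%N -> a \in below i0 F S.
Proof.
move=> cF /belowP[-> |[C [CF iC CS bC]]] ab; apply/belowP; [left|right].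
  by apply: (index_ord_inj os); apply/eqP; rewrite s0 -leqn0 -s0.
by exists C; split=> //; apply: conv_initial ab => //; apply: cF.
Qed.

(** The gap is an interval from which an initial segment of the order has been removed, since
    intervals through the first element [i0] are initial. *)
Lemma alpha_conv F A : compat F -> alpha i0 F = Some A -> conv s A.
Proof.
case/compatP => tF cF /alphaP[S [SF iS _ ->]].
apply/convP => x y z xy yz /setDP[xS xb] /setDP[zS _].
apply/setDP; split; first exact: (convP _ _ (cF _ SF) x y z).
by apply: contra xb => yb; apply: below_initial yb (ltnW xy).
Qed.

Lemma alpha_compat F A : compat F -> alpha i0 F = Some A -> compat (A |: F).
Proof.
move=> cF aA; have [S [_ _ A1 _]] := alphaP aA.
apply: compat_set1U => //; first exact: alpha_conv aA.
by move=> B; apply: alpha_lam aA; apply: compat_tree.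
Qed.

End Compat.

(** * Cochains on families of sets and the contracting homotopy *)

Section Cochains.
Variables (k : fieldType) (I : finType).
Implicit Types (F : {set {set I}}) (A B C D S : {set I}).

(** [edge_sign] on arbitrary families, so that sign computations carry no proof that a family is a
    tree. *)
Definition sg F S : k :=
  (-1) ^+ #|[set A in F :\ [set: I] | (enum_rank A < enum_rank S)%N]|.

Lemma sg_sq F S : sg F S * sg F S = 1.
Proof. by rewrite -expr2 sqrr_sign. Qed.

Lemma sgD1 F B C : B \in F :\ [set: I] ->
  sg (F :\ B) C = if (enum_rank B < enum_rank C)%N then - sg F C else sg F C.
Proof.
move=> BF; rewrite /sg.
set X := [set A in F :\ [set: I] | (enum_rank A < enum_rank C)%N].
have -> : [set A in (F :\ B) :\ [set: I] | (enum_rank A < enum_rank C)%N] = X :\ B.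
  by apply/setP => A; rewrite !inE; case: (A == B); rewrite ?andbF.
have BX : (B \in X) = (enum_rank B < enum_rank C)%N by rewrite inE BF.
rewrite (cardsD1 B X) BX; case: ifP => -> //.
by rewrite exprD expr1 mulN1r opprK.
Qed.

Variable W : lmodType k.
Implicit Type phi : {set {set I}} -> W.

Definition dd phi F : W := \sum_(B in F :\ [set: I]) sg F B *: phi (F :\ B).

Lemma dd_sum phi phi' F : dd (fun G => phi G - phi' G) F = dd phi F - dd phi' F.
Proof. by rewrite /dd -sumrB; apply: eq_bigr => B _; rewrite scalerBr. Qed.

(** Deleting two sets in either order gives the same family with opposite signs, so exchanging the
    sums yields [X = - X]. *)
Lemma dd_dd phi F : (2%:R != 0 :> k) -> dd (dd phi) F = 0.
Proof.
move=> char_neq2; set X := dd _ _.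
pose a B C := (sg F B * sg (F :\ B) C) *: phi ((F :\ B) :\ C).
have XE : X = \sum_(B in F :\ [set: I]) \sum_(C in F :\ [set: I] | C != B) a B C.
  apply: eq_bigr => B BF; rewrite /dd scaler_sumr.
  apply: eq_big => [C|C _]; last by rewrite scalerA.
  by rewrite !inE; case: (C == B); rewrite /= ?andbF ?andbT.
have aN B C : B \in F :\ [set: I] -> C \in F :\ [set: I] -> C != B -> a B C = - a C B.
  move=> BF CF CB; rewrite /a -scaleNr !(sgD1 _ BF) !(sgD1 _ CF).
  have -> : F :\ B :\ C = F :\ C :\ B.
    by apply/setP => A; rewrite !inE; case: (A == B); rewrite /= ?andbF.
  congr (_ *: _); case: ltngtP => [||/val_inj/enum_rank_inj e] //.
  - by rewrite mulrN mulrC.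
  - by rewrite mulrN opprK mulrC.
  by rewrite e eqxx in CB.
have XN : X = - X.
  rewrite {1}XE (exchange_big_dep (mem (F :\ [set: I]))) /=; last by move=> B C _ /andP[].
  rewrite XE -sumrN; apply: eq_bigr => C CF; rewrite -sumrN.
  apply: eq_big => [B|B /andP[BF /andP[_ CB]]]; first by rewrite CF eq_sym.
  exact: aN.
have : 2%:R *: X = 0 by rewrite scaler_nat mulr2n {1}XN addNr.
by move/eqP; rewrite scaler_eq0 (negPf char_neq2) /= => /eqP.
Qed.

Variable i0 : I.

(* Contraction homotopy obtained by toggling [alpha F].  It satisfies
   [(dd psi) (alpha F |: F) = phi (alpha F |: F)], which is triangular for the
   number of members of [F] containing [i0]: removing such a member is the only
   way to change [alpha]. *)
Fixpoint psi_rec phi m F : W :=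
  if m is m'.+1 then
    if alpha i0 F is Some A then
      if A \notin F then
        sg (A |: F) A *: (phi (A |: F)
          - \sum_(B in F :\ [set: I]) sg (A |: F) B *: psi_rec phi m' ((A |: F) :\ B))
      else 0
    else 0
  else 0.

Lemma alpha_setUD F A B : alpha i0 F = Some A -> i0 \notin B ->
  alpha i0 ((A |: F) :\ B) = Some A.
Proof.
move=> aA iB; rewrite -aA; apply: alpha_dep => C iC.
rewrite !inE; have -> : C != B by apply: contraNneq iB => <-.
by have -> : C == A = false by apply: contraNF (alpha_i0 aA) => /eqP<-.
Qed.

Lemma alpha_setD F B : i0 \notin B -> alpha i0 (F :\ B) = alpha i0 F.
Proof.
move=> iB; apply: alpha_dep => C iC.
by rewrite !inE; have -> : C != B by apply: contraNneq iB => <-.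
Qed.

Lemma n0_setUD F A B : alpha i0 F = Some A -> B \in F -> i0 \in B ->
  n0 i0 F = (n0 i0 ((A |: F) :\ B)).+1.
Proof.
move=> aA BF iB; rewrite /n0 (cardsD1 B) inE BF iB /= add1n; congr _.+1.
apply: eq_card => C; rewrite !inE; case iC: (i0 \in C); rewrite ?andbF ?andbT //.
by have -> : C == A = false by apply: contraNF (alpha_i0 aA) => /eqP<-.
Qed.

(** Deleting a member through [i0] lowers [n0] by one. Deleting any other set leaves the toggle [A]
    in place and present, where the recursion stops at zero; so [n0 i0 F] bounds the fuel that is
    consumed. *)
Lemma psi_rec_stable phi m F : (n0 i0 F <= m)%N ->
  psi_rec phi m.+1 F = psi_rec phi m F.
Proof.
elim: m F => [|m IH] F nF.
  rewrite /=; case aA: (alpha i0 F) => [A|//]; case: ifP => // _.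
  have [S [SF iS _ _]] := alphaP aA.
  move: nF; rewrite leqn0 cards_eq0 => /eqP/setP/(_ S).
  by rewrite !inE SF iS.
rewrite [LHS]/= [RHS]/=; case aA: (alpha i0 F) => [A|//]; case: ifP => // AF.
congr (_ *: (_ - _)); apply: eq_bigr => B /setD1P[BT BF]; congr (_ *: _).
have [iB|iB] := boolP (i0 \in B).
  by apply: IH; rewrite -ltnS -(n0_setUD aA BF iB).
have BA : A != B by apply: contraNneq AF => ->.
rewrite [LHS]/= ; case: m {IH nF} => [|m] /=; rewrite (alpha_setUD aA iB).
  by rewrite !inE BA eqxx.
by rewrite !inE BA eqxx.
Qed.

Definition psi phi : {set {set I}} -> W := psi_rec phi #|{set I}|.

Lemma psiE phi F : psi phi F =
  if alpha i0 F is Some A then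
    if A \notin F then
      sg (A |: F) A *: (phi (A |: F)
        - \sum_(B in F :\ [set: I]) sg (A |: F) B *: psi phi ((A |: F) :\ B))
    else 0
  else 0.
Proof. by rewrite {1}/psi -psi_rec_stable // max_card. Qed.

Lemma psi_supp phi (r : nat) F : (forall G : {set {set I}}, #|G| != r -> phi G = 0) ->
  #|F|.+1 != r -> psi phi F = 0.
Proof.
rewrite /psi => supp; elim: #|{set I}| F => //= m IH F nF.
case aA: (alpha i0 F) => [A|//]; case: ifP => // AF.
have cA : #|A |: F| = #|F|.+1 by rewrite cardsU1 AF.
rewrite supp ?cA // big1 ?subr0 ?scaler0 // => B /setD1P[BT BF].
have cB := cardsD1 B (A |: F); rewrite in_setU1 BF orbT cA in cB.
by rewrite IH ?scaler0 // -add1n -cB.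
Qed.

(** Used with the action of [a] on values, to keep the primitive K-linear: the homotopy only
    involves scalars. *)
Lemma psi_natural (L : W -> W) phi F : linear L ->
  psi (fun G => L (phi G)) F = L (psi phi F).
Proof.
move=> linL; rewrite /psi.
have L0 : L 0 = 0 by have := linL (-1) 0 0; rewrite !scaleN1r !addNr.
have LZ a x : L (a *: x) = a *: L x by have := linL a x 0; rewrite !addr0 L0 addr0.
have LB x y : L (x - y) = L x - L y.
  by rewrite addrC -scaleN1r linL scaleN1r addrC.
have LS (r : {pred {set I}}) (f : {set I} -> W) :
    L (\sum_(B in r) f B) = \sum_(B in r) L (f B).
  by apply: (big_morph L _ L0) => x y; have := linL 1 x y; rewrite !scale1r.
elim: #|{set I}| F => //= m IH F; case: (alpha i0 F) => [A|//]; case: ifP => // AF.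
rewrite LZ LB LS; congr (_ *: (_ - _)); apply: eq_bigr => B _.
by rewrite LZ IH.
Qed.

Variables (s : seq I).
Hypotheses (os : ordering s) (s0 : index i0 s = 0%N) (char_neq2 : 2%:R != 0 :> k).

(** The error [phi - dd (psi phi)] is closed and vanishes on families that contain their toggle. For
    any other [F], closedness at [A |: F] expresses the error at [F] through families that contain
    their toggle or have fewer members through [i0]. *)
Theorem psi_exact phi (r : nat) F : (r.+1 < #|I|)%N ->
  (forall G : {set {set I}}, #|G| != r -> phi G = 0) ->
  (forall G, compat s G -> dd phi G = 0) ->
  compat s F -> phi F = dd (psi phi) F.
Proof.
move=> rI supp closed cF.
(* The value of [psi] at [G :\ A] was defined so as to solve the equation at [G]. *)
have dpsi G A : compat s G -> alpha i0 G = Some A -> A \in G ->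
    phi G = dd (psi phi) G.
  move=> cG aA AG; have AT := alpha_nT aA.
  have ATG : A \in G :\ [set: I] by rewrite in_setD1 AT.
  have aA' : alpha i0 (G :\ A) = Some A by rewrite alpha_setD ?(alpha_i0 aA).
  rewrite /dd (big_setD1 A) //= psiE aA' in_setD1 eqxx /= setD1K //.
  rewrite scalerA sg_sq scale1r.
  have -> : G :\ A :\ [set: I] = G :\ [set: I] :\ A.
    by apply/setP => B; rewrite !inE andbCA.
  by rewrite subrK.
have [Fr|Fr] := eqVneq #|F| r; last first.
  rewrite supp // /dd big1 // => B /setD1P[BT BF].
  rewrite (@psi_supp phi r) ?scaler0 // -add1n.
  by rewrite (cardsD1 B) BF in Fr.
apply/eqP; rewrite -subr_eq0; apply/eqP.
have [n] := ubnP (n0 i0 F); elim: n F cF Fr => // n IH F cF Fr nF.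
(* Without a toggle [F] would have at least [#|I| - 1] members, which [rI] excludes. *)
case aA: (alpha i0 F) => [A|]; last first.
  have := alpha_none (compat_tree cF) aA.
  have : (n0 i0 F <= #|F|)%N.
    by apply/subset_leq_card/subsetP => C; rewrite inE => /andP[].
  by lia.
have [AF|AF] := boolP (A \in F); first by rewrite (dpsi _ _ cF aA AF) subrr.
have cG := alpha_compat os s0 cF aA.
pose phi' G := phi G - dd (psi phi) G.
have : dd phi' (A |: F) = 0 by rewrite dd_sum closed // dd_dd // subrr.
rewrite /dd (big_setD1 A) /=; last by rewrite in_setD1 (alpha_nT aA) setU11.
rewrite setU1K // big1 ?addr0 => [/eqP|B].
  by rewrite scaler_eq0 signr_eq0 /= => /eqP.
rewrite !inE => /and3P[BA BT /orP[/eqP e|BF]]; first by rewrite e eqxx in BA.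
have cB : compat s ((A |: F) :\ B) by apply: compat_set1D.
suff -> : phi' ((A |: F) :\ B) = 0 by rewrite scaler0.
have [iB|iB] := boolP (i0 \in B).
  apply: IH => //; last by rewrite -ltnS -(n0_setUD aA BF iB).
  have := cardsD1 B (A |: F); rewrite in_setU1 BF orbT cardsU1 AF Fr.
  by move=> [].
rewrite /phi' -(dpsi _ _ cB (alpha_setUD aA iB)) ?subrr //.
by rewrite !inE eqxx eq_sym BA.
Qed.

End Cochains.

(** * Flips of binary trees *)

Section Flips.
Local Open Scope nat_scope.
Variables (I : finType) (i0 : I) (s : seq I).
Hypotheses (os : ordering s) (s0 : index i0 s = 0) (I1 : 1 < #|I|).
Implicit Types (F : {set {set I}}) (A B C D S : {set I}).

Definition comb : {set {set I}} :=
  [set S : {set I} | (1 < #|S|) && [forall a, forall b,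
     (index a s <= index b s) && (b \in S) ==> (a \in S)]].

Lemma combP S : reflect (1 < #|S| /\
    forall a b, index a s <= index b s -> b \in S -> a \in S) (S \in comb).
Proof.
rewrite inE; apply: (iffP andP) => -[S1 h]; split=> //.
  by move=> a b ab bS; move/forallP/(_ a)/forallP/(_ b): h; rewrite ab bS.
apply/forallP => a; apply/forallP => b; apply/implyP => /andP[]; exact: h.
Qed.

Lemma comb_compat : compat s comb.
Proof.
apply/compatP; split; last first.
  move=> S /combP[_ iS]; apply/convP => a b c _ bc _.
  by apply: iS; apply: ltnW.
apply/is_treeP; split.
- by apply/combP; rewrite cardsT; split=> // a b; rewrite !inE.
- by move=> S /combP[].
move=> A B /combP[_ iA] /combP[_ iB]; rewrite /laminar.
have [|/subsetPn[a aA aB]] := boolP (A \subset B); first by move=> h; apply/or3P; apply: Or31.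
apply/orP; right; apply/orP; left; apply/subsetP => b bB.
by apply: iA aA; rewrite leqNgt; apply: contra aB => /ltnW ab; apply: iB bB.
Qed.

Lemma conv_i0_comb S : conv s S -> i0 \in S -> 1 < #|S| -> S \in comb.
Proof.
move=> cS iS S1; apply/combP; split=> // a b ab bS.
exact: (conv_initial os s0 cS iS bS ab).
Qed.

Lemma compat_i0_comb F : compat s F -> [set C in F | i0 \in C] \subset comb.
Proof.
case/compatP => tF cF; apply/subsetP => C; rewrite inE => /andP[CF iC].
by apply: conv_i0_comb => //; [apply: cF|apply: tree_card tF CF].
Qed.

Lemma alpha_none_comb F : compat s F -> #|F|.+1 = #|I| -> alpha i0 F = None ->
  F = comb.
Proof.
move=> cF Fn aF; have tF := compat_tree cF.
have n0F := alpha_none tF aF.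
have Fi : [set C in F | i0 \in C] = F.
  apply/eqP; rewrite eqEcard; apply/andP; split.
    by apply/subsetP => C; rewrite inE => /andP[].
  by rewrite -ltnS Fn.
apply/eqP; rewrite eqEcard -{1}Fi compat_i0_comb //=.
by rewrite -ltnS Fn; apply: card_tree (compat_tree comb_compat).
Qed.

Lemma comb_card : #|comb|.+1 = #|I|.
Proof.
have tc := compat_tree comb_compat; apply/eqP; rewrite eqn_leq card_tree //=.
case aC: (alpha i0 comb) => [A|]; last first.
  apply: leq_trans (alpha_none tc aC) _; rewrite ltnS.
  by apply/subset_leq_card/subsetP => C; rewrite inE => /andP[].
have [S [SC iS A1 eA]] := alphaP aC.
(* The two last elements of [S] cannot both lie outside the smaller sets. *)
have [x xA [z zA xz]] : exists2 x, x \in A & exists2 z, z \in A & index x s < index z s.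
  move: (A1); rewrite (cardD1 (enum_val (Ordinal (ltnW A1)))).
  set u := enum_val _; have uA : u \in A by apply: enum_valP.
  rewrite uA ltnS => /card_gt0P[v]; rewrite !inE => /andP[vu vA].
  case: (ltngtP (index u s) (index v s)) => [uv|vu'|/(index_ord_inj os) e].
  - by exists u => //; exists v.
  - by exists v => //; exists u.
  by rewrite e eqxx in vu.
have [_ iSC] := combP _ SC.
have /setDP[xS xb] : x \in gap i0 comb S by rewrite -eA.
have /setDP[zS zb] : z \in gap i0 comb S by rewrite -eA.
(* This initial segment belongs to the comb, contains [x] and misses [z], so it puts [x] below the
   gap. *)
pose C := [set y in S | index y s <= index x s].
case/negP: xb; apply/belowP; right; exists C.
have xi : x != i0 by apply: contraNneq (alpha_i0 aC) => <-.
have iC : i0 \in C by rewrite inE iS s0.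
split=> //; last by rewrite inE xS /=.
- apply/combP; split.
    rewrite (cardD1 i0) iC (cardD1 x) !inE xi xS leqnn.
    by [].
  by move=> a b ab; rewrite !inE => /andP[bS bx]; rewrite (iSC a b) //= (leq_trans ab).
rewrite properE; apply/andP; split; first by apply/subsetP => y; rewrite inE => /andP[].
by apply/subsetPn; exists z; rewrite // inE zS -ltnNge.
Qed.

(* The set [S], with kids [below F S] and [A], is flipped: the kid [K] of [A]
   furthest from [i0] is split off. *)
Lemma flip_ex F A : compat s F -> #|F|.+1 = #|I| -> alpha i0 F = Some A ->
  A \in F /\ exists B, [/\ i0 \in B, B \notin F & compat s (B |: (F :\ A))].
Proof.
move=> cF Fn aA; have tF := compat_tree cF; have [_ convF] := compatP _ _ cF.
(* [F] already has the largest possible number of members, so the compatible set [A] cannot be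
   new. *)
have AF : A \in F.
  apply: contraT => AF; have := card_tree (compat_tree (alpha_compat os s0 cF aA)).
  by rewrite cardsU1 AF /= add1n Fn ltnn.
split=> //; have [S [SF iS A1 eA]] := alphaP aA.
have [x0 x0A] : exists x, x \in A by apply/card_gt0P; apply: ltnW.
case: (@arg_maxnP _ x0 (mem A) (fun x => index x s) x0A) => z zA zmax.
have [K KA zK] := kids_cover tF AF zA.
pose B := S :\: K; exists B.
have iK : i0 \notin K by apply: contra (alpha_i0 aA); apply: (subsetP (kid_sub KA)).
have iB : i0 \in B by rewrite in_setD iK.
have AS : A \subset S by rewrite eA subsetDl.
have /properP[_ [y yA yK]] := kid_proper KA.
have yB : y \in B by rewrite in_setD yK (subsetP AS).
have nAbelow x : x \in A -> x \notin below i0 F S.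
  by rewrite eA => /setDP[].
have BpS : B \proper S.
  rewrite properE subsetDl; apply/subsetPn; exists z; first exact: (subsetP AS).
  by rewrite in_setD zK.
have BF : B \notin F.
  apply: contra (nAbelow y yA) => BF; apply/belowP; right; by exists B.
split=> //; apply: compat_set1U.
- apply: compat_set1D => //; exact: alpha_nT aA.
- rewrite (cardD1 i0) iB (cardD1 y) !inE yK (subsetP AS _ yA).
  by have -> : y != i0 by apply: contraNneq (alpha_i0 aA) => <-.
(* [K] contains the last element [z] of [A]. If a point of [K] lay between two points of [B], the
   right one would be in [A], between that point and [z], hence in [K]. *)
- apply/convP => a b c ab bc /setDP[aS aK] /setDP[cS cK].
  apply/setDP; split; first exact: (convP _ _ (convF _ SF) a b c).
  apply/negP => bK; have bA := subsetP (kid_sub KA) _ bK.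
  have cA : c \in A.
    rewrite eA in_setD cS andbT; apply: contra (nAbelow b bA) => cb.
    by apply: (below_initial os s0 convF) cb (ltnW bc).
  have cK' : c \in K.
    have zc : index c s < index z s.
      have lcz : index c s <= index z s := zmax c cA.
      rewrite ltn_neqAle lcz andbT; apply: contra cK => /eqP.
      by move/(index_ord_inj os)->.
    case/orP: (kid_node KA) => [KF|/cards1P[w eK]].
      exact: (convP _ _ (convF _ KF) b c z).
    move: bK zK; rewrite eK !inE => /eqP eb /eqP ez.
    by have := ltn_trans bc zc; rewrite eb ez ltnn.
  by rewrite cK' in cK.
move=> D /setD1P[DA DF]; rewrite /laminar.
have dK : [disjoint K & D] || (D \subset K) || (A \subset D).
  case dKD: [disjoint K & D] => //=.
  have /pred0Pn[x /andP[xK xD]] := negbT dKD.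
  exact: kid_max tF KA AF DF xK xD.
have DB : D \subset S -> [disjoint K & D] -> D \subset B.
  move=> DS dKD; apply/subsetP => x xD; rewrite in_setD (subsetP DS _ xD) andbT.
  by rewrite (disjointFl dKD xD).
case/or3P: (tree_lam tF SF DF) => [SD|DS|dSD].
- by rewrite (subset_trans (subsetDl _ _) SD).
- have AD_iD : A \subset D -> i0 \in D -> S \subset D.
    move=> AD iD; apply: contraT => SD; have := nAbelow y yA.
    case/negP; apply/belowP; right; exists D; split=> //; last exact: (subsetP AD).
    by rewrite properE DS.
  case/orP: dK => [/orP[dKD|DK]|AD].
  - by rewrite (DB DS dKD) orbT.
  - have -> : [disjoint B & D]; last by rewrite !orbT.
    apply/pred0P => x; apply/negP => /andP[/setDP[_ xK] xD].
    by rewrite (subsetP DK) in xK.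
  (* If [D] contains [i0], it contains [S]. Otherwise [D] leaves [A] inside [S], so it meets a
     smaller member [C] through [i0] and is contained in it together with [A], which contradicts the
     choice of the gap. *)
  have [iD|iD] := boolP (i0 \in D).
    by rewrite (subset_trans (subsetDl _ _) (AD_iD AD iD)).
  have /properP[_ [d dD dA]] : A \proper D by rewrite properEneq eq_sym DA.
  have : d \in below i0 F S.
    apply: contraR dA => db; rewrite eA in_setD db; exact: (subsetP DS).
  case/belowP => [ed|[C [CF iC CS dC]]]; first by rewrite -ed dD in iD.
  have /orP[DC|CD] := laminar_meet (tree_lam tF DF CF) dD dC; last first.
    by rewrite (subsetP CD _ iC) in iD.
  case/negP: (nAbelow y yA); apply/belowP; right; exists C; split=> //.
  exact: (subsetP DC _ (subsetP AD _ yA)).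
have -> : [disjoint B & D]; last by rewrite !orbT.
apply/pred0P => x; apply/negP => /andP[/setDP[xS _] xD].
by have := disjointFr dSD xS; rewrite [x \in D]xD.
Qed.

(** Each flip trades a member avoiding [i0] for one containing it, so [n0] increases until no toggle
    is left, and then the tree is the comb. *)
Lemma flip_const (W : Type) (phi : {set {set I}} -> W) :
  (forall F A B, compat s F -> #|F|.+2 = #|I| -> A \notin F -> B \notin F ->
     compat s (A |: F) -> compat s (B |: F) -> phi (A |: F) = phi (B |: F)) ->
  forall F, compat s F -> #|F|.+1 = #|I| -> phi F = phi comb.
Proof.
move=> flip F cF Fn.
have [n] := ubnP (#|I| - n0 i0 F); elim: n F cF Fn => // n IH F cF Fn nF.
case aA: (alpha i0 F) => [A|]; last by rewrite (alpha_none_comb cF Fn aA).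
have [AF [B [iB BF cB]]] := flip_ex cF Fn aA.
have AT := alpha_nT aA.
have cA : #|F :\ A|.+2 = #|I| by rewrite -Fn (cardsD1 A F) AF.
have BFA : B \notin F :\ A by rewrite in_setD1 negb_and BF orbT.
have AFA : A \notin F :\ A by rewrite in_setD1 eqxx.
have cAF : compat s (A |: (F :\ A)) by rewrite setD1K.
rewrite -{1}(setD1K AF) (flip _ A B (compat_set1D cF AT) cA AFA BFA cAF cB).
apply: IH => //; first by rewrite cardsU1 BFA.
apply: leq_trans (_ : #|I| - n0 i0 F <= n)%N; last by rewrite -ltnS.
have n0B : n0 i0 (B |: (F :\ A)) = (n0 i0 F).+1.
  rewrite /n0 [LHS](cardsD1 B) inE setU11 iB /= add1n; congr _.+1.
  apply: eq_card => C; rewrite !inE; case iC: (i0 \in C); rewrite ?andbF ?andbT //.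
  have -> : C != A by apply: contraNneq (alpha_i0 aA) => <-.
  case: eqP => [->|//]; by rewrite (negPf BF).
have : n0 i0 F <= #|F|.
  by apply/subset_leq_card/subsetP => C; rewrite inE => /andP[].
rewrite n0B; lia.
Qed.

End Flips.

(** * Coordinates on the dual dg operad *)

Arguments DP_diff {k P I} f T p : rename.
Arguments in_dual {k P I} T f.

Lemma linear_at0 (k : fieldType) (U V : lmodType k) (f : U -> V) :
  linear f -> f 0 = 0.
Proof. by move=> /(_ (-1) 0 0); rewrite !scaler0 !scaleN1r !addNr addr0. Qed.

Lemma lact0 (k : fieldType) (J : finType) (c : opK (MAss k)) :
  lact c (0 : op_sp (MAss k) J) = 0.
Proof. exact: linear_at0 (lact_linearr c). Qed.

Section Coordinates.
Variables (k : fieldType) (I : finType).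
Local Notation P := (MAss k).
Hypothesis I1 : (1 < #|I|)%N.

(** A section of [outer]. Internal edges receive the colour [false], a choice to which balanced maps
    are insensitive. *)
Definition inner (c : option I -> bool) (C : {set I}) : bool :=
  if C == [set: I] then c None else [exists i, (C == [set i]) && c (Some i)].

Lemma set1_neqT (i : I) : [set i] != [set: I].
Proof. by apply: contraTneq I1 => e; rewrite -cardsT -e cards1. Qed.

Lemma innerK c : outer (inner c) = c.
Proof.
apply: functional_extensionality => -[i|]; rewrite /= /inner ?eqxx //.
rewrite (negPf (set1_neqT i)); apply/existsP/idP => [[j]|ci].
  by case/andP=> /eqP/set1_inj->.
by exists i; rewrite eqxx.
Qed.

Lemma balanced_inner (T : rtree I) (W : lmodType k) (f : dec P T -> W) s eta :
  balanced f -> f (std_dec k T s eta) = f (std_dec k T s (inner (outer eta))).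
Proof.
move=> bf; apply: balanced_recolor => // C [->|/eqP/cards1P[i ->]].
  by rewrite /inner eqxx.
by rewrite -[LHS]/(outer eta (Some i)) -{1}[outer eta]innerK.
Qed.

Lemma std_dec_recol_root (T : rtree I) s c b :
  std_dec k T s (inner (recol None b c)) =
  dfwith (std_dec k T s (inner c)) (lact (kflip k b) (std_dec k T s (inner c) (Defs.root T))).
Proof.
have tF : is_tree (val T) := valP T.
have nT (v : vert T) (w : inp (val T) (val v)) : val w != [set: I].
  apply/eqP => e; have := proper_sub_trans (kid_proper (valP w)) (subsetT _).
  by rewrite [val w]e properxx.
have inE' (C : {set I}) : C != [set: I] -> inner (recol None b c) C = inner c C.
  move=> CT; rewrite /inner (negPf CT); apply: eq_existsb => i.
  by rewrite /recol andbF addbF.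
apply: functional_extensionality_dep => v; case: dfwithP => [|v' nv].
  rewrite lact_flip ?kidseq_ordering //; apply: bas_ext => -[w|]; rewrite /recol.
    by rewrite (inE' _ (nT _ w)) andbF addbF.
  by rewrite /inner !eqxx.
apply: bas_ext => -[w|]; first exact: inE' (nT _ w).
apply: inE'; by apply: contra nv => /eqP e; apply/eqP/val_inj.
Qed.

Lemma mass_ind_oriented (Q : MAss_sp k I -> Prop) :
  (forall a x y, Q x -> Q y -> Q (a *: x + y)) ->
  (forall s c, ordering s -> oriented s -> Q (bas k s c)) -> forall x, Q x.
Proof.
move=> QD Qb; apply: mass_ind => // s c os.
have [ors|ors] := boolP (oriented s); first exact: Qb.
rewrite -bas_rev; apply: Qb; first by rewrite ordering_rev.
exact: oriented_rev.
Qed.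

Implicit Type f g : forall T : rtree I, dec P T -> opK P.

(** The component of [f] in the summand of the order [s] with outer colouring [c]: a cochain on
    families, extended by zero to those that are not trees. *)
Definition coord (W : lmodType k) (f : forall T : rtree I, dec P T -> W)
    (s : seq I) (c : option I -> bool) (F : {set {set I}}) : W :=
  if insub F is Some T then f T (std_dec k T s (inner c)) else 0.

Lemma coordE (W : lmodType k) (f : forall T : rtree I, dec P T -> W) s c (T : rtree I) :
  coord f s c (val T) = f T (std_dec k T s (inner c)).
Proof. by rewrite /coord valK. Qed.

Lemma balanced_coord (W : lmodType k) (f : forall T : rtree I, dec P T -> W) s eta (T : rtree I) :
  balanced (f T) -> f T (std_dec k T s eta) = coord f s (outer eta) (val T).
Proof. by move=> bf; rewrite coordE; apply: balanced_inner. Qed.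

Lemma coord_recol f s c b F : (forall T, in_dual T (f T)) ->
  coord f s (recol None b c) F = lact (kflip k b) (coord f s c F).
Proof.
move=> df; rewrite /coord; case: insubP => [T _ _|_].
  by rewrite std_dec_recol_root (df T).2.
by rewrite lact0.
Qed.

(** Inverse to taking coordinates: prescribed values on oriented orders define a functional on P(I),
    and pulling it back along composition yields balancing at once. *)
Definition functional_of (th : rtree I -> seq I -> (option I -> bool) -> opK P) :
    forall T : rtree I, dec P T -> opK P :=
  fun T p => ext (th T) (compose p).

Arguments functional_of : clear implicits.

Lemma functional_of_std_dec th (T : rtree I) s eta :
  ordering s -> oriented s -> compat s (val T) ->
  functional_of th T (std_dec k T s eta) = th T s (outer eta).
Proof.
move=> os ors /compatP[_ cs]; have [_ _ cC] := composeP k T.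
by rewrite /functional_of cC // ext_bas.
Qed.

Lemma functional_of_dual th (T : rtree I) :
  (forall s c b, ordering s -> oriented s ->
     th T s (recol None b c) = lact (kflip k b) (th T s c)) ->
  in_dual T (functional_of th T).
Proof.
move=> thr; have [bC rC _] := composeP k T; have [lC fC] := bC.
split.
  split=> [p v a x y|p v w i c iw]; rewrite /functional_of; first by rewrite lC ext_linear.
  by rewrite (fC _ _ w).
move=> p c; rewrite /functional_of rC; move: (compose p) => y.
elim/kflip_ind: c => [a c d Hc Hd|b].
  by rewrite lactDl ext_linear Hc Hd -lactDl.
elim/mass_ind_oriented: y => [a x y Hx Hy|s c os ors].
  by rewrite lact_linearr !ext_linear Hx Hy -lact_linearr.
by rewrite lact_flip // !ext_bas // thr.
Qed.

Lemma functional_of0 th (T : rtree I) p : (forall s c, th T s c = 0) -> functional_of th T p = 0.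
Proof. by move=> th0; rewrite /functional_of /ext big1 // => m _; rewrite th0 scaler0. Qed.

Lemma balanced0 (T : rtree I) (W : lmodType k) : balanced (fun _ : dec P T => 0 : W).
Proof. by split=> // *; rewrite scaler0 addr0. Qed.

Lemma dual0 (T : rtree I) : in_dual T (fun _ : dec P T => 0).
Proof. by split=> [|*]; [exact: balanced0|rewrite lact0]. Qed.

Lemma dual_lin (T : rtree I) a (f1 f2 : dec P T -> opK P) :
  in_dual T f1 -> in_dual T f2 -> in_dual T (fun p => a *: f1 p + f2 p).
Proof.
move=> [[l1 b1] r1] [[l2 b2] r2]; split; last by move=> p c; rewrite r1 r2 lact_linearr.
split=> [p v x y z|p v w i c iw]; last by rewrite (b1 _ _ w) // (b2 _ _ w).
by rewrite l1 l2 !scalerDr !scalerA [a * x]mulrC addrACA.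
Qed.

Lemma dual_sum (T : rtree I) (J : finType) (Q : pred J) (a : J -> k)
    (h : J -> dec P T -> opK P) :
  (forall j, in_dual T (h j)) ->
  in_dual T (fun p => \sum_(j | Q j) a j *: h j p).
Proof.
move=> dh.
have H (r : seq J) : in_dual T (fun p => \sum_(j <- r | Q j) a j *: h j p).
  elim: r => [|j r IH].
    have -> : (fun p => \sum_(j <- [::] | Q j) a j *: h j p) = fun=> 0.
      by apply: functional_extensionality => p; rewrite big_nil.
    exact: dual0.
  have -> : (fun p => \sum_(i <- j :: r | Q i) a i *: h i p) = fun p =>
      (if Q j then a j else 0) *: h j p + \sum_(j <- r | Q j) a j *: h j p.
    apply: functional_extensionality => p; rewrite big_cons.
    by case: ifP => // _; rewrite scale0r add0r.
  exact: dual_lin.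
exact: H.
Qed.

Lemma dual_contract (T : rtree I) (e : edge T) (h : dec P (contract e) -> opK P) :
  in_dual (contract e) h -> in_dual T (fun p => h (contract_dec e p)).
Proof.
move=> [bh rh]; split; first exact: balanced_contract.
move=> p c; exact: (root_equivariant_contract (act := fun c x => lact c x) rh).
Qed.

Lemma DP_diff_dual f (T : rtree I) :
  (forall T, in_dual T (f T)) -> in_dual T (DP_diff f T).
Proof. by move=> df; apply: dual_sum => e; apply: dual_contract. Qed.

Lemma sum_edges (V : nmodType) (T : rtree I) (h : {set I} -> V) :
  \sum_(B in val T :\ [set: I]) h B = \sum_(e : edge T) h (val e).
Proof. exact: big_sub. Qed.

(** In coordinates the differential of the dual dg operad is [dd]: contraction changes neither the
    order nor the outer colouring. *)
Lemma DP_diff_std_dec f (T : rtree I) s eta :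
  ordering s -> compat s (val T) -> (forall T, balanced (f T)) ->
  DP_diff f T (std_dec k T s eta) = dd (coord f s (outer eta)) (val T).
Proof.
move=> os /compatP[_ cs] bf; rewrite /dd sum_edges; apply: eq_bigr => e _.
rewrite contract_std_dec //; last exact: cs (edgeP e).2.
by rewrite (balanced_coord _ _ (bf _)).
Qed.

End Coordinates.

Arguments functional_of {k I} th T p.

(** * Exactness away from degree zero *)

Section Exactness.
Variables (k : fieldType) (I : finType).
Local Notation P := (MAss k).
Hypotheses (I1 : (1 < #|I|)%N) (char_neq2 : 2%:R != 0 :> k).
Implicit Type f g : forall T : rtree I, dec P T -> opK P.

Lemma balancedW (T : rtree I) (h : dec P T -> opK P) : in_dual T h -> balanced h.
Proof. by case. Qed.

Lemma contract_compat (T : rtree I) (e : edge T) s :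
  compat s (val T) -> compat s (val (contract e)).
Proof. by move=> cT; apply: compat_set1D cT (edgeP e).1. Qed.

Lemma in_DP0 j : in_DP j (fun (T : rtree I) (_ : dec P T) => 0 : opK P).
Proof. by split=> // T; apply: dual0. Qed.

Lemma DP_diff_zero f (T : rtree I) p : (forall (T : rtree I) (p : dec P T), f T p = 0) -> DP_diff f T p = 0.
Proof. by move=> f0; rewrite /DP_diff big1 // => e _; rewrite f0 scaler0. Qed.

Lemma DP_diff_diff f (T : rtree I) p : (forall T, in_dual T (f T)) ->
  DP_diff (DP_diff f) T p = 0.
Proof.
move=> df; have ddf := fun T => DP_diff_dual T df.
have dddf := DP_diff_dual T ddf.
apply: (balanced_eq (balancedW dddf) (balanced0 _ _)) => s eta os _ cs.
have cT : compat s (val T) by apply/compatP; split=> //; exact: valP T.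
rewrite (DP_diff_std_dec I1 _ os cT (fun T' => balancedW (ddf T'))).
rewrite -[RHS](dd_dd (coord f s (outer eta)) (val T) char_neq2) /dd.
apply: eq_bigr => B /[!in_setD1] /andP[BT BF]; congr (_ *: _).
have cB : compat s (val T :\ B) by apply: compat_set1D.
have tB := compat_tree cB.
pose TB : rtree I := Sub (val T :\ B) tB.
have {}cB : compat s (val TB) by [].
rewrite -[val T :\ B]/(val TB) coordE.
rewrite (DP_diff_std_dec I1 _ os cB (fun T' => balancedW (df T'))).
by rewrite innerK.
Qed.

Lemma edge_nvert (T : rtree I) (e : edge T) : nvert T = (nvert (contract e)).+1.
Proof. exact: edge_contract_card. Qed.

Lemma nvert_lt (T : rtree I) : (nvert T < #|I|)%N.
Proof. exact: card_tree (valP T). Qed.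

Lemma coord_supp f j s c (F : {set {set I}}) :
  in_DP j f -> (#|F|%:Z + (1 - #|I|%:Z) != j) -> coord f s c F = 0.
Proof.
move=> [_ supp] Fj; rewrite /coord; case: insubP => [T _ eT|//].
by apply: supp; rewrite /nvert eT.
Qed.

(** The base point of the toggle varies with the summand: it is the first element of [s], so that
    intervals through it are initial segments. *)
Definition primitive f (T : rtree I) (s : seq I) (c : option I -> bool) : opK P :=
  if s is x :: _ then psi x (coord f s c) (val T) else 0.

Lemma head_index0 (x : I) (t : seq I) : index x (x :: t) = 0%N.
Proof. by rewrite /= eqxx. Qed.

(** [psi_exact] gives a primitive in each coordinate; these assemble into one element because
    [psi_natural] makes them K-equivariant. *)
Lemma exact_MAss (j : int) : j != 0 -> exact_at P I j.
Proof.
move=> j0 f fj; have [df supp] := fj.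
split; last first.
  case=> g [dg _] fg T p; rewrite -[RHS](DP_diff_diff p dg).
  by apply: eq_bigr => e _; rewrite fg.
move=> closed.
have [jlt|jge] := boolP (j + #|I|%:Z - 1 < 0).
  exists (fun (T : rtree I) (_ : dec P T) => 0); first exact: in_DP0.
  move=> T p; rewrite DP_diff_zero // supp //; apply: contraTneq jlt => <-; lia.
have [jpos|jneg] := boolP (0 < j).
  exists (fun (T : rtree I) (_ : dec P T) => 0); first exact: in_DP0.
  move=> T p; rewrite DP_diff_zero // supp //; apply: contraTneq jpos => <-.
  have := nvert_lt T; lia.
(* [r] is the number of vertices of the trees occurring in degree [j]; the remaining case [j < 0] is
   the bound needed for [psi_exact]. *)
have [r jr] : exists r : nat, r%:Z = j + #|I|%:Z - 1.
  by exists (absz (j + #|I|%:Z - 1)%R); lia.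
have rI : (r.+1 < #|I|)%N by lia.
have vsupp s c (F : {set {set I}}) : #|F| != r -> coord f s c F = 0.
  move=> Fr; apply: coord_supp fj _; apply: contra Fr => /eqP h; apply/eqP; lia.
pose g := functional_of (primitive f).
have dg T' : in_dual T' (g T').
  apply: functional_of_dual => // s c b os ors; case: s os ors => [|x s] os ors /=.
    by rewrite lact0.
  rewrite -(psi_natural x _ _ (lact_linearr (kflip k b))); congr (psi x _ _).
  by apply: functional_extensionality => F; apply: coord_recol.
exists g; first split=> // T p Tj.
  apply: functional_of0 => -[//|x s] c /=; apply: (psi_supp x (vsupp _ _)).
  apply: contra Tj; rewrite -[#|_|]/(nvert T) => /eqP h; apply/eqP.
  by move: jr; rewrite -h; lia.
move=> T.
apply: balanced_eq; [exact: balancedW|exact/balancedW/DP_diff_dual|].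
move=> s eta os ors cs.
have cT : compat s (val T) by apply/compatP; split=> //; exact: valP T.
rewrite (balanced_coord I1 _ _ (balancedW (df T))).
rewrite (DP_diff_std_dec I1 _ os cT (fun T' => balancedW (dg T'))).
case: s os ors cs cT => // x t; set s := x :: t => os ors cs cT.
have clo (G : {set {set I}}) : compat s G -> dd (coord f s (outer eta)) G = 0.
  move=> cG; have tG := compat_tree cG.
  pose TG : rtree I := Sub G tG; have {}cG : compat s (val TG) by [].
  rewrite -[G]/(val TG) -[outer eta](innerK I1).
  by rewrite -(DP_diff_std_dec I1 _ os cG (fun T' => balancedW (df T'))).
rewrite (psi_exact os (head_index0 x t) char_neq2 rI (vsupp s _) clo cT) /dd.
apply: eq_bigr => B /[!in_setD1] /andP[BT BF]; congr (_ *: _).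
have cB : compat s (val T :\ B) by apply: compat_set1D.
have tB := compat_tree cB.
pose TB : rtree I := Sub (val T :\ B) tB.
have {}cB : compat s (val TB) by [].
rewrite -[val T :\ B]/(val TB) coordE /g (functional_of_std_dec _ _ os ors cB).
by rewrite innerK.
Qed.

End Exactness.

(** * Quadratic relations *)

Section Relations.
Variables (k : fieldType) (I : finType).
Local Notation P := (MAss k).

Lemma contract_set1U (T TA : rtree I) (A : {set I}) (e : edge TA) :
  val TA = A |: val T -> A \notin val T -> val e = A -> contract e = T.
Proof. by move=> TAE AT eA; apply: val_inj; rewrite /= eA TAE setU1K. Qed.

Lemma edge_set1U (T TA : rtree I) (A : {set I}) :
  val TA = A |: val T -> A \notin val T -> exists e : edge TA, val e = A.
Proof.
move=> TAE AT; have AE : A \in val TA :\ [set: I].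
  rewrite in_setD1 TAE setU11 andbT; apply: contraNneq AT => ->.
  exact: tree_setT (valP T).
by exists (Sub A AE).
Qed.

Lemma binary_nvert (T : rtree I) : (nvert T).+1 = #|I| -> binary T.
Proof. by move=> h; rewrite binary_card -h. Qed.

Lemma nvert_set1U (T TA : rtree I) (A : {set I}) :
  val TA = A |: val T -> A \notin val T -> nvert TA = (nvert T).+1.
Proof. by move=> TAE AT; rewrite /nvert TAE cardsU1 AT. Qed.

Lemma ternary_vertex (T : rtree I) (e : edge T) : binary T ->
  exists v : vert (contract e), #|kids (val (contract e)) (val v)| = 3.
Proof.
move=> /forallP bT; have [v h] := edge_parent e; exists v.
rewrite -card_inp -(bij_eq_card (merge_inp_bij h (valP v))) card_graft !card_inp.
by rewrite -[val v]/(val (old v)) -[val e]/(val (top e)) !(eqP (bT _)).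
Qed.

Definition flip_pair (TA TB : rtree I) (eA : edge TA) (eB : edge TB) s c
    (j : 'I_2) : pointed_dec P I :=
  if j == ord0 then existT _ TA (eA, std_dec k TA s (inner c))
  else existT _ TB (eB, std_dec k TB s (inner c)).

(** Two binary expansions compatible with the same order contract to the same decoration of [T], so
    their difference is a relation at its ternary vertex. *)
Lemma flip_relation (T TA TB : rtree I) (A B : {set I}) (eA : edge TA)
    (eB : edge TB) s c :
  val TA = A |: val T -> A \notin val T -> val eA = A ->
  val TB = B |: val T -> B \notin val T -> val eB = B ->
  (nvert T).+2 = #|I| -> ordering s -> compat s (val TA) -> compat s (val TB) ->
  exists v : vert T, relation_at v (fun j : 'I_2 => (-1) ^+ j) (flip_pair eA eB s c).
Proof.
move=> TAE AT eAE TBE BT eBE nT os cA cB.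
have bA : binary TA by apply: binary_nvert; rewrite (nvert_set1U TAE AT).
have bB : binary TB by apply: binary_nvert; rewrite (nvert_set1U TBE BT).
have [v0 v03] := ternary_vertex eA bA.
have cTA := contract_set1U TAE AT eAE.
have cTB := contract_set1U TBE BT eBE.
have [v v3] : exists v : vert T, #|kids (val T) (val v)| = 3 by rewrite -cTA; exists v0.
exists v; split=> // [j|]; first by rewrite /flip_pair; case: ifP.
have cE (TC : rtree I) (e : edge TC) : compat s (val TC) -> contract e = T ->
    existT (@dec _ P I) (contract e) (contract_dec e (std_dec k TC s (inner c)))
    = existT (@dec _ P I) T (std_dec k T s (inner c)).
  move=> /compatP[_ cC] eT; rewrite contract_std_dec //; last exact: cC (edgeP e).2.
  by rewrite eT.
exists (std_dec k T s (inner c)), (fun=> std_dec k T s (inner c) v); split.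
  move=> j; rewrite dfwith_id /contract_pointed /flip_pair.
  by case: ifP => _ /=; apply: cE.
by rewrite !big_ord_recl big_ord0 /= expr0 expr1 scale1r scaleN1r addr0 subrr.
Qed.

Lemma linear_sum0 (U V : lmodType k) (L : U -> V) N (c : 'I_N -> k) (x : 'I_N -> U) :
  linear L -> \sum_j c j *: x j = 0 -> \sum_j c j *: L (x j) = 0.
Proof.
move=> linL e; have L0 := linear_at0 linL.
suff -> : \sum_j c j *: L (x j) = L (\sum_j c j *: x j) by rewrite e L0.
elim/big_rec2: _ => [|j y1 y2 _ ->]; first exact: esym L0.
by rewrite linL.
Qed.

Hypotheses (I1 : (1 < #|I|)%N).
Implicit Type f g : forall T : rtree I, dec P T -> opK P.

Lemma contract_inj (T : rtree I) (e e' : edge T) : contract e = contract e' -> e = e'.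
Proof.
move=> h; apply: val_inj; apply/eqP; apply: contraT => ee'.
have : val e \in val (contract e') by rewrite in_setD1 ee' (edgeP e).2.
by rewrite -h in_setD1 eqxx.
Qed.

Definition restrict_to (T : rtree I) g : forall T' : rtree I, dec P T' -> opK P :=
  fun T' p => if T' == T then g T' p else 0.

Arguments restrict_to : clear implicits.

Lemma restrict_dual T g : (forall T', in_dual T' (g T')) ->
  forall T', in_dual T' (restrict_to T g T').
Proof.
by move=> dg T'; rewrite /restrict_to; case: eqP => _; [apply: dg|apply: dual0].
Qed.

(** The primitive is split according to its supporting trees. The differential of the part at [T]
    lives on the expansions of [T] and factors through contraction to [T], so it annihilates the
    relations there. *)
Lemma boundary_Rperp f : DP_boundary 0 f -> in_Rperp f.
Proof.
case=> g [dg sg0] fE.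
exists (fun T => DP_diff (restrict_to T g)); last first.
  move=> T p; rewrite fE /DP_diff exchange_big /=; apply: eq_bigr => e _.
  rewrite -scaler_sumr; congr (_ *: _); rewrite /restrict_to.
  have [h|h] := boolP ((nvert (contract e)).+2 == #|I|).
    rewrite (bigD1 (contract e)) //= eqxx big1 ?addr0 // => T' /andP[_ /negPf].
    by rewrite eq_sym => ->.
  rewrite sg0; last by apply: contra h => /eqP h; apply/eqP; lia.
  rewrite big1 // => T' h'; case: eqP => // e1; by rewrite e1 h' in h.
move=> T nT; split.
- split=> [T'|T' p]; first exact: DP_diff_dual (restrict_dual T dg).
  move=> T'j; rewrite /DP_diff big1 // => e _; rewrite /restrict_to.
  case: eqP => [eT|]; last by rewrite scaler0.
  by case/eqP: T'j; rewrite (edge_nvert e) eT; lia.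
- move=> T' p TT'; rewrite /DP_diff big1 // => e _; rewrite /restrict_to.
  case: eqP => [eT|]; last by rewrite scaler0.
  by case/negP: TT'; rewrite -eT; apply: subsetDl.
move=> v N c t [_ _ [q [x [tE sx]]]].
have [[lg _] _] := dg T.
(* Zero is written as [g T] of the vanishing combination at [v]. In each term only the edge
   contracted in [t j] survives, and its sign squares to one. *)
rewrite -[RHS](linear_sum0 (L := fun y => g T (dfwith q y)) (lg q v) sx).
apply: eq_bigr => j _; rewrite -scalerA; congr (_ *: _).
have gE : g T (dfwith q (x j)) =
    g (contract (tagged (t j)).1) (contract_dec (tagged (t j)).1 (tagged (t j)).2).
  by move: (congr1 (fun z : {T : rtree I & dec P T} => g (tag z) (tagged z)) (tE j)).
have cT : contract (tagged (t j)).1 = T := congr1 (@tag _ _) (tE j).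
rewrite gE /DP_diff (bigD1 (tagged (t j)).1) //= big1 ?addr0; last first.
  move=> e ej; rewrite /restrict_to; case: eqP => [eT|]; last by rewrite scaler0.
  by case/eqP: ej; apply: contract_inj; rewrite eT cT.
by rewrite scalerA -[edge_sign _ _ _]/(sg k _ _) sg_sq scale1r /restrict_to ifT // cT eqxx.
Qed.

Section FromRperp.
Variable G : rtree I -> forall T : rtree I, dec P T -> opK P.
Arguments G : clear implicits.
Hypothesis GR : forall T, (nvert T).+2 = #|I| -> Rperp_at T (G T).

(** Candidate primitive: its value at [T] is read off one compatible expansion of [T]. The choice of
    expansion is immaterial by [expandE]. *)
Definition expand T s c : opK P :=
  if ((nvert T).+2 == #|I|) && compat s (val T) then
    if [pick A | (A \notin val T) && compat s (A |: val T)] is Some A then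
      sg k (A |: val T) A *: coord (G T) s c (A |: val T)
    else 0
  else 0.

(** The chosen expansion and [T] itself form a two-term relation over [contract e]. Since [G]
    annihilates it, the two signed values agree. *)
Lemma expandE (T : rtree I) (e : edge T) s c : (nvert T).+1 = #|I| ->
  ordering s -> compat s (val T) ->
  edge_sign k T (val e) *: expand (contract e) s c
  = G (contract e) T (std_dec k T s (inner c)).
Proof.
move=> nT os cT; have nC : (nvert (contract e)).+2 = #|I| by rewrite -edge_nvert.
have [eT eF] := edgeP e.
have eN : val e \notin val (contract e) by rewrite in_setD1 eqxx.
have TE : val T = val e |: val (contract e) by rewrite setD1K.
rewrite /expand nC eqxx (contract_compat e cT) /=.
case: pickP => [A /andP[AT cA]|/(_ (val e))]; last by rewrite eN -TE cT.
have tA := compat_tree cA; pose TA : rtree I := Sub (A |: val (contract e)) tA.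
have [eA eAE] := edge_set1U (erefl (val TA)) AT.
have {}cA : compat s (val TA) by [].
have [v rel] := flip_relation c (erefl (val TA)) AT eAE TE eN erefl nC os cA cT.
have [_ _ /(_ v _ _ _ rel)] := GR nC.
rewrite !big_ord_recl big_ord0 /= expr0 expr1 mul1r mulN1r addr0 scaleNr => /subr0_eq.
rewrite -[A |: _]/(val TA) coordE eAE -[edge_sign _ _ _]/(sg k (val TA) A) => ->.
by rewrite scalerA -[edge_sign _ _ _]/(sg k (val T) (val e)) sg_sq scale1r.
Qed.

Lemma Rperp_boundary f : in_DP 0 f ->
  (forall T' (p : dec P T'), f T' p = \sum_(T | (nvert T).+2 == #|I|) G T T' p) ->
  DP_boundary 0 f.
Proof.
move=> [df supp] fE.
have dg (T : rtree I) : in_dual T (functional_of expand T).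
  apply: functional_of_dual => // s c b os ors; rewrite /expand.
  have [nT|_] := eqVneq (nvert T).+2 #|I|; last exact/esym/lact0.
  case: (compat s (val T)); last exact/esym/lact0.
  case: [pick A | _] => [A|]; last exact/esym/lact0.
  have [[dG _] _ _] := GR nT.
  rewrite coord_recol //; have := lact_linearr (kflip k b) (sg k (A |: val T) A)
     (coord (G T) s c (A |: val T)) 0.
  by rewrite lact0 !addr0.
exists (functional_of expand).
  split=> // T p nT; apply: functional_of0 => s c; rewrite /expand.
  case: ifP => // /andP[/eqP h _]; case/eqP: nT; lia.
move=> T; apply: balanced_eq; [by have [] := df T|by have [] := DP_diff_dual T dg|].
move=> s eta os ors cs; have tT : is_tree (val T) := valP T.
have cT : compat s (val T) by apply/compatP.
rewrite (balanced_inner I1 _ _ (proj1 (df T))).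
have [nT|nT] := eqVneq (nvert T).+1 #|I|; last first.
  rewrite supp; last by apply: contra nT => /eqP h; apply/eqP; lia.
  rewrite /DP_diff big1 // => e _; rewrite functional_of0 ?scaler0 // => s' c.
  rewrite /expand; case: ifP => // /andP[/eqP h _].
  by rewrite (edge_nvert e) h eqxx in nT.
have -> : DP_diff (functional_of expand) T (std_dec k T s eta) =
    \sum_(e : edge T) G (contract e) T (std_dec k T s (inner (outer eta))).
  apply: eq_bigr => e _; rewrite -expandE //; congr (_ *: _).
  rewrite contract_std_dec //; last exact: cs (edgeP e).2.
  by rewrite functional_of_std_dec //; apply: contract_compat.
rewrite fE.
have nC (e : edge T) : ((nvert (contract e)).+2 == #|I|) by rewrite -edge_nvert nT.
(* Each edge of [T] is credited to the one tree it contracts to, so that both sides become sums over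
   trees with [#|I| - 2] vertices. *)
rewrite [RHS](eq_bigr (fun e : edge T => \sum_(T' | (nvert T').+2 == #|I|)
   (if contract e == T' then G T' T (std_dec k T s (inner (outer eta))) else 0))); last first.
  move=> e _; rewrite (bigD1 (contract e)) //= eqxx big1 ?addr0 // => T' /andP[_].
  by rewrite eq_sym => /negPf->.
rewrite exchange_big /=; apply: eq_bigr => T' /eqP nT'.
have [sub|nsub] := boolP (val T' \subset val T); last first.
  have [_ -> // _] := GR nT'.
  by rewrite big1 // => e _; case: ifP.
(* A subfamily of [T] with one vertex fewer arises from exactly one contraction. *)
have T'lt : (nvert T' < nvert T)%N by rewrite -ltnS nT -nT'.
have [e eT] : exists e : edge T, contract e = T'.
  have : (0 < #|val T :\: val T'|)%N by rewrite cardsD (setIidPr sub) subn_gt0.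
  case/card_gt0P => B /setDP[BT BT'].
  have Bn : B != [set: I] by apply: contraNneq BT' => ->; apply: tree_setT (valP T').
  have BE : B \in val T :\ [set: I] by rewrite in_setD1 Bn.
  exists (Sub B BE); apply: val_inj; apply/eqP; rewrite eq_sym eqEcard /=.
  apply/andP; split.
    by apply/subsetP => C CT'; rewrite in_setD1 (subsetP sub) // andbT; apply: contraNneq BT' => <-.
  have := cardsD1 B (val T); rewrite BT add1n => h.
  have Tle : (nvert T <= (nvert T').+1)%N by rewrite -ltnS nT -nT'.
  by rewrite -ltnS -h.
rewrite (bigD1 e) //= eT eqxx big1 ?addr0 // => e' ee'.
by case: eqP => // h; case/eqP: ee'; apply: contract_inj; rewrite h.
Qed.

End FromRperp.

Lemma Rperp_boundaryE f : in_DP 0 f -> in_Rperp f <-> DP_boundary 0 f.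
Proof.
move=> f0; split; last exact: boundary_Rperp.
by case=> G GR fE; exact: (@Rperp_boundary G GR f f0 fE).
Qed.

End Relations.

(** * Quadraticity *)

Section Quadratic.
Variables (k : fieldType) (I : finType).
Local Notation P := (MAss k).
Hypothesis I1 : (1 < #|I|)%N.

Lemma ext_compose_balanced (W : lmodType k) theta (T : rtree I) :
  balanced (fun p : dec P T => ext (W := W) theta (compose p)).
Proof.
have [[lC fC] _ _] := composeP k T.
split=> [p v a x y|p v w i c iw]; first by rewrite lC ext_linear.
by rewrite (fC _ _ w).
Qed.

(** There is no determinant here, so a two-term relation becomes an equality without signs. *)
Lemma coord_flip (W : lmodType k) (f : forall T : rtree I, dec P T -> W) s c :
  (forall T (v : vert T) N (a : 'I_N -> k) (t : 'I_N -> pointed_dec P I),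
     relation_at v a t -> \sum_j a j *: f (tag (t j)) (tagged (t j)).2 = 0) ->
  ordering s ->
  forall (F : {set {set I}}) A B, compat s F -> #|F|.+2 = #|I| ->
    A \notin F -> B \notin F ->
    compat s (A |: F) -> compat s (B |: F) ->
    coord f s c (A |: F) = coord f s c (B |: F).
Proof.
move=> rel os F A B cF nF AF BF cA cB.
pose T : rtree I := Sub F (compat_tree cF).
pose TA : rtree I := Sub (A |: F) (compat_tree cA).
pose TB : rtree I := Sub (B |: F) (compat_tree cB).
have TAE : val TA = A |: val T by []. have TBE : val TB = B |: val T by [].
have {}AF : A \notin val T by []. have {}BF : B \notin val T by [].
have [eA eAE] := edge_set1U TAE AF; have [eB eBE] := edge_set1U TBE BF.
have cA' : compat s (val TA) by []. have cB' : compat s (val TB) by [].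
have nT : (nvert T).+2 = #|I| by [].
have [v rAB] := flip_relation k c TAE AF eAE TBE BF eBE nT os cA' cB'.
have := rel _ _ _ _ _ rAB.
rewrite !big_ord_recl big_ord0 /= expr0 expr1 scale1r scaleN1r addr0 => /subr0_eq.
by rewrite -!coordE.
Qed.

(** Flips join every binary tree compatible with an order to its comb, so a map killing the
    relations is determined by its values on combs, which define the factorisation. It is unique
    because each basis vector is the composite of a decorated comb. *)
Lemma quadratic_MAss : quadratic_in P I.
Proof.
move=> W f bf rel /=.
have comb_tree s : ordering s -> oriented s -> exists T : rtree I,
    [/\ val T = comb s, compat s (val T) & binary T].
  case: s => // x s; set t := x :: s => ot ort.
  have t0 : index x t = 0%N by rewrite /= eqxx.
  have cc := comb_compat t I1.
  exists (Sub (comb t) (compat_tree cc)); split=> //.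
  by rewrite binary_card -(comb_card ot t0 I1).
pose theta s c := coord f s c (comb s).
pose g : {linear op_sp P I -> W} :=
  HB.pack (ext theta) (GRing.isLinear.Build _ _ _ _ (ext theta) (ext_linear theta)).
have gE : g = ext theta :> (_ -> _) by [].
have gf (T : rtree I) (p : dec P T) x : binary T -> composite p x -> f T p = g x.
  move=> bT /compositeP <-; rewrite gE; move: p.
  apply: balanced_eq; [exact: bf|exact: ext_compose_balanced|].
  move=> s eta os ors cs; have [_ _ cC] := composeP k T; rewrite cC // ext_bas //.
  rewrite (balanced_coord I1 _ _ (bf _ bT)) /theta.
  case: s os ors cs => // i0 t; set s := i0 :: t => os ors cs.
  have s0 : index i0 s = 0%N by rewrite /= eqxx.
  apply: (flip_const os s0 I1 (coord_flip (outer eta) rel os)).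
    by apply/compatP; split=> //; exact: valP T.
  by move: bT; rewrite binary_card => /eqP; rewrite /nvert => ->; case: #|I| I1.
exists g => // g' g'f; apply: mass_ind_oriented => // [a x y Hx Hy|s c os ors].
  by rewrite !linearP Hx Hy.
have [T [eT cT bT]] := comb_tree s os ors.
have cp : composite (std_dec k T s (inner c)) (bas k s c).
  apply/compositeP; have [_ _ cC] := composeP k T.
  by rewrite cC ?innerK //; case/compatP: cT.
by rewrite -(g'f _ _ _ bT cp) -(gf _ _ _ bT cp).
Qed.

End Quadratic.

(** * Semisimplicity of K *)

Section Semisimple.
Variable k : fieldType.
Local Notation P := (MAss k).
Local Notation K := (opK P).

Definition act_a : K -> K := lact (kflip k true).

HB.instance Definition _ := GRing.isLinear.Build k K K _ act_a
  (lact_linearr (kflip k true)).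

(** Maschke's argument for the group of order two: [q] averages a projection onto [U] over
    conjugation by [a], and its kernel is an invariant complement. *)
Lemma semisimple_MAss : 2%:R != 0 :> k -> semisimpleK P.
Proof.
move=> char_neq2 U idU.
have aK : involutive act_a by move=> x; apply: lact_flipK.
pose q x : K := 2%:R^-1 *: (projv U x + act_a (projv U (act_a x))).
have linq : linear q.
  move=> a x y; rewrite /q [act_a (a *: x + y)]linearP.
  rewrite ![projv U (a *: _ + _)]linearP [act_a (a *: _ + _)]linearP.
  rewrite scalerA [a * _]mulrC -scalerA -[RHS]scalerDr; congr (_ *: _).
  by rewrite scalerDr addrACA.
pose qL : {linear K -> K} := HB.pack q (GRing.isLinear.Build _ _ _ _ q linq).
have aU x : x \in U -> act_a x \in U by apply: idU.
have qU x : q x \in U by rewrite memvZ // memvD ?aU ?memv_proj.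
have qid x : x \in U -> q x = x.
  move=> xU; rewrite /q !projv_id ?aU // aK -mulr2n -scaler_nat scalerA.
  by rewrite mulVf ?scale1r.
have qa x : q (act_a x) = act_a (q x).
  have aZD b u v : act_a (b *: (u + v)) = b *: (act_a u + act_a v).
    by rewrite linearZ linearD.
  by rewrite /q aK aZD aK addrC.
pose V := lker (linfun qL).
have VE x : (x \in V) = (q x == 0) by rewrite memv_ker lfunE.
exists V; split.
- move=> c x xV; elim/kflip_ind: c => [a c d Hc Hd|b].
    by rewrite lactDl memvD // memvZ.
  case: b; last by rewrite lact_unit.
  by move: xV; rewrite !VE -[lact _ _]/(act_a x) qa => /eqP->; rewrite linear0.
- apply/vspaceP => x; rewrite memvf.
  have {1}-> : x = q x + (x - q x) by rewrite addrC subrK.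
  by rewrite memv_add // VE addrC -scaleN1r linq qid // scaleN1r addNr.
apply/eqP; rewrite -subv0; apply/subvP => x; rewrite memv_cap => /andP[xU].
by rewrite VE qid // memv0.
Qed.

End Semisimple.

Theorem corollary4p3p7 (k : fieldType) (char_neq2 : (2%:R != 0 :> k)%R) :
  [/\ is_operad (MAss k), quadratic (MAss k) & koszul (MAss k)].
Proof.
split; first exact: MAss_is_operad.
  by move=> n n2; apply: quadratic_MAss; rewrite card_ord.
split=> [|n n2]; first exact: semisimple_MAss.
have I1 : (1 < #|'I_n|)%N by rewrite card_ord.
split=> [j j0|f f0]; first exact: exact_MAss.
exact: Rperp_boundaryE.
Qed.
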